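(* Let $(M,g)$ be a connected Hermitian manifold with torsion-twisted connection $\nabla^T$, and let $\mathcal{F}\subset T^{1,0}M$ be the holomorphic distribution with fibers $$\mathcal{F}_x=\{\xi\in T^{1,0}_xM \mid \mathrm{Hol}_x(\nabla^T)\xi=\xi\},$$ where $\mathrm{Hol}_x(\nabla^T)\subset GL(T^{1,0}_xM)$ is the holonomy group of $\nabla^T$ at $x$. Then $\mathcal{F}$ is Frobenius-integrable, i.e. $$[\mathcal{F},\mathcal{F}]\subset\mathcal{F}.$$ Moreover, if $\xi_1,\dots,\xi_r$ is a $\nabla^T$-parallel basis of $\mathcal{F}$, then $$[\xi_i,\xi_j]=c_{ij}^k\xi_k,$$ with the structure constants $c_{ij}^k=c_{ij}^k(x)$ independent of $x\in M$.
   Context: A Hermitian manifold $(M,g)$ is a complex manifold with a Riemannian metric $g$ invariant under the almost complex structure $J$. The Chern connection $\nabla$ is the unique unitary connection on $TM$ with $\nabla^{0,1}=\bar\partial$ on $\Gamma(T^{1,0}M)$; its torsion is $T(X,Y)=\nabla_XY-\nabla_YX-[X,Y]$. The torsion-twisted connection is $\nabla^T_XY=\nabla_XY-T(X,Y)$, extended to $TM\otimes\mathbb{C}$; it preserves $T^{1,0}M$ and satisfies $(\nabla^T)^{0,1}=\bar\partial$ on $\Gamma(T^{1,0}M)$. $\mathrm{Hol}_x(\nabla^T)$ is the group generated by $\nabla^T$-parallel transport on $T^{1,0}M$ along all smooth loops based at $x$, and $\mathcal F_x$ is the set of vectors fixed by every element of this group. $\mathcal{F}=\bigcup_x\mathcal{F}_x$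 is a holomorphic subbundle of $T^{1,0}M$, invariant under $\nabla^T$-parallel transport; every $\xi\in\mathcal{F}_x$ extends to a global $\nabla^T$-parallel section of $\mathcal{F}$, and every $\nabla^T$-parallel section of $T^{1,0}M$ is a section of $\mathcal F$. Summation over repeated indices is understood. *)

(* Defs.v *)
From HB Require Import structures.
From mathcomp Require Import all_boot all_order all_algebra.
From mathcomp Require Import all_classical all_reals all_analysis.
From mathcomp Require Import complex.
Set Implicit Arguments.
Unset Strict Implicit.
Unset Printing Implicit Defensive.
Import Order.TTheory GRing.Theory Num.Theory.
Import numFieldNormedType.Exports.
Local Open Scope classical_set_scope.
Local Open Scope ring_scope.
Local Open Scope complex_scope.

Section Smoothness.
Context {R : realType} {V : normedModType R}.

(* [Ck k U f] is meant for open U. *)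
Fixpoint Ck (k : nat) (U : set V) (f : V -> R) : Prop :=
  match k with
  | 0%N => forall p, U p -> {for p, continuous f}
  | k'.+1 => (forall p, U p -> differentiable f p) /\
             (forall v : V, Ck k' U (fun p => 'D_v f p))
  end.

Definition smooth_on (U : set V) (f : V -> R) : Prop := forall k, Ck k U f.

Definition csmooth_on (U : set V) (f : V -> R[i]) : Prop :=
  smooth_on U (fun p => complex.Re (f p)) /\
  smooth_on U (fun p => complex.Im (f p)).

Definition cderivable (f : V -> R[i]) (p v : V) : Prop :=
  derivable (fun q => complex.Re (f q)) p v /\
  derivable (fun q => complex.Im (f q)) p v.

Definition cderive (f : V -> R[i]) (p v : V) : R[i] :=
  ('D_v (fun q => complex.Re (f q)) p : R) +i*
  ('D_v (fun q => complex.Im (f q)) p : R).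

End Smoothness.

(* C^n is identified with R^(n+n) by z = x + i y |-> (x, y); [stdJ] is then
   multiplication by i.  It is polymorphic so as to apply to real vectors as
   well as to their complexification. *)
Definition stdJ {T : pzRingType} {n : nat} (u : 'rV[T]_(n + n)) :
  'rV[T]_(n + n) := row_mx (- rsubmx u) (lsubmx u).

(* Smooth maps satisfying the Cauchy-Riemann equations dF o J = J o dF. *)
Definition holomorphic_on {R : realType} {n : nat} (W : set 'rV[R]_(n + n))
    (F : 'rV[R]_(n + n) -> 'rV[R]_(n + n)) : Prop :=
  (forall k, smooth_on W (fun p => F p ord0 k)) /\
  (forall p v, W p -> 'D_(stdJ v) F p = stdJ ('D_v F p)).

(* [chart_inv] is only meaningful on the image of [chart_dom]. *)
Record chart (R : realType) (n : nat) (M : Type) := Chart {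
  chart_dom : set M;
  chart_map : M -> 'rV[R]_(n + n);
  chart_inv : 'rV[R]_(n + n) -> M }.

Definition is_chart {R : realType} {n : nat} {M : topologicalType}
    (c : chart R n M) : Prop :=
  [/\ open (chart_dom c),
      open (chart_map c @` chart_dom c),
      (forall x, chart_dom c x -> chart_inv c (chart_map c x) = x),
      (forall x, chart_dom c x -> {for x, continuous (chart_map c)}) &
      (forall p, (chart_map c @` chart_dom c) p -> {for p, continuous (chart_inv c)})].

Record complexManifold (R : realType) (n : nat) := ComplexManifold {
  carrier :> topologicalType;
  atlas : set (chart R n carrier);
  manifold_hausdorff : hausdorff_space carrier;
  manifold_second_countable : @second_countable carrier;
  atlas_chart : forall c, atlas c -> is_chart c;
  atlas_cover : forall x, exists2 c, atlas c & chart_dom c x;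
  atlas_holomorphic : forall c c', atlas c -> atlas c' ->
    holomorphic_on (chart_map c @` (chart_dom c `&` chart_dom c'))
      (fun p => chart_map c' (chart_inv c p)) }.

Section HermitianManifold.
Context {R : realType} {n : nat} {M : complexManifold R n}.
Local Notation C := R[i].

Definition smooth_fun (U : set M) (f : M -> C) : Prop :=
  forall c : chart R n M, atlas c ->
    csmooth_on (chart_map c @` (U `&` chart_dom c)) (fun p => f (chart_inv c p)).

Definition smooth_near (x : M) (f : M -> C) : Prop :=
  exists U : set M, [/\ open U, U x & smooth_fun U f].

(* A vector at x is identified with its directional derivative operator on
   complex functions smooth near x; it is set to 0 on the other functions, so
   that equality of vectors is Leibniz equality. *)
Definition tvec := (M -> C) -> C^o.
Definition vfield := M -> tvec.

(* The vector of T_xM (x) C with complex components u in the chart c, with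
   respect to d/dx^1, ..., d/dx^n, d/dy^1, ..., d/dy^n. *)
Definition chart_vec (c : chart R n M) (x : M) (u : 'rV[C]_(n + n)) : tvec :=
  fun f => if `[< smooth_near x f >]
    then \sum_k u ord0 k *
           cderive (fun p => f (chart_inv c p)) (chart_map c x) (delta_mx ord0 k)
    else 0.

Definition tangent (x : M) (v : tvec) : Prop :=
  exists (c : chart R n M) (u : 'rV[R]_(n + n)),
    [/\ atlas c, chart_dom c x & v = chart_vec c x (map_mx (real_complex R) u)].

(* The graph of the almost complex structure, extended to T_xM (x) C. *)
Definition is_J (x : M) (v w : tvec) : Prop :=
  exists (c : chart R n M) (u : 'rV[C]_(n + n)),
    [/\ atlas c, chart_dom c x, v = chart_vec c x u & w = chart_vec c x (stdJ u)].

Definition T10 (x : M) (v : tvec) : Prop := is_J x v (('i%C : C) *: v).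
Definition T01 (x : M) (v : tvec) : Prop := is_J x v (- ('i%C : C) *: v).

(* Smooth sections over an open set U of TM (x) C, and of TM, T^{1,0}M and
   T^{0,1}M.  The values of a field outside U are irrelevant. *)
Definition csection (U : set M) (X : vfield) : Prop :=
  forall c : chart R n M, atlas c ->
    exists u : M -> 'rV[C]_(n + n),
      (forall k, smooth_fun (U `&` chart_dom c) (fun x => u x ord0 k)) /\
      (forall x, U x -> chart_dom c x -> X x = chart_vec c x (u x)).

Definition section_in (P : M -> tvec -> Prop) (U : set M) (X : vfield) : Prop :=
  csection U X /\ (forall x, U x -> P x (X x)).

Definition rsection := section_in tangent.
Definition section10 := section_in T10.
Definition section01 := section_in T01.

Definition bracket (X Y : vfield) : vfield := fun x f =>
  if `[< smooth_near x f >]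
  then X x (fun y => Y y f) - Y x (fun y => X y f) else 0.

(* v = re_vec v + i im_vec v, with re_vec v and im_vec v in T_xM. *)
Definition re_vec (v : tvec) : tvec := fun f =>
  (v f + conjc (v (fun y => conjc (f y)))) / 2%:R.
Definition im_vec (v : tvec) : tvec := fun f =>
  (v f - conjc (v (fun y => conjc (f y)))) / (2%:R * 'i%C).

Definition re_field (X : vfield) : vfield := fun x => re_vec (X x).
Definition im_field (X : vfield) : vfield := fun x => im_vec (X x).

Record hermitian_metric (g : M -> tvec -> tvec -> R) : Prop := {
  metric_sym : forall x v w, tangent x v -> tangent x w -> g x v w = g x w v;
  metric_linear : forall x (a : R) v v' w,
    tangent x v -> tangent x v' -> tangent x w ->
    g x (a%:C *: v + v') w = a * g x v w + g x v' w;
  metric_pos : forall x v, tangent x v -> v != 0 -> 0 < g x v v;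
  metric_smooth : forall U X Y, open U -> rsection U X -> rsection U Y ->
    smooth_fun U (fun x => (g x (X x) (Y x))%:C);
  metric_J : forall x v v' w w', tangent x v -> tangent x w ->
    is_J x v v' -> is_J x w w' -> g x v' w' = g x v w }.

(* A connection on TM acts on local smooth sections; locality follows from the
   Leibniz rule applied to indicator functions of open sets. *)
Record connection (D : vfield -> vfield -> vfield) : Prop := {
  conn_section : forall U X Y, open U -> rsection U X -> rsection U Y ->
    rsection U (D X Y);
  conn_addl : forall U X X' Y x, open U -> U x ->
    rsection U X -> rsection U X' -> rsection U Y ->
    D (fun y => X y + X' y) Y x = D X Y x + D X' Y x;
  conn_addr : forall U X Y Y' x, open U -> U x ->
    rsection U X -> rsection U Y -> rsection U Y' ->
    D X (fun y => Y y + Y' y) x = D X Y x + D X Y' x;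
  conn_scale : forall U (f : M -> R) X Y x, open U -> U x ->
    smooth_fun U (fun y => (f y)%:C) -> rsection U X -> rsection U Y ->
    D (fun y => (f y)%:C *: X y) Y x = (f x)%:C *: D X Y x;
  conn_leibniz : forall U (f : M -> R) X Y x, open U -> U x ->
    smooth_fun U (fun y => (f y)%:C) -> rsection U X -> rsection U Y ->
    D X (fun y => (f y)%:C *: Y y) x =
      X x (fun y => (f y)%:C) *: Y x + (f x)%:C *: D X Y x }.

(* Extension of a connection on TM to TM (x) C, C-linear in both arguments. *)
Definition complexify (D : vfield -> vfield -> vfield) : vfield -> vfield -> vfield :=
  fun X Y x =>
    D (re_field X) (re_field Y) x - D (im_field X) (im_field Y) x +
    ('i%C : C) *: (D (re_field X) (im_field Y) x + D (im_field X) (re_field Y) x).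

(* d/dz^k = (d/dx^k - i d/dy^k) / 2 *)
Definition dz (c : chart R n M) (k : 'I_n) : vfield := fun x =>
  chart_vec c x ((2%:R^-1 : C) *: row_mx (delta_mx ord0 k)
                                  (- ('i%C : C) *: delta_mx ord0 k)).

(* [chern_dbar] is nabla^{0,1} = dbar on T^{1,0}M, where
   dbar_W (sum_k Z^k d/dz^k) = sum_k W(Z^k) d/dz^k for W of type (0,1). *)
Record chern_connection (g : M -> tvec -> tvec -> R)
    (D : vfield -> vfield -> vfield) : Prop := {
  chern_conn : connection D;
  chern_metric : forall U X Y Z x, open U -> U x ->
    rsection U X -> rsection U Y -> rsection U Z ->
    X x (fun y => (g y (Y y) (Z y))%:C) =
      (g x (D X Y x) (Z x) + g x (Y x) (D X Z x))%:C;
  chern_J : forall U X Y JY x, open U -> U x ->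
    rsection U X -> rsection U Y -> rsection U JY ->
    (forall y, U y -> is_J y (Y y) (JY y)) -> is_J x (D X Y x) (D X JY x);
  chern_dbar : forall (c : chart R n M) U W (Z : 'I_n -> M -> C) x,
    atlas c -> open U -> U `<=` chart_dom c -> U x -> section01 U W ->
    (forall k, smooth_fun U (Z k)) ->
    complexify D W (fun y => \sum_k Z k y *: dz c k y) x =
      \sum_k W x (Z k) *: dz c k x }.

Definition torsion (D : vfield -> vfield -> vfield) : vfield -> vfield -> vfield :=
  fun X Y x => D X Y x - D Y X x - bracket X Y x.

Definition torsion_twisted (D : vfield -> vfield -> vfield) :
    vfield -> vfield -> vfield :=
  fun X Y x => D X Y x - torsion D X Y x.

(* Smooth curves [0, 1] -> M, i.e. smooth on an open neighbourhood of [0, 1];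
   the other values of gamma are irrelevant. *)
Definition smooth_curve (gamma : R -> M) : Prop :=
  exists I : set R,
    [/\ open I, `[0, 1] `<=` I,
        (forall t, I t -> {for t, continuous gamma}) &
        (forall c : chart R n M, atlas c -> forall k,
          smooth_on (I `&` gamma @^-1` chart_dom c)
            (fun t => chart_map c (gamma t) ord0 k))].

Definition smooth_loop (x : M) (gamma : R -> M) : Prop :=
  [/\ smooth_curve gamma, gamma 0 = x & gamma 1 = x].

Definition velocity (gamma : R -> M) (t : R) : tvec := fun f =>
  if `[< smooth_near (gamma t) f >]
  then cderive (fun s => f (gamma s)) t 1 else 0.

(* w is the covariant derivative at t of the field Y along gamma with values
   in T^{1,0}M, for the connection D on TM (x) C: if Y = sum_j y_j E_j(gamma)
   near t, then w = sum_j (y_j' E_j + y_j D_{gamma'} E_j). *)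
Definition cov_deriv (D : vfield -> vfield -> vfield) (gamma : R -> M)
    (Y : R -> tvec) (t : R) (w : tvec) : Prop :=
  exists (U : set M) (X : vfield) (m : nat) (E : 'I_m -> vfield)
      (y : 'I_m -> R -> C),
    [/\ open U /\ U (gamma t),
        rsection U X /\ X (gamma t) = velocity gamma t,
        (forall j, section10 U (E j) /\ cderivable (y j) t 1),
        (\forall s \near t, Y s = \sum_j y j s *: E j (gamma s)) &
        w = \sum_j (cderive (y j) t 1 *: E j (gamma t) +
                    y j t *: D X (E j) (gamma t))].

Definition parallel_transport (D : vfield -> vfield -> vfield) (gamma : R -> M)
    (v w : tvec) : Prop :=
  exists Y : R -> tvec,
    [/\ Y 0 = v, Y 1 = w,
        (forall t, 0 <= t <= 1 -> T10 (gamma t) (Y t)) &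
        (forall t, 0 <= t <= 1 -> cov_deriv D gamma Y t 0)].

(* Hol_x(D), a subgroup of GL(T^{1,0}_xM); its elements are represented by
   maps on all vectors, of which only the restriction to T^{1,0}_xM matters. *)
Inductive holonomy (D : vfield -> vfield -> vfield) (x : M) :
    (tvec -> tvec) -> Prop :=
| holonomy_loop gamma h : smooth_loop x gamma ->
    (forall v, T10 x v -> parallel_transport D gamma v (h v)) ->
    holonomy D x h
| holonomy_id : holonomy D x id
| holonomy_comp h k : holonomy D x h -> holonomy D x k ->
    holonomy D x (h \o k)
| holonomy_inv h k : holonomy D x h ->
    (forall v, T10 x v -> [/\ T10 x (k v), h (k v) = v & k (h v) = v]) ->
    holonomy D x k.

Definition hol_fixed (D : vfield -> vfield -> vfield) (x : M) (v : tvec) : Prop :=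
  T10 x v /\ (forall h, holonomy D x h -> h v = v).

Definition frobenius_integrable (F : M -> tvec -> Prop) : Prop :=
  forall (U : set M) (X Y : vfield), open U ->
    section_in F U X -> section_in F U Y -> section_in F U (bracket X Y).

Definition parallel_section (D : vfield -> vfield -> vfield) (xi : vfield) : Prop :=
  forall (U : set M) (X : vfield) x, open U -> U x -> csection U X ->
    D X xi x = 0.

Definition is_frame (F : M -> tvec -> Prop) (r : nat) (xi : 'I_r -> vfield) :
    Prop :=
  (forall i, section_in F setT (xi i)) /\
  (forall x,
    (forall a : 'I_r -> C, \sum_i a i *: xi i x = 0 -> forall i, a i = 0) /\
    (forall v, F x v -> exists a : 'I_r -> C, v = \sum_i a i *: xi i x)).

End HermitianManifold.

Arguments tvec {R n} M.
Arguments vfield {R n} M.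

(* Main.v *)
Require Import Defs.
From mathcomp Require Import all_boot all_order all_algebra.
From mathcomp Require Import all_classical all_reals all_analysis.
From mathcomp Require Import complex ring lra.
Set Implicit Arguments.
Unset Strict Implicit.
Unset Printing Implicit Defensive.
Import Order.TTheory GRing.Theory Num.Theory.
Import numFieldNormedType.Exports.
Local Open Scope classical_set_scope.
Local Open Scope ring_scope.
Local Open Scope complex_scope.

(* Parallel transport extends a holonomy-fixed vector to a global section of T^{1,0}M, which in a
   chart solves a total linear system along every line and is therefore smooth and parallel.
   Conversely the values of a parallel section are holonomy-fixed, so F is spanned by global
   parallel sections.  Let Gam be the matrix of nabla^T in a chart, a form of type (1,0).  For
   sections p, q of T^{1,0}M,
     [p, q] = nabla^T_p q - nabla^T_q p + (p Gam(q) - q Gam(p)).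
   If p and q are parallel, only the last bracket remains, and it is parallel again because the
   (2,0) part of the Chern curvature vanishes: with h the matrix of g, the Chern connection form
   is (dh) h^-1.  For arbitrary sections of F, nabla^T preserves F, and the last bracket at x only
   depends on p(x) and q(x), so it may be computed from parallel extensions.  Parallel sections
   that agree at one point coincide, hence the structure constants do not depend on the point. *)

(** * Functions of class C^k *)

(** Since [nabla^T_X Y = nabla_Y X + [X, Y]], passing from the Chern connection to [nabla^T] only
    exchanges the two lower indices of the Christoffel symbols. The symbols that would give [Gam] a
    (0,1) part are those of [nabla_Z W] with [Z] of type (1,0) and [W] of type (0,1); they vanish,
    being conjugate to those killed by [nabla^{0,1} = dbar]. The bracket [p Gam(q) - q Gam(p)] is
    the Chern torsion [T(p, q)].

    Two obstacles shape the rest. Holonomy is defined by smooth, not piecewise smooth, loops, and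
    covariant derivatives along curves are two-sided even at the ends; so paths are reparametrised
    by a function flat at the junction before they are joined, and solutions are kept on intervals
    slightly larger than needed. And [F] is only a family of sets of vectors: a smooth section of it
    comes without smooth coefficients in a parallel frame. That [nabla^T] preserves [F] is therefore
    shown through linear equations with smooth coefficients that vanish on [F], not by
    differentiating coefficients. *)

Section Calculus.
Context {R : realType} {V : normedModType R}.
Implicit Types (U : set V) (f g : V -> R) (p v : V).

(** The little-o definition unfolded, for use where the differential is known in advance: that of a
    function with the same germ, or zero. *)
Lemma differentiable_intro f (L : {linear V -> R}) p : continuous L ->
  (forall e : R, 0 < e -> \forall h \near 0, `|f (h + p) - f p - L h| <= e * `|h|) ->
  differentiable f p /\ 'd f p = L :> (V -> R).
Proof.
move=> Lc H.
have E : f \o shift p = cst (f p) + L +o_0 id.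
  apply/eqaddoP => e /H; apply: filterS => h.
  by rewrite /cst /= !fctE /= opprD addrA.
have D := diff_unique Lc E; split=> //.
by apply/diff_locallyP; rewrite D.
Qed.

Lemma differentiable_eps f p (e : R) : differentiable f p -> 0 < e ->
  \forall h \near 0, `|f (h + p) - f p - 'd f p h| <= e * `|h|.
Proof.
move=> /diff_locally/eqaddoP H /H; apply: filterS => h.
by rewrite /cst /= !fctE /= opprD addrA.
Qed.

Lemma near_eq_differentiable f g p : (\forall q \near p, f q = g q) ->
  differentiable f p -> differentiable g p.
Proof.
move=> fg df.
have fgp : f p = g p by exact: nbhs_singleton fg.
have [//|e e0|] := @differentiable_intro g ('d f p) p; first exact: diff_continuous.
near=> h.
have <- : f (h + p) = g (h + p).
  near: h; move: fg; rewrite (near_shift 0 p) /= subr0; apply: filterS => h /=.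
  by rewrite addrC.
by rewrite -fgp; near: h; apply: differentiable_eps.
Unshelve. all: by end_near.
Qed.

Lemma near_eq_continuous_at (T T' : topologicalType) (f g : T -> T') (p : T) :
  (\forall q \near p, f q = g q) -> {for p, continuous f} -> {for p, continuous g}.
Proof.
move=> fg; rewrite /prop_for /continuous_at (nbhs_singleton fg) => H.
exact: cvg_trans (near_eq_cvg _) H.
Qed.

Lemma open_near U p (P : set V) : open U -> U p -> (forall q, U q -> P q) -> \forall q \near p, P q.
Proof. by move=> oU Up H; apply: filterS H _; apply: open_nbhs_nbhs. Qed.

(** Derivatives see a neighbourhood, so equality on [U] passes to them because [U] is open. *)
Lemma Ck_ext k U f g : open U -> (forall p, U p -> f p = g p) -> Ck k U f -> Ck k U g.
Proof.
move=> oU; elim: k f g => [|k IH] f g fg /=.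
  move=> cf p Up; apply: near_eq_continuous_at (cf p Up).
  exact: open_near Up fg.
move=> [df Df]; split=> [p Up|v].
  by apply: near_eq_differentiable (df p Up); apply: open_near Up fg.
apply: IH (Df v) => p Up; apply: near_eq_derive.
exact: open_near Up fg.
Qed.

Lemma Ck_sub k U W f : U `<=` W -> Ck k W f -> Ck k U f.
Proof.
move=> UW; elim: k f => [|k IH] f /= => [H p /UW|[H1 H2]]; first exact: H.
by split=> [p /UW|v]; [exact: H1|exact/IH/H2].
Qed.

(** [Ck] is a condition at each point, so it may be checked on neighbourhoods that vary with the
    point, as is done for [curve_glue]. *)
Lemma Ck_local k U f :
  (forall p, U p -> exists W, [/\ open W, W p & Ck k W f]) -> Ck k U f.
Proof.
elim: k f => [|k IH] f /= H.
  by move=> p /H [W [_ Wp HW]]; exact: HW.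
split=> [p /H [W [_ Wp [HW _]]]|v]; first exact: HW.
apply: IH => p /H [W [oW Wp [_ HW]]].
by exists W.
Qed.

Lemma CkW k U f : Ck k.+1 U f -> Ck k U f.
Proof.
elim: k f => [|k IH] f [H1 H2].
  by move=> p /H1/differentiable_continuous.
by split=> // v; apply/IH/H2.
Qed.

Lemma Ck_cst k U (a : R) : Ck k U (fun=> a).
Proof.
elim: k a => [|k IH] a /=; first by move=> p _; apply: cst_continuous.
split=> [p _|v]; first exact: differentiable_cst.
rewrite (_ : 'D_v _ = (fun=> 0)); first exact: IH.
by apply/funext => p; rewrite derive_cst.
Qed.

Lemma CkD k U f g : open U -> Ck k U f -> Ck k U g -> Ck k U (fun p => f p + g p).
Proof.
move=> oU; elim: k f g => [|k IH] f g /=.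
  by move=> cf cg p Up; apply: continuousD; [apply: cf|apply: cg].
move=> [f1 f2] [g1 g2]; split=> [p Up|v].
  by apply: differentiableD; [apply: f1|apply: g1].
apply: Ck_ext (IH _ _ (f2 v) (g2 v)) => // p Up.
by rewrite -deriveD //; apply: diff_derivable; [apply: f1|apply: g1].
Qed.

Lemma CkM k U f g : open U -> Ck k U f -> Ck k U g -> Ck k U (fun p => f p * g p).
Proof.
move=> oU; elim: k f g => [|k IH] f g.
  by move=> cf cg p Up; apply: continuousM; [apply: cf|apply: cg].
move=> Cf Cg; have [f1 f2] := Cf; have [g1 g2] := Cg; split=> [p Up|v].
  by apply: differentiableM; [apply: f1|apply: g1].
apply: (@Ck_ext _ _ (fun p => f p * 'D_v g p + g p * 'D_v f p)) => // [p Up|].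
  by rewrite -deriveM //; apply: diff_derivable; [apply: f1|apply: g1].
by apply: CkD => //; apply: IH; [exact: CkW Cf|exact: g2|exact: CkW Cg|exact: f2].
Qed.

Lemma Ck_sum k U (I : Type) (r : seq I) (F : I -> V -> R) : open U ->
  (forall i, Ck k U (F i)) -> Ck k U (fun p => \sum_(i <- r) F i p).
Proof.
move=> oU H; elim: r => [|i r IH].
  by under [X in Ck _ _ X]funext do rewrite big_nil; exact: Ck_cst.
by under [X in Ck _ _ X]funext do rewrite big_cons; exact: CkD.
Qed.

Lemma Ck_opp k U f : open U -> Ck k U f -> Ck k U (fun p => - f p).
Proof.
move=> oU Cf; apply: (@Ck_ext _ _ (fun p => (-1) * f p)) => // [p _|].
  by rewrite mulN1r.
by apply: CkM => //; exact: Ck_cst.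
Qed.

Lemma derive_linear_arg f p : differentiable f p ->
  (forall v w, 'D_(v + w) f p = 'D_v f p + 'D_w f p) /\
  (forall (a : R) v, 'D_(a *: v) f p = a * 'D_v f p).
Proof.
by move=> df; split=> *; rewrite !deriveE // ?linearD ?linearZ.
Qed.

Lemma derive_sum_arg (I : Type) (r : seq I) (P : pred I) (w : I -> V) f p : differentiable f p ->
  'D_(\sum_(i <- r | P i) w i) f p = \sum_(i <- r | P i) 'D_(w i) f p.
Proof.
move=> df; rewrite deriveE // linear_sum /=; apply: eq_bigr => i _.
by rewrite deriveE.
Qed.

End Calculus.

(** * Chain rule and composition of C^k maps *)

Section Composition.
Context {R : realType} {V : normedModType R}.
Implicit Types (U : set V) (f : V -> R) (p v : V).

Lemma derive_comp (W : normedModType R) (F : V -> W) (g : W -> R) p v :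
  differentiable F p -> differentiable g (F p) ->
  'D_v (fun q => g (F q)) p = 'D_('D_v F p) g (F p).
Proof.
move=> dF dg; rewrite [LHS]deriveE; last exact: differentiable_comp.
by rewrite [X in X _ = _](diff_comp dF dg) /= !deriveE.
Qed.

Lemma differentiable_row m (F : V -> 'rV[R]_m) p :
  (forall k, differentiable (fun q => F q ord0 k) p) -> differentiable F p.
Proof.
move=> H.
rewrite (_ : F = \sum_(j < m) (fun q => F q 0 j *: delta_mx ord0 j)); last first.
  by apply/funext => q; rewrite fct_sumE; exact: row_sum_delta.
apply: differentiable_sum => j; apply: differentiableZl; exact: H.
Qed.

Lemma derive_row m (F : V -> 'rV[R]_m) p v : differentiable F p ->
  'D_v F p = \sum_k 'D_v (fun q => F q ord0 k) p *: delta_mx ord0 k.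
Proof.
move=> dF; rewrite derive_mx; last exact: diff_derivable.
by rewrite [LHS]row_sum_delta; apply: eq_bigr => k _; rewrite mxE.
Qed.

Lemma derive_comp_row m (F : V -> 'rV[R]_m) (g : 'rV[R]_m -> R) p v :
  differentiable F p -> differentiable g (F p) ->
  'D_v (fun q => g (F q)) p =
  \sum_k 'D_v (fun q => F q ord0 k) p * 'D_(delta_mx ord0 k) g (F p).
Proof.
move=> dF dg; rewrite derive_comp // derive_row // derive_sum_arg //.
by apply: eq_bigr => k _; rewrite (derive_linear_arg dg).2.
Qed.

(** By the chain rule a derivative of [g o F] is a sum of derivatives of [F] times partial
    derivatives of [g] composed with [F]; the induction applies to the latter, with order one
    less. *)
Lemma Ck_comp_row k m U (W : set 'rV[R]_m) (F : V -> 'rV[R]_m) (g : 'rV[R]_m -> R) :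
  open U -> (forall p, U p -> W (F p)) ->
  (forall j, Ck k U (fun p => F p ord0 j)) -> Ck k W g ->
  (forall p, U p -> differentiable F p) ->
  Ck k U (fun p => g (F p)).
Proof.
move=> oU UW CF Cg dF; elim: k g CF Cg => [|k IH] g CF.
  move=> cg p Up.
  apply: (@continuous_comp _ _ _ F g); first exact: differentiable_continuous (dF p Up).
  by apply: cg; exact: UW.
move=> [dg Dg]; split=> [p Up|v].
  apply: (@differentiable_comp _ _ _ _ F g); first exact: dF.
  by apply: dg; exact: UW.
apply: (@Ck_ext _ _ k U (fun p => \sum_k 'D_v (fun q => F q ord0 k) p * 'D_(delta_mx ord0 k) g (F p))) => //.
  by move=> p Up; rewrite derive_comp_row //; [exact: dF|exact/dg/UW].
apply: Ck_sum => // j; apply: CkM => //; first by case: (CF j) => _; exact.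
apply: (IH (fun q => 'D_(delta_mx ord0 j) g q)); last exact: Dg.
by move=> i; exact/CkW/CF.
Qed.

(** [Ck_comp_row] with a scalar inner function, which is not a row; it serves the reparametrisation
    of curves. *)
Lemma Ck_comp1 k U (W : set R) (r : V -> R) (g : R -> R) :
  open U -> (forall p, U p -> W (r p)) -> Ck k U r -> Ck k W g -> Ck k U (fun p => g (r p)).
Proof.
move=> oU UW; elim: k g => [|k IH] g Cr.
  by move=> cg p Up; apply: (@continuous_comp _ _ _ r g); [exact: Cr|exact/cg/UW].
move=> [dg Dg]; have [dr Dr] := Cr; split=> [p Up|v].
  by apply: (@differentiable_comp _ _ _ _ r g); [exact: dr|exact/dg/UW].
apply: (@Ck_ext _ _ k U (fun p => 'D_v r p * 'D_1 g (r p))) => //.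
  move=> p Up; rewrite (derive_comp v (dr p Up) (dg _ (UW _ Up))).
  rewrite -(derive_linear_arg (dg _ (UW _ Up))).2.
  by congr ('D__ g _); rewrite /GRing.scale /= mulr1.
apply: CkM => //.
  exact: Dr.
by apply: (IH (fun q => 'D_1 g q)); [exact: CkW Cr|exact: Dg].
Qed.

Lemma smooth_on_diff U f p : smooth_on U f -> U p -> differentiable f p.
Proof. by move=> /(_ 1%N) [H _]; exact: H. Qed.

Lemma smooth_on_derive U f v : smooth_on U f -> smooth_on U (fun p => 'D_v f p).
Proof. by move=> H k; case: (H k.+1) => _; exact. Qed.

End Composition.

(** * Symmetry of second derivatives *)

Section SecondDerivative.
Context {R : realType} {V : normedModType R}.
Implicit Types (f : V -> R) (p u v : V).

(** The mean value theorem for [phi s = f (s u + h v + p) - f (s u + p)] turns the second difference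
    into [h] times a difference of values of [D_u f]; differentiability of [D_u f] at [p] expands
    this difference up to [o(h)]. *)
Lemma second_difference f p u v (e : R) :
  (\forall q \near p, differentiable f q) -> differentiable (fun q => 'D_u f q) p -> 0 < e ->
  \forall h \near (0 : R)^'+,
    `|f (h *: u + h *: v + p) - f (h *: u + p) - f (h *: v + p) + f p
      - h ^+ 2 * 'D_v (fun q => 'D_u f q) p| <= e * h ^+ 2.
Proof.
move=> df dDf e0.
set L := 'D_v _ p.
(* The two expansions are made at distance at most [h (|u| + |v|)] and [h |u|] from [p], whence
   [2 |u| + |v|]; the added 1 keeps [c] positive. *)
pose c := 2 * `|u| + `|v| + 1.
have c0 : 0 < c by rewrite /c; have := normr_ge0 u; have := normr_ge0 v; lra.
have e'0 : 0 < e / c by rewrite divr_gt0.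
have H1 := differentiable_eps dDf e'0.
have H2 : \forall h \near 0, differentiable f (h + p).
  by move: df; rewrite (near_shift 0 p) /= subr0; apply: filterS => h /=; rewrite addrC.
have [d /= d0 H] := (nbhs_ballP _ _).1 (filterI H1 H2).
near=> h.
have h0 : 0 < h by near: h; exact: nbhs_right_gt.
have hd : h * c < d by rewrite -ltr_pdivlMr //; near: h; apply: nbhs_right_lt; rewrite divr_gt0.
have small s t : 0 <= s <= h -> 0 <= t <= h -> `|s *: u + t *: v| < d /\ `|s *: u + t *: v| <= h * (`|u| + `|v|).
  move=> /andP[s0 sh] /andP[t0 th].
  have K : `|s *: u + t *: v| <= h * (`|u| + `|v|).
    rewrite (le_trans (ler_normD _ _)) // !normrZ mulrDr lerD //.
      by rewrite ler_wpM2r // ger0_norm.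
    by rewrite ler_wpM2r // ger0_norm.
  split=> //; apply: le_lt_trans K _; apply: le_lt_trans hd; rewrite ler_wpM2l ?(ltW h0) //.
  by rewrite /c; have := normr_ge0 u; lra.
have inball (w : V) : `|w| < d -> ball 0 d w by rewrite -ball_normE /ball_ /= sub0r normrN.
pose phi (s : R) := f (s *: u + h *: v + p) - f (s *: u + p).
pose dphi (s : R) := 'D_u f (s *: u + h *: v + p) - 'D_u f (s *: u + p).
have dline (w : V) (s : R) : differentiable f (s *: u + w + p) ->
    is_derive s (1 : R) (fun s : R => f (s *: u + w + p)) ('D_u f (s *: u + w + p)).
  move=> dfs.
  have dl : differentiable (fun s : R => s *: u + w + p) s.
    by apply: differentiableD => //; apply: differentiableD => //; exact: differentiableZl.
  apply: DeriveDef.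
    by apply: diff_derivable; exact: (differentiable_comp dl dfs).
  rewrite (@derive_comp R R V _ f s 1 dl dfs); congr ('D__ f _).
  rewrite deriveD; last 2 first.
  - by apply: diff_derivable; apply: differentiableD => //; exact: differentiableZl.
  - exact: derivable_cst.
  rewrite deriveD; last 2 first.
  - by apply: diff_derivable; exact: differentiableZl.
  - exact: derivable_cst.
  rewrite !derive_cst !addr0 deriveE; last exact: differentiableZl.
  by rewrite diffZl // diff_val /= scale1r.
have dphiP s : 0 <= s <= h -> is_derive s 1 phi (dphi s).
  move=> sh; have hh : 0 <= h <= h by rewrite lexx ltW.
  have zh : 0 <= (0 : R) <= h by rewrite lexx ltW.
  apply: is_deriveB.
    by apply: dline; apply: (H _ (inball _ (small _ _ sh hh).1)).2.
  have := dline 0 s; rewrite addr0 => K.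
  under [X in is_derive _ _ X]funext => s' do rewrite -[s' *: u]addr0.
  apply: K; have := (H _ (inball _ (small _ _ sh zh).1)).2.
  by rewrite scale0r addr0.
have [th thin Eth] : exists2 th, th \in `]0, h[%R & phi h - phi 0 = dphi th * (h - 0).
  apply: (@MVT R phi dphi) => //.
    by move=> x /[!in_itv]/= /andP[x0 xh]; apply: dphiP; rewrite !ltW.
  apply: derivable_within_continuous => x /[!in_itv]/= xh.
  by have [] := dphiP x xh.
have thh : 0 <= th <= h by move: thin; rewrite in_itv /= => /andP[? ?]; rewrite !ltW.
have hh : 0 <= h <= h by rewrite lexx ltW.
have zh : 0 <= (0 : R) <= h by rewrite lexx ltW.
have -> : f (h *: u + h *: v + p) - f (h *: u + p) - f (h *: v + p) + f p = dphi th * h.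
  rewrite -[h in RHS]subr0 -Eth /phi scale0r add0r [0 + p]add0r; ring.
have E1 := (H _ (inball _ (small _ _ thh hh).1)).1.
have E2 := (H _ (inball _ (small _ _ thh zh).1)).1.
(* The linear terms of the two expansions differ by exactly [h L], so a difference of two remainders
   is left. *)
have Lh : 'd (fun q => 'D_u f q) p (th *: u + h *: v) - 'd (fun q => 'D_u f q) p (th *: u + 0 *: v) = h * L.
  by rewrite -linearB /= scale0r addr0 addrAC subrr add0r linearZ /= /L deriveE.
rewrite (_ : dphi th * h - h ^+ 2 * L = (dphi th - h * L) * h); last ring.
rewrite normrM (ger0_norm (ltW h0)) expr2 mulrA ler_wpM2r ?(ltW h0) //.
have -> : dphi th - h * L =
  ('D_u f (th *: u + h *: v + p) - 'D_u f p - 'd (fun q => 'D_u f q) p (th *: u + h *: v)) -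
  ('D_u f (th *: u + 0 *: v + p) - 'D_u f p - 'd (fun q => 'D_u f q) p (th *: u + 0 *: v)).
  by rewrite -Lh /dphi scale0r addr0; ring.
rewrite (le_trans (ler_normB _ _)) // (le_trans (lerD E1 E2)) // -mulrDr.
have B1 := (small _ _ thh hh).2.
have B2 : `|th *: u + 0 *: v| <= h * `|u|.
  by rewrite scale0r addr0 normrZ ler_wpM2r // ger0_norm; case/andP: thh.
rewrite -mulrA ler_wpM2l ?(ltW e0) // mulrC ler_pdivrMr //.
apply: le_trans (lerD B1 B2) _; rewrite -mulrDr ler_wpM2l ?(ltW h0) // /c; lra.
Unshelve. all: by end_near.
Qed.

Let second_difference_unique (a b d d' h e : R) : 0 <= h -> d = d' ->
  `|d - h * a| <= e / 2 * h -> `|d' - h * b| <= e / 2 * h -> `|(a - b) * h| <= e * h.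
Proof.
move=> h0 <-; rewrite !ler_norml => /andP[a1 a2] /andP[b1 b2].
by apply/andP; split; lra.
Qed.

(** The second difference is symmetric in [u] and [v], and each iterated derivative times [h ^+ 2]
    approximates it within [e / 2 * h ^+ 2]. *)
Lemma schwarz f p u v : (\forall q \near p, differentiable f q) ->
  differentiable (fun q => 'D_u f q) p -> differentiable (fun q => 'D_v f q) p ->
  'D_v (fun q => 'D_u f q) p = 'D_u (fun q => 'D_v f q) p.
Proof.
move=> df du dv; apply/eqP; rewrite -subr_eq0 -normr_le0; apply/ler_addgt0Pr => e e0.
rewrite add0r.
have e2 : 0 < e / 2 by rewrite divr_gt0.
have A1 := second_difference v df du e2.
have A2 := second_difference u df dv e2.
have [h [/= h0 [H1 H2]]] := filter_ex (filterI (nbhs_right_gt (0 : R)) (filterI A1 A2)).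
have h20 : 0 < h ^+ 2 by rewrite exprn_gt0.
rewrite -(ler_pM2r h20) -[X in _ * X <= _](ger0_norm (ltW h20)) -normrM.
apply: second_difference_unique H1 H2; first exact: ltW.
by rewrite [h *: v + h *: u]addrC; congr (_ + _); rewrite addrAC.
Qed.

End SecondDerivative.

(** * Linear differential equations *)

Section RealLine.
Context {R : realType}.
Implicit Types (f g : R -> R) (a b c s t C e : R).

Lemma continuous_sum_fun (T : topologicalType) (I : Type) (r : seq I) (F : I -> T -> R) :
  (forall i, continuous (F i)) -> continuous (fun x => \sum_(i <- r) F i x).
Proof.
move=> H; elim: r => [|i r IH] x.
  by under eq_fun do rewrite big_nil; exact: cvg_cst.
by under eq_fun do rewrite big_cons; apply: continuousD; [exact: H|exact: IH].
Qed.

Lemma mean_value_bound f (df : R -> R) a b C s t :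
  (forall x, a <= x <= b -> is_derive x 1 f (df x)) ->
  (forall x, a <= x <= b -> `|df x| <= C) ->
  a <= s <= b -> a <= t <= b -> `|f t - f s| <= C * `|t - s|.
Proof.
move=> fP dfC.
wlog st : s t / s <= t.
  move=> H sab tab; have [/H|/ltW/H] := leP s t; first exact.
  by rewrite [`|f s - _|]distrC [`|s - _|]distrC; exact.
move=> /andP[as_ sb] /andP[at_ tb].
have inab x : s <= x <= t -> a <= x <= b.
  by move=> /andP[sx xt]; rewrite (le_trans as_ sx) (le_trans xt tb).
have [|x|x|c csd ->] := @MVT_segment R f df s t.
- exact: st.
- by move=> /[!in_itv]/= /andP[sx xt]; apply/fP/inab; rewrite !ltW.
- apply: derivable_within_continuous => y /[!in_itv]/= /inab/fP[] //.
rewrite normrM ler_wpM2r //; apply/dfC/inab; by move: csd; rewrite in_itv.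
Qed.

(** On an interval this short, the maximum [S] of [sum_j |y_j|] satisfies
    [S <= sum_j |y_j(s)| + S / 2]. This replaces the exponential bound and treats both sides of [s]
    at once. *)
Lemma gronwall_short (I : finType) (y dy : I -> R -> R) (K a b s : R) :
  0 <= K -> a <= s <= b -> (b - a) * K * #|I|%:R <= 2^-1 ->
  (forall i t, a <= t <= b -> is_derive t 1 (y i) (dy i t)) ->
  (forall i t, a <= t <= b -> `|dy i t| <= K * \sum_j `|y j t|) ->
  forall t, a <= t <= b -> \sum_j `|y j t| <= 2 * \sum_j `|y j s|.
Proof.
move=> K0 asb small yP dyK.
have ab : a <= b by case/andP: asb => /le_trans; exact.
have Sc : {within `[a, b], continuous (fun t => \sum_j `|y j t|)}.
  have H j : {within `[a, b], continuous (y j)}.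
    by apply: derivable_within_continuous => t /[!in_itv]/= /(yP j)[].
  apply: continuous_sum_fun => j t.
  apply: (@continuous_comp _ _ _ (y j : subspace `[a, b] -> R) (fun x : R => `|x|)); first exact: H.
  exact: norm_continuous.
have [c /[!in_itv]/= cab cmax] := EVT_max ab Sc.
have cmax' t : a <= t <= b -> \sum_j `|y j t| <= \sum_j `|y j c| by move=> tab; apply: cmax; rewrite in_itv.
suff E : \sum_j `|y j c| <= 2 * \sum_j `|y j s|.
  by move=> t /cmax'/le_trans; exact.
set S : R := \sum_j `|y j c| in cmax' *.
have S0 : 0 <= S by apply: sumr_ge0.
have H j : `|y j c| <= `|y j s| + (b - a) * K * S.
  have D : `|y j c - y j s| <= K * S * `|c - s|.
    apply: (@mean_value_bound _ (dy j) a b) => // x xab.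
    by apply: le_trans (dyK _ _ xab) _; rewrite ler_wpM2l // cmax'.
  rewrite -[y j c](subrK (y j s)) addrC (le_trans (ler_normD _ _)) // lerD2l.
  rewrite (le_trans D) // -[X in _ <= X]mulrA [X in _ <= X]mulrC ler_wpM2l ?mulr_ge0 //.
  rewrite ler_norml; move: cab asb => /andP[? ?] /andP[? ?]; apply/andP; split; lra.
have : S <= \sum_j `|y j s| + 2^-1 * S.
  apply: le_trans (ler_sum _ (fun j _ => H j)) _.
  have -> : \sum_(j : I) (`|y j s| + (b - a) * K * S) = \sum_j `|y j s| + (b - a) * K * #|I|%:R * S.
    by rewrite big_split /= sumr_const -[X in _ + X]mulr_natr mulrAC.
  by rewrite lerD2l ler_wpM2r.
lra.
Qed.

(** The intervals of radius [2 C / 2^k] around [u k] are nested, as the steps after [k] add up to at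
    most this radius; the limit is the supremum of the left ends. The Picard iteration uses the
    explicit rate. *)
Lemma geometric_limit (u : nat -> R) C :
  (forall k, `|u k.+1 - u k| <= C / 2 ^+ k) ->
  exists l, forall k, `|u k - l| <= 2 * C / 2 ^+ k.
Proof.
move=> H.
pose a k := u k - 2 * C / 2 ^+ k; pose c k := u k + 2 * C / 2 ^+ k.
have pk k : 2 ^+ k != 0 :> R by rewrite expf_neq0.
have E k : 2 * C / 2 ^+ k = 2 * (2 * C / 2 ^+ k.+1).
  by rewrite exprS; field.
have E' k : C / 2 ^+ k = 2 * C / 2 ^+ k.+1 by rewrite exprS; field.
have C0 k : 0 <= 2 * C / 2 ^+ k.+1 by rewrite -E'; exact: le_trans (H k).
have an m k : a m <= a (m + k)%N.
  elim: k => [|k IH]; first by rewrite addn0.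
  rewrite (le_trans IH) // addnS /a; have := E (m + k)%N.
  by have := H (m + k)%N; rewrite E' ler_norml => /andP[]; lra.
have cn m k : c (m + k)%N <= c m.
  elim: k => [|k IH]; first by rewrite addn0.
  rewrite (le_trans _ IH) // addnS /c; have := E (m + k)%N.
  by have := H (m + k)%N; rewrite E' ler_norml => /andP[]; lra.
have ac m k : a m <= c k.
  rewrite (le_trans (an m k)) // (le_trans _ (cn k m)) // addnC /a /c.
  by have := C0 (k + m)%N; rewrite [in X in _ -> X]E; lra.
have sA : has_sup (range a).
  by split; [exists (a 0%N), 0%N|exists (c 0%N) => _ [k _ <-]].
exists (sup (range a)) => k.
have L : a k <= sup (range a) by apply: ub_le_sup; [case: sA|exists k].
have U : sup (range a) <= c k by apply: ge_sup; [case: sA|move=> _ [m _ <-]].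
by move: L U; rewrite /a /c ler_norml => L U; apply/andP; split; lra.
Qed.

Lemma geometric_le0 (x C : R) : (forall k, x <= C / 2 ^+ k) -> x <= 0.
Proof.
move=> H; rewrite leNgt; apply/negP => x0.
have C0 : 0 < C by have := H 0%N; rewrite expr0 divr1; exact: lt_le_trans.
pose k := Num.truncn (C / x).
have : C / x < 2 ^+ k.+1.
  apply: (@lt_trans _ _ (k.+1)%:R); first by have /andP[_] := truncn_itv (ltW (divr_gt0 C0 x0)).
  by rewrite -natrX ltr_nat ltn_expl.
by rewrite ltr_pdivrMr // -ltr_pdivrMl ?exprn_gt0 // mulrC ltNge H.
Qed.

Lemma geometric_limit_continuous (u : nat -> R -> R) (l : R -> R) C :
  (forall k, continuous (u k)) -> (forall k t, `|u k t - l t| <= C / 2 ^+ k) -> continuous l.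
Proof.
move=> uc H t; apply/cvgrPdist_le => e e0.
have [k Hk] : exists k, C / 2 ^+ k < e / 4.
  apply: contrapT => /forallNP K.
  suff : e / 4 <= 0 by rewrite leNgt divr_gt0.
  by apply: (@geometric_le0 _ C) => k; have /negP := K k; rewrite -leNgt.
have e2 : 0 < e / 2 by rewrite divr_gt0.
have := uc k t => /cvgrPdist_le /(_ _ e2).
apply: filterS => x.
have := H k t; have := H k x; rewrite !ler_norml.
by move=> /andP[? ?] /andP[? ?] /andP[? ?]; apply/andP; split; lra.
Qed.

(** Projection of the line to [[c - e, c + e]]. Composing with it turns functions known on this
    interval into continuous functions on all of [R], so that the iteration below has no domain to
    respect. *)
Definition clamp c e t := Num.max (c - e) (Num.min t (c + e)).

Lemma clamp_continuous c e : continuous (clamp c e).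
Proof.
move=> t; apply: (@continuous_max R R (cst (c - e)) (fun t => Num.min t (c + e))).
  exact: cst_continuous.
by apply: (@continuous_min R R id (cst (c + e))); [exact: cvg_id|exact: cst_continuous].
Qed.

Lemma clamp_itv c e t : 0 <= e -> c - e <= clamp c e t <= c + e.
Proof.
move=> e0; rewrite /clamp le_max lexx /= ge_max ge_min lexx orbT andbT.
by lra.
Qed.

Lemma clamp_id c e t : c - e <= t <= c + e -> clamp c e t = t.
Proof. by move=> /andP[h1 h2]; rewrite /clamp (min_idPl h2) (max_idPr h1). Qed.

Lemma primitive f a b : continuous f ->
  exists F, forall x, a < x < b -> is_derive x 1 F (f x).
Proof.
move=> cf; exists (fun x => \int[lebesgue_measure]_(t in `[a, x]) f t)%R => x /andP[ax xb].
have [] := @continuous_FTC1_closed R f a x b xb.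
- apply: continuous_compact_integrable; first exact: segment_compact.
  exact: continuous_subspaceT.
- exact: ax.
- exact: cf.
by move=> d E; apply: DeriveDef; [exact: d|rewrite -derive1E; exact: E].
Qed.

(** [T f] is the primitive of [f] that vanishes at [c], frozen outside [[c - e, c + e]]; being
    frozen makes its bounds, with factor [e], valid on the whole line. *)
Lemma clamped_primitive c e : 0 < e ->
  exists T : (R -> R) -> R -> R, forall f, continuous f ->
    [/\ continuous (T f), T f c = 0,
        (forall t, c - e < t < c + e -> is_derive t 1 (T f) (f t)),
        (forall C, (forall t, `|f t| <= C) -> forall t, `|T f t| <= e * C) &
        forall g C, continuous g -> (forall t, `|f t - g t| <= C) ->
          forall t, `|T f t - T g t| <= e * C].
Proof.
move=> e0.
(* The interval is longer by 1 on each side, so that [c - e] and [c + e] are interior points where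
   the primitive has a two-sided derivative. *)
have /choice[P HP] : forall f, exists F, continuous f ->
    forall x, c - e - 1 < x < c + e + 1 -> is_derive x 1 F (f x).
  move=> f; have [cf|nf] := pselect (continuous f); last by exists f.
  by have [F HF] := primitive (c - e - 1) (c + e + 1) cf; exists F.
have Pc f x : continuous f -> c - e - 1 < x < c + e + 1 -> {for x, continuous (P f)}.
  move=> cf /(HP f cf) [d _]; apply: differentiable_continuous; exact/derivable1_diffP.
have inb x : c - e <= x <= c + e -> c - e - 1 < x < c + e + 1.
  by move=> /andP[? ?]; apply/andP; split; lra.
have cc : clamp c e c = c by apply: clamp_id; apply/andP; split; lra.
have bound (F h : R -> R) C : (forall y, c - e <= y <= c + e -> is_derive y 1 F (h y)) ->
    (forall y, `|h y| <= C) -> forall t, `|F (clamp c e t) - F c| <= e * C.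
  move=> FP hC t; have tI := clamp_itv c t (ltW e0); set x := clamp c e t in tI *.
  have cI : c - e <= c <= c + e by apply/andP; split; lra.
  have := mean_value_bound FP (fun x _ => hC x) cI tI.
  move/le_trans; apply; rewrite mulrC ler_wpM2r //; first exact: le_trans (hC c).
  by rewrite ler_norml; move: tI => /andP[? ?]; apply/andP; split; lra.
exists (fun f t => P f (clamp c e t) - P f c) => f cf; split=> [t||t /andP[t1 t2]|C fC t|g C cg fg t].
- apply: (@continuousB _ R R^o) => //; last exact: cst_continuous.
  apply: (@continuous_comp _ _ _ (clamp c e) (P f)); first exact: clamp_continuous.
  by apply: Pc => //; apply/inb/clamp_itv/ltW.
- by rewrite cc subrr.
- have D : is_derive t 1 (fun t => P f t - P f c) (f t).
    rewrite -[f t]subr0; apply: is_deriveB; apply: HP => //.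
    by apply/andP; split; lra.
  apply: near_eq_is_derive D.
  have : \forall x \near t, x \in `](c - e), (c + e)[%R by apply: near_in_itvoo; rewrite in_itv /= t1.
  by apply: filterS => x; rewrite in_itv /= => /andP[x1 x2]; rewrite clamp_id // !ltW.
- by apply: (bound _ f) => // y /inb; exact: HP.
rewrite (_ : _ - _ = P f (clamp c e t) - P g (clamp c e t) - (P f c - P g c)); last by ring.
apply: (bound (fun y => P f y - P g y) (fun y => f y - g y)) => // y /inb yI.
by apply: is_deriveB; exact: HP.
Qed.

Let dominated_sum (I : finType) (m z : I -> R) (K C : R) : 0 <= K ->
  (forall j, `|m j| <= K) -> (forall j, `|z j| <= C) ->
  `|\sum_j m j * z j| <= #|I|%:R * K * C.
Proof.
move=> K0 mK zC; apply: le_trans (ler_norm_sum _ _ _) _.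
have : \sum_j `|m j * z j| <= \sum_(j : I) K * C.
  by apply: ler_sum => j _; rewrite normrM ler_pM.
have -> : \sum_(j : I) K * C = #|I|%:R * K * C by rewrite sumr_const -[LHS]mulr_natl mulrA.
exact.
Qed.

(** The map [step] halves distances in the sup norm on all of [R]: [m] is bounded there and [T]
    contributes the factor [e]. Its iterates converge at the rate [2^-k], and the limit solves the
    integral equation. *)
Lemma picard (I : finType) (m : I -> I -> R -> R) (K c e : R) (v : I -> R) :
  0 <= K -> 0 < e -> e * K * #|I|%:R <= 2^-1 ->
  (forall i j, continuous (m i j)) -> (forall i j t, `|m i j t| <= K) ->
  exists y : I -> R -> R, (forall i, y i c = v i) /\
    forall i t, c - e < t < c + e -> is_derive t 1 (y i) (\sum_j m i j t * y j t).
Proof.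
move=> K0 e0 small mc mK.
have [T HT] := clamped_primitive c e0.
pose G (y : I -> R -> R) i t := \sum_j m i j t * y j t.
pose step (y : I -> R -> R) i t := v i + T (G y i) t.
pose u k := iter k step (fun i _ => v i).
have Gc y : (forall i, continuous (y i)) -> forall i, continuous (G y i).
  move=> yc i; apply: continuous_sum_fun => j t.
  by apply: continuousM; [exact: mc|exact: yc].
have stepc y : (forall i, continuous (y i)) -> forall i, continuous (step y i).
  move=> yc i t; apply: continuousD; first exact: cst_continuous.
  by have [+ _ _ _ _] := HT _ (Gc y yc i); exact.
have uc k : forall i, continuous (u k i).
  by elim: k => [|k IH] i; [exact: cst_continuous|exact: stepc].
have contr y z C : (forall i, continuous (y i)) -> (forall i, continuous (z i)) ->
    (forall i t, `|y i t - z i t| <= C) -> forall i t, `|step y i t - step z i t| <= C / 2.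
  move=> yc zc H i t; have C0 : 0 <= C by exact: le_trans (H i t).
  have [_ _ _ _ D] := HT _ (Gc y yc i).
  have := D (G z i) (#|I|%:R * K * C) (Gc z zc i).
  have HG s : `|G y i s - G z i s| <= #|I|%:R * K * C.
    rewrite /G -sumrB; under eq_bigr do rewrite -mulrBr.
    by apply: dominated_sum => // j; exact: H.
  move=> /(_ HG t); rewrite /step opprD addrACA subrr add0r => /le_trans; apply.
  have := ler_wpM2r C0 small; lra.
(* Since [u 0] is constant, the first step only adds [T (G (u 0))], which the bound for [T]
   controls. *)
have [B HB] : exists B, forall i t, `|u 1%N i t - u 0%N i t| <= B.
  exists (e * (#|I|%:R * K * \sum_j `|v j|)) => i t.
  rewrite /u /= /step addrAC subrr add0r.
  have uc0 : forall i, continuous (fun _ : R => v i) by move=> ?; exact: cst_continuous.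
  have [_ _ _ D _] := HT _ (Gc _ uc0 i).
  apply: D => s; apply: dominated_sum => // j.
  by rewrite (bigD1 j) //= lerDl sumr_ge0.
have Hu i t k : `|u k.+1 i t - u k i t| <= B / 2 ^+ k.
  elim: k i t => [|k IH] i t; first by rewrite expr0 divr1.
  by have := contr _ _ _ (uc k.+1) (uc k) IH i t; rewrite exprS invfM mulrCA mulrC.
have /choice[y Hy] : forall it : I * R, exists l, forall k, `|u k it.1 it.2 - l| <= 2 * B / 2 ^+ k.
  by move=> [i t]; apply: geometric_limit; exact: Hu.
pose z i t := y (i, t).
have zc i : continuous (z i).
  apply: (@geometric_limit_continuous (fun k => u k i) _ (2 * B)) => [k|k t]; first exact: uc.
  exact: Hy (i, t) k.
have zE i t : z i t = step z i t.
  (* Both [step z] and [z] lie within [B / 2^k] of [u k.+1], so any constant from 2 on would do in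
     place of 3. *)
  apply/eqP; rewrite -subr_eq0 -normr_le0; apply: (@geometric_le0 _ (3 * B)) => k.
  have D1 : `|u k.+1 i t - step z i t| <= 2 * B / 2 ^+ k / 2.
    by apply: contr => // i' t'; exact: Hy (i', t') k.
  have D2 : `|u k.+1 i t - z i t| <= 2 * B / 2 ^+ k.+1 by exact: Hy (i, t) k.+1.
  have -> : z i t - step z i t = (u k.+1 i t - step z i t) - (u k.+1 i t - z i t) by ring.
  apply: le_trans (ler_normB _ _) _; apply: le_trans (lerD D1 D2) _.
  have B0 : 0 <= B / 2 ^+ k by exact: le_trans (Hu i t k).
  have -> : 2 * B / 2 ^+ k.+1 = B / 2 ^+ k.
    by rewrite exprS; field; rewrite expf_neq0.
  by rewrite -[3 * B / _]mulrA -[2 * B / _]mulrA; lra.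
exists z; split=> [i|i t tI].
  by rewrite zE /step; have [_ -> _ _ _] := HT _ (Gc z zc i); rewrite addr0.
have [_ _ D _ _] := HT _ (Gc z zc i).
rewrite (_ : z i = fun t => v i + T (G z i) t); last by apply/funext => t'; exact: zE.
by rewrite -[X in is_derive _ _ _ X]add0r; apply: is_deriveD; exact: D.
Qed.

(** The radius [e] depends on the coefficients alone: a solution on the whole window exists from
    every initial time [s] in it and every initial value. Continuation along a curve relies on this
    uniformity. *)
Lemma linear_ode (I : finType) (m : I -> I -> R -> R) (c d : R) : 0 < d ->
  (forall i j t, c - d < t < c + d -> {for t, continuous (m i j)}) ->
  exists2 e, 0 < e <= d & forall s (v : I -> R), c - e < s < c + e ->
    exists y : I -> R -> R, (forall i, y i s = v i) /\
    forall i t, c - e < t < c + e -> is_derive t 1 (y i) (\sum_j m i j t * y j t).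
Proof.
move=> d0 mc.
have [e1 /andP[e10 e1d] m1] : exists2 e1, 0 < e1 < d &
    forall t, `|t - c| <= e1 -> forall i j, `|m i j t - m i j c| <= 1.
  have : \forall t \near c, forall ij : I * I, `|m ij.1 ij.2 t - m ij.1 ij.2 c| <= 1.
    have H (ij : I * I) : \forall t \near c, `|m ij.1 ij.2 t - m ij.1 ij.2 c| <= 1.
      have : {for c, continuous (m ij.1 ij.2)} by apply: mc; apply/andP; split; lra.
      by move=> /cvgrPdist_le /(_ 1 ltr01); apply: filterS => t; rewrite distrC.
    exact: (@filter_forall _ _ (fun ij t => `|m ij.1 ij.2 t - m ij.1 ij.2 c| <= 1) _ _ H).
  move=> /nbhs_ballP[r /= r0 Hr].
  have r1 : 0 < Num.min r d by rewrite lt_min r0.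
  have rr : Num.min r d <= r by rewrite ge_min lexx.
  have rd : Num.min r d <= d by rewrite ge_min lexx orbT.
  exists (Num.min r d / 2); first by apply/andP; split; lra.
  move=> t tc i j; apply: (Hr _ _ (i, j)).
  rewrite -ball_normE /ball_ /= distrC; lra.
(* Within distance [e1] of [c] the coefficients differ by at most 1 from their values at [c]. *)
pose K := 1 + \sum_i \sum_j `|m i j c|.
have mK t : `|t - c| <= e1 -> forall i j, `|m i j t| <= K.
  move=> tc i j; rewrite -[m i j t](subrK (m i j c)) (le_trans (ler_normD _ _)) // lerD ?m1 //.
  rewrite (bigD1 i) //= (bigD1 j) //= -addrA lerDl addr_ge0 ?sumr_ge0 // => i' _.
  exact: sumr_ge0.
have K1 : 1 <= K by rewrite lerDl sumr_ge0 // => i _; exact: sumr_ge0.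
pose N : R := #|I|%:R + 1.
have N1 : 1 <= N by rewrite lerDr.
have NK : 1 <= K * N by rewrite -[X in X <= _]mulr1 ler_pM.
have NK0 : 0 < K * N by rewrite (lt_le_trans _ NK).
(* [picard] is run with radius [2 * e] around [s], which covers the window wherever [s] lies in it;
   its smallness condition [2 e K |I| <= 1/2] gives the quarter. *)
pose e := Num.min e1 (4^-1 / (K * N)).
have e0 : 0 < e by rewrite lt_min e10 divr_gt0.
have ee1 : e <= e1 by rewrite ge_min lexx.
have eKN : e * (K * N) <= 4^-1 by rewrite -ler_pdivlMr // ge_min lexx orbT.
exists e; first by apply/andP; split => //; lra.
move=> s v /andP[s1 s2].
pose m' i j t := m i j (clamp c e1 t).
have KK : 0 <= K by lra.
have e20 : 0 < 2 * e by lra.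
have [|i j|i j t|y [y0 Hy]] := @picard I m' K s (2 * e) v KK e20.
- have : e * (K * #|I|%:R) <= e * (K * N).
    by rewrite ler_wpM2l ?(ltW e0) // ler_wpM2l ?lerDl //; lra.
  lra.
- move=> t; apply: (@continuous_comp _ _ _ (clamp c e1) (m i j)); first exact: clamp_continuous.
  have /andP[? ?] := clamp_itv c t (ltW e10).
  by apply: mc; apply/andP; split; lra.
- apply: mK; have /andP[? ?] := clamp_itv c t (ltW e10).
  by rewrite ler_norml; apply/andP; split; lra.
exists y; split=> // i t /andP[t1 t2].
have -> : \sum_j m i j t * y j t = \sum_j m' i j t * y j t.
  by apply: eq_bigr => j _; rewrite /m' clamp_id //; apply/andP; split; lra.
by apply: Hy; apply/andP; split; lra.
Qed.

End RealLine.

(** * Complex-valued functions *)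

Section ComplexParts.
Context {R : realType}.
Local Notation C := R[i].
Implicit Types z w : C.

Lemma complex_ext z w : complex.Re z = complex.Re w -> complex.Im z = complex.Im w -> z = w.
Proof. by case: z => a b; case: w => c d /= -> ->. Qed.

Lemma cReD z w : complex.Re (z + w) = complex.Re z + complex.Re w.
Proof. by case: z; case: w. Qed.

Lemma cImD z w : complex.Im (z + w) = complex.Im z + complex.Im w.
Proof. by case: z; case: w. Qed.

Lemma cReM z w : complex.Re (z * w) = complex.Re z * complex.Re w - complex.Im z * complex.Im w.
Proof. by case: z; case: w. Qed.

Lemma cImM z w : complex.Im (z * w) = complex.Re z * complex.Im w + complex.Im z * complex.Re w.
Proof. by case: z => a b; case: w => c d. Qed.

Lemma cRe_sum (I : Type) (r : seq I) (P : pred I) (F : I -> C) :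
  complex.Re (\sum_(i <- r | P i) F i) = \sum_(i <- r | P i) complex.Re (F i).
Proof. by apply: (big_morph (@complex.Re R)) => //; exact: cReD. Qed.

Lemma cIm_sum (I : Type) (r : seq I) (P : pred I) (F : I -> C) :
  complex.Im (\sum_(i <- r | P i) F i) = \sum_(i <- r | P i) complex.Im (F i).
Proof. by apply: (big_morph (@complex.Im R)) => //; exact: cImD. Qed.

Lemma conjcE z : conjc z = complex.Re z -i* complex.Im z. Proof. by case: z. Qed.

Lemma complexE z : z = (complex.Re z)%:C + 'i%C * (complex.Im z)%:C.
Proof. by case: z => a b; apply: complex_ext; rewrite /= ?mul0r ?mul1r ?subr0 ?addr0 ?add0r ?mulr0. Qed.

End ComplexParts.

Section ComplexCalculus.
Context {R : realType} {V : normedModType R}.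
Local Notation C := R[i].
Implicit Types (U : set V) (f g : V -> C) (p v : V) (d : C).

(** [cderive] has a meaningless value where a part is not derivable, so derivability and value are
    carried together, as in [is_derive]. *)
Definition is_cderive f p v d := cderivable f p v /\ cderive f p v = d.

Lemma is_cderiveP f p v d : is_cderive f p v d <->
  is_derive p v (fun q => complex.Re (f q)) (complex.Re d) /\
  is_derive p v (fun q => complex.Im (f q)) (complex.Im d).
Proof.
split=> [[[h1 h2] <-]|[[h1 e1] [h2 e2]]]; first by split; exact: DeriveDef.
by split=> //; apply: complex_ext.
Qed.

Lemma is_cderive_near f g p v d : (\forall q \near p, f q = g q) ->
  is_cderive f p v d -> is_cderive g p v d.
Proof.
move=> fg /is_cderiveP[h1 h2]; apply/is_cderiveP; split.
  by apply: near_eq_is_derive h1; apply: filterS fg => q ->.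
by apply: near_eq_is_derive h2; apply: filterS fg => q ->.
Qed.

Lemma is_cderive_cst (a : C) p v : is_cderive (fun=> a) p v 0.
Proof. by apply/is_cderiveP; split; exact: is_derive_cst. Qed.

Lemma is_cderiveD f g p v d d' : is_cderive f p v d -> is_cderive g p v d' ->
  is_cderive (fun q => f q + g q) p v (d + d').
Proof.
move=> /is_cderiveP[h1 h2] /is_cderiveP[k1 k2]; apply/is_cderiveP; split.
  by under eq_fun do rewrite cReD; rewrite cReD; exact: is_deriveD.
by under eq_fun do rewrite cImD; rewrite cImD; exact: is_deriveD.
Qed.

Lemma is_cderiveM f g p v d d' : is_cderive f p v d -> is_cderive g p v d' ->
  is_cderive (fun q => f q * g q) p v (d * g p + f p * d').
Proof.
move=> /is_cderiveP[h1 h2] /is_cderiveP[k1 k2]; apply/is_cderiveP; split.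
  under eq_fun do rewrite cReM.
  apply: (@is_derive_eq _ _ _ _ _ _ _ _ (is_deriveB (is_deriveM h1 k1) (is_deriveM h2 k2))).
  by rewrite /GRing.scale /= cReD !cReM; ring.
under eq_fun do rewrite cImM.
apply: (@is_derive_eq _ _ _ _ _ _ _ _ (is_deriveD (is_deriveM h1 k2) (is_deriveM h2 k1))).
by rewrite /GRing.scale /= cImD !cImM; ring.
Qed.

Lemma is_cderiveMl f p v d (a : C) : is_cderive f p v d -> is_cderive (fun q => a * f q) p v (a * d).
Proof.
move=> H; have := is_cderiveM (is_cderive_cst a p v) H.
by rewrite mul0r add0r.
Qed.

Lemma is_cderive_sum (I : Type) (r : seq I) (P : pred I) (F : I -> V -> C) p v (d : I -> C) :
  (forall i, P i -> is_cderive (F i) p v (d i)) ->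
  is_cderive (fun q => \sum_(i <- r | P i) F i q) p v (\sum_(i <- r | P i) d i).
Proof.
move=> H; elim: r => [|i r IH].
  by under eq_fun do rewrite big_nil; rewrite big_nil; exact: is_cderive_cst.
under eq_fun do rewrite big_cons; rewrite big_cons.
by case: ifPn => // Pi; apply: is_cderiveD => //; exact: H.
Qed.

Lemma is_cderive_conj f p v d : is_cderive f p v d ->
  is_cderive (fun q => conjc (f q)) p v (conjc d).
Proof.
move=> /is_cderiveP[h1 h2]; apply/is_cderiveP; rewrite conjcE; split=> /=.
  by under eq_fun do rewrite conjcE /=.
by under eq_fun do rewrite conjcE /=; exact: is_deriveN.
Qed.

Lemma is_cderive_real (f : V -> R) p v (d : R) : is_derive p v f d ->
  is_cderive (fun q => (f q)%:C) p v d%:C.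
Proof. by move=> h; apply/is_cderiveP; split=> //=; exact: is_derive_cst. Qed.

Definition cdiff f p := differentiable (fun q => complex.Re (f q)) p /\
  differentiable (fun q => complex.Im (f q)) p.

Lemma cdiff_is_cderive f p v : cdiff f p -> is_cderive f p v (cderive f p v).
Proof. by move=> [h1 h2]; split=> //; split; exact: diff_derivable. Qed.

Lemma cderive_near f g p v : (\forall q \near p, f q = g q) -> cderive f p v = cderive g p v.
Proof.
move=> fg; congr (_ +i* _); apply: near_eq_derive; apply: filterS fg => q ->//.
Qed.

Lemma csmooth_ext U f g : open U -> (forall p, U p -> f p = g p) ->
  csmooth_on U f -> csmooth_on U g.
Proof.
move=> oU fg [h1 h2]; split=> k.
  by apply: Ck_ext (h1 k) => // p /fg ->.
by apply: Ck_ext (h2 k) => // p /fg ->.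
Qed.

Lemma csmooth_sub U W f : U `<=` W -> csmooth_on W f -> csmooth_on U f.
Proof. by move=> UW [h1 h2]; split=> k; [exact: Ck_sub (h1 k)|exact: Ck_sub (h2 k)]. Qed.

Lemma csmooth_cst U (a : C) : csmooth_on U (fun=> a).
Proof. by split=> k; exact: Ck_cst. Qed.

Lemma csmoothD U f g : open U -> csmooth_on U f -> csmooth_on U g ->
  csmooth_on U (fun p => f p + g p).
Proof.
move=> oU [h1 h2] [k1 k2]; split=> k.
  by under [X in Ck _ _ X]eq_fun do rewrite cReD; exact: CkD.
by under [X in Ck _ _ X]eq_fun do rewrite cImD; exact: CkD.
Qed.

Lemma csmoothM U f g : open U -> csmooth_on U f -> csmooth_on U g ->
  csmooth_on U (fun p => f p * g p).
Proof.
move=> oU [h1 h2] [k1 k2]; split=> k.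
  under [X in Ck _ _ X]eq_fun do rewrite cReM.
  by apply: CkD => //; [exact: CkM|apply: Ck_opp => //; exact: CkM].
under [X in Ck _ _ X]eq_fun do rewrite cImM.
by apply: CkD => //; exact: CkM.
Qed.

Lemma csmooth_sum U (I : Type) (r : seq I) (P : pred I) (F : I -> V -> C) : open U ->
  (forall i, P i -> csmooth_on U (F i)) -> csmooth_on U (fun p => \sum_(i <- r | P i) F i p).
Proof.
move=> oU H; elim: r => [|i r IH].
  by under [X in csmooth_on _ X]eq_fun do rewrite big_nil; exact: csmooth_cst.
under [X in csmooth_on _ X]eq_fun do rewrite big_cons.
by case Pi : (P i) => //; apply: csmoothD => //; exact: H.
Qed.

Lemma csmoothN U f : open U -> csmooth_on U f -> csmooth_on U (fun p => - f p).
Proof.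
move=> oU H; apply: (@csmooth_ext _ (fun p => -1 * f p)) => // [p _|]; first by rewrite mulN1r.
by apply: csmoothM => //; exact: csmooth_cst.
Qed.

Lemma csmooth_conj U f : open U -> csmooth_on U f -> csmooth_on U (fun p => conjc (f p)).
Proof.
move=> oU [h1 h2]; split=> k.
  by under [X in Ck _ _ X]eq_fun do rewrite conjcE /=; exact: h1.
by under [X in Ck _ _ X]eq_fun do rewrite conjcE /=; exact: Ck_opp.
Qed.

Lemma csmooth_real U (f : V -> R) : smooth_on U f -> csmooth_on U (fun p => (f p)%:C).
Proof. by move=> H; split=> //= k; exact: Ck_cst. Qed.

Lemma csmooth_Re U f : csmooth_on U f -> csmooth_on U (fun p => (complex.Re (f p))%:C).
Proof. by move=> [H _]; exact: csmooth_real. Qed.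

Lemma csmooth_Im U f : csmooth_on U f -> csmooth_on U (fun p => (complex.Im (f p))%:C).
Proof. by move=> [_ H]; exact: csmooth_real. Qed.

Lemma csmooth_cdiff U f p : csmooth_on U f -> U p -> cdiff f p.
Proof. by move=> [h1 h2] Up; split; [exact: smooth_on_diff h1 Up|exact: smooth_on_diff h2 Up]. Qed.

Lemma csmooth_cderive U f v : csmooth_on U f -> csmooth_on U (fun p => cderive f p v).
Proof. by move=> [h1 h2]; split; exact: smooth_on_derive. Qed.

Lemma cschwarz U f p u v : open U -> U p -> csmooth_on U f ->
  cderive (fun q => cderive f q u) p v = cderive (fun q => cderive f q v) p u.
Proof.
move=> oU Up fs; have [h1 h2] := fs.
have [d1 d2] := csmooth_cdiff (csmooth_cderive u fs) Up.
have [e1 e2] := csmooth_cdiff (csmooth_cderive v fs) Up.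
have nRe : \forall q \near p, differentiable (fun q => complex.Re (f q)) q.
  by apply: open_near oU Up _ => q; exact: smooth_on_diff.
have nIm : \forall q \near p, differentiable (fun q => complex.Im (f q)) q.
  by apply: open_near oU Up _ => q; exact: smooth_on_diff.
by rewrite /cderive /= (schwarz nRe d1 e1) (schwarz nIm d2 e2).
Qed.

End ComplexCalculus.

Section ComplexComposition.
Context {R : realType} {V : normedModType R}.
Local Notation C := R[i].

Lemma csmooth_comp_row m (U : set V) (W : set 'rV[R]_m) (F : V -> 'rV[R]_m) (g : 'rV[R]_m -> C) :
  open U -> (forall p, U p -> W (F p)) ->
  (forall j, smooth_on U (fun p => F p ord0 j)) -> csmooth_on W g ->
  csmooth_on U (fun p => g (F p)).
Proof.
move=> oU UW CF [h1 h2].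
have dF p : U p -> differentiable F p.
  by move=> Up; apply: differentiable_row => k; exact: smooth_on_diff (CF k) Up.
by split=> k; apply: (@Ck_comp_row _ _ k m U W F (fun q => _ (g q))) => // j; exact: CF.
Qed.

Lemma cderive_comp_row m (F : V -> 'rV[R]_m) (g : 'rV[R]_m -> C) p v :
  differentiable F p -> cdiff g (F p) ->
  is_cderive (fun q => g (F q)) p v
    (\sum_k ('D_v (fun q => F q ord0 k) p)%:C * cderive g (F p) (delta_mx ord0 k)).
Proof.
move=> dF [h1 h2]; apply/is_cderiveP; rewrite cRe_sum cIm_sum; split.
  apply: DeriveDef.
    apply: diff_derivable; exact: (differentiable_comp dF h1).
  rewrite (derive_comp_row v dF h1); apply: eq_bigr => k _.
  by rewrite cReM /= mul0r subr0.
apply: DeriveDef.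
  apply: diff_derivable; exact: (differentiable_comp dF h2).
rewrite (derive_comp_row v dF h2); apply: eq_bigr => k _.
by rewrite cImM /= mul0r addr0.
Qed.

End ComplexComposition.

(** * Charts and tangent vectors *)

Section Charts.
Context {R : realType} {n : nat} {M : complexManifold R n}.
Local Notation C := R[i].
Local Notation V := 'rV[R]_(n + n).
Implicit Types (c : chart R n M) (U W : set M) (f : M -> C) (x y : M).

Definition chart_image c : set V := chart_map c @` chart_dom c.

Lemma chart_open c : atlas c -> open (chart_dom c).
Proof. by case/atlas_chart. Qed.

Lemma chart_image_open c : atlas c -> open (chart_image c).
Proof. by case/atlas_chart. Qed.

Lemma chart_mapK c x : atlas c -> chart_dom c x -> chart_inv c (chart_map c x) = x.
Proof. by case/atlas_chart => _ _ H _ _; exact: H. Qed.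

Lemma chart_invK c p : atlas c -> chart_image c p ->
  chart_dom c (chart_inv c p) /\ chart_map c (chart_inv c p) = p.
Proof. by move=> ac [x cx <-]; rewrite chart_mapK. Qed.

Lemma chart_map_continuous c x : atlas c -> chart_dom c x -> {for x, continuous (chart_map c)}.
Proof. by case/atlas_chart => _ _ _ H _; exact: H. Qed.

Lemma chart_inv_continuous c p : atlas c -> chart_image c p -> {for p, continuous (chart_inv c)}.
Proof. by case/atlas_chart => _ _ _ _ H; exact: H. Qed.

Lemma chart_imageIP c U p : atlas c ->
  (chart_map c @` (U `&` chart_dom c)) p <-> chart_image c p /\ U (chart_inv c p).
Proof.
move=> ac; split=> [[x [Ux cx] <-]|[[x cx <-] Ux]].
  by split; [exists x|rewrite chart_mapK].
by exists x => //; split=> //; rewrite chart_mapK in Ux.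
Qed.

Lemma chart_imageI_open c U : atlas c -> open U -> open (chart_map c @` (U `&` chart_dom c)).
Proof.
move=> ac oU; rewrite openE => p /(chart_imageIP _ _ ac)[cp Up].
have H1 : nbhs p (chart_image c) by apply: open_nbhs_nbhs; split=> //; exact: chart_image_open.
have H2 : nbhs p [set q | U (chart_inv c q)].
  by apply: (chart_inv_continuous ac cp); apply: open_nbhs_nbhs.
by apply: filterS (filterI H1 H2) => q [h1 h2]; apply/chart_imageIP.
Qed.

Lemma smooth_fun_ext U f g : open U -> (forall x, U x -> f x = g x) ->
  smooth_fun U f -> smooth_fun U g.
Proof.
move=> oU fg H c ac; apply: csmooth_ext (H c ac); first exact: chart_imageI_open.
by move=> p /(chart_imageIP _ _ ac)[_ /fg].
Qed.

Lemma smooth_fun_eq U f g : (forall x, g x = f x) -> smooth_fun U f -> smooth_fun U g.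
Proof. by move=> fg; rewrite (_ : g = f) //; exact/funext. Qed.

Lemma smooth_fun_sub U W f : U `<=` W -> smooth_fun W f -> smooth_fun U f.
Proof.
move=> UW H c ac; apply: csmooth_sub (H c ac).
by move=> _ [x [Ux cx] <-]; exists x => //; split=> //; exact: UW.
Qed.

Lemma smooth_fun_cst U (a : C) : smooth_fun U (fun=> a).
Proof. by move=> c ac; exact: csmooth_cst. Qed.

Lemma smooth_funD U f g : open U -> smooth_fun U f -> smooth_fun U g ->
  smooth_fun U (fun x => f x + g x).
Proof.
by move=> oU hf hg c ac; apply: csmoothD; [exact: chart_imageI_open|exact: hf|exact: hg].
Qed.

Lemma smooth_funM U f g : open U -> smooth_fun U f -> smooth_fun U g ->
  smooth_fun U (fun x => f x * g x).
Proof.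
by move=> oU hf hg c ac; apply: csmoothM; [exact: chart_imageI_open|exact: hf|exact: hg].
Qed.

Lemma smooth_funN U f : open U -> smooth_fun U f -> smooth_fun U (fun x => - f x).
Proof. by move=> oU hf c ac; apply: csmoothN; [exact: chart_imageI_open|exact: hf]. Qed.

Lemma smooth_fun_sum U (I : Type) (r : seq I) (P : pred I) (F : I -> M -> C) : open U ->
  (forall i, P i -> smooth_fun U (F i)) -> smooth_fun U (fun x => \sum_(i <- r | P i) F i x).
Proof.
move=> oU H c ac; apply: (@csmooth_sum _ _ _ _ _ _ (fun i p => F i (chart_inv c p))).
  exact: chart_imageI_open.
by move=> i Pi; exact: H.
Qed.

Lemma smooth_fun_conj U f : open U -> smooth_fun U f -> smooth_fun U (fun x => conjc (f x)).
Proof. by move=> oU hf c ac; apply: csmooth_conj; [exact: chart_imageI_open|exact: hf]. Qed.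

Lemma smooth_fun_Re U f : smooth_fun U f -> smooth_fun U (fun x => (complex.Re (f x))%:C).
Proof. by move=> hf c ac; apply: csmooth_Re; exact: hf. Qed.

Lemma smooth_fun_Im U f : smooth_fun U f -> smooth_fun U (fun x => (complex.Im (f x))%:C).
Proof. by move=> hf c ac; apply: csmooth_Im; exact: hf. Qed.

Lemma smooth_near_fun U x f : open U -> U x -> smooth_fun U f -> smooth_near x f.
Proof. by exists U. Qed.

Lemma smooth_near_cst x (a : C) : smooth_near x (fun=> a).
Proof. by exists setT; split=> //; [exact: openT|exact: smooth_fun_cst]. Qed.

(** [smooth_fun] refers to all charts of the atlas; the transition maps being smooth, one chart
    around [U] is enough. *)
Lemma smooth_fun_chart c U f : atlas c -> open U -> U `<=` chart_dom c ->
  csmooth_on (chart_map c @` U) (fun p => f (chart_inv c p)) -> smooth_fun U f.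
Proof.
move=> ac oU Uc H c' ac'.
have oc' := chart_imageI_open ac' oU.
have [tr _] := atlas_holomorphic ac' ac.
have sub : chart_map c' @` (U `&` chart_dom c') `<=` chart_map c' @` (chart_dom c' `&` chart_dom c).
  by move=> _ [x [Ux cx] <-]; exists x => //; split=> //; exact: Uc.
have Up p : (chart_map c' @` (U `&` chart_dom c')) p -> U (chart_inv c' p).
  by move=> /(chart_imageIP _ _ ac')[].
apply: (@csmooth_ext _ _ _ (fun p => f (chart_inv c (chart_map c (chart_inv c' p))))) => //.
  by move=> p /Up Ux; rewrite chart_mapK //; exact: Uc.
apply: (@csmooth_comp_row _ _ _ _ _ (fun p => chart_map c (chart_inv c' p)) (fun p => f (chart_inv c p)) oc' _ _ H).
  by move=> p /Up Ux; exists (chart_inv c' p).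
by move=> j k; apply: Ck_sub sub _; exact: tr.
Qed.

Lemma smooth_coordinate m (U : set 'rV[R]_m) (j : 'I_m) : smooth_on U (fun p => p ord0 j).
Proof.
have dc p : differentiable (fun p : 'rV[R]_m => p ord0 j) p by exact: differentiable_coord.
have Dc v : 'D_v (fun p : 'rV[R]_m => p ord0 j) = fun=> v ord0 j.
  apply/funext => p; rewrite -[in LHS](scale1r v).
  have -> : 'D_(1 *: v) (fun p : 'rV[R]_m => p ord0 j) p = 'D_v (fun p : 'rV[R]_m => p ord0 j) p by rewrite scale1r.
  rewrite -[RHS](_ : 'D_v (fun q : 'rV[R]_m => q) p ord0 j = _); last by rewrite derive_id.
  rewrite derive_mx; last exact: derivable_id.
  by rewrite mxE.
case=> [|k]; first by move=> p _; apply: differentiable_continuous.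
by split=> // v; rewrite Dc; exact: Ck_cst.
Qed.

(** Coordinates as complex functions, so that tangent vectors can be applied to them:
    [chart_vec c x u] sends [coord c k] to the [k]-th component of [u], hence determines its
    components. *)
Definition coord c (k : 'I_(n + n)) : M -> C := fun x => (chart_map c x ord0 k)%:C.

Lemma coord_smooth c k : atlas c -> smooth_fun (chart_dom c) (coord c k).
Proof.
move=> ac; apply: (smooth_fun_chart ac) => //; first exact: chart_open.
apply: (@csmooth_ext _ _ _ (fun p : V => (p ord0 k)%:C)); first exact: chart_image_open.
  by move=> p /(chart_invK ac)[_ pE]; rewrite /coord pE.
exact/csmooth_real/smooth_coordinate.
Qed.

Definition cpart c (k : 'I_(n + n)) f : M -> C :=
  fun x => cderive (fun p => f (chart_inv c p)) (chart_map c x) (delta_mx ord0 k).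

Lemma cpart_smooth c k U f : atlas c -> open U -> U `<=` chart_dom c ->
  smooth_fun U f -> smooth_fun U (cpart c k f).
Proof.
move=> ac oU Uc H; apply: (smooth_fun_chart ac) => //.
have UE : chart_map c @` U = chart_map c @` (U `&` chart_dom c).
  by congr (_ @` _); apply/seteqP; split=> [x Ux|x []//]; split=> //; exact: Uc.
rewrite UE; have oU' := chart_imageI_open ac oU.
apply: (csmooth_ext oU' _ (csmooth_cderive (delta_mx ord0 k) (H c ac))).
by move=> p /(chart_imageIP _ _ ac)[/(chart_invK ac)[_ pE] _]; rewrite /cpart pE.
Qed.

Lemma smooth_near_cdiff c x f : atlas c -> chart_dom c x -> smooth_near x f ->
  cdiff (fun p => f (chart_inv c p)) (chart_map c x).
Proof.
move=> ac cx [U [oU Ux /(_ c ac) H]]; apply: csmooth_cdiff H _.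
by exists x.
Qed.

Lemma cpart_near c k x f g : atlas c -> chart_dom c x -> (\forall y \near x, f y = g y) ->
  cpart c k f x = cpart c k g x.
Proof.
move=> ac cx fg; apply: cderive_near.
have := chart_inv_continuous ac (ex_intro2 _ _ x cx erefl).
rewrite /prop_for /continuous_at chart_mapK // => H.
exact: (H _ fg).
Qed.

Lemma cpart_is_cderive c k x f : atlas c -> chart_dom c x -> smooth_near x f ->
  is_cderive (fun p => f (chart_inv c p)) (chart_map c x) (delta_mx ord0 k) (cpart c k f x).
Proof. by move=> ac cx fx; apply/cdiff_is_cderive/smooth_near_cdiff. Qed.

Lemma cpartD c k x f g : atlas c -> chart_dom c x -> smooth_near x f -> smooth_near x g ->
  cpart c k (fun y => f y + g y) x = cpart c k f x + cpart c k g x.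
Proof. by move=> ac cx fx gx; case: (is_cderiveD (cpart_is_cderive k ac cx fx) (cpart_is_cderive k ac cx gx)). Qed.

Lemma cpartM c k x f g : atlas c -> chart_dom c x -> smooth_near x f -> smooth_near x g ->
  cpart c k (fun y => f y * g y) x = cpart c k f x * g x + f x * cpart c k g x.
Proof.
move=> ac cx fx gx.
case: (is_cderiveM (cpart_is_cderive k ac cx fx) (cpart_is_cderive k ac cx gx)) => _.
by rewrite chart_mapK.
Qed.

Lemma cpart_sum c k x (I : Type) (r : seq I) (P : pred I) (F : I -> M -> C) :
  atlas c -> chart_dom c x -> (forall i, P i -> smooth_near x (F i)) ->
  cpart c k (fun y => \sum_(i <- r | P i) F i y) x = \sum_(i <- r | P i) cpart c k (F i) x.
Proof.
move=> ac cx Fx.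
by case: (@is_cderive_sum _ _ I r P (fun i p => F i (chart_inv c p)) (chart_map c x) _ _
  (fun i Pi => cpart_is_cderive k ac cx (Fx i Pi))).
Qed.

Lemma cpart_cst c k x (a : C) : cpart c k (fun=> a) x = 0.
Proof. by case: (is_cderive_cst a (chart_map c x) (delta_mx ord0 k)). Qed.

Lemma cpart_conj c k x f : atlas c -> chart_dom c x -> smooth_near x f ->
  cpart c k (fun y => conjc (f y)) x = conjc (cpart c k f x).
Proof. by move=> ac cx fx; case: (is_cderive_conj (cpart_is_cderive k ac cx fx)). Qed.

Lemma cpart_sym c k l U x f : atlas c -> open U -> U x -> U `<=` chart_dom c -> smooth_fun U f ->
  cpart c k (cpart c l f) x = cpart c l (cpart c k f) x.
Proof.
move=> ac oU Ux Uc fs; have cx := Uc _ Ux.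
have oI := chart_image_open ac.
have xI : chart_image c (chart_map c x) by exists x.
have E j m : cpart c j (cpart c m f) x =
    cderive (fun p => cderive (fun p => f (chart_inv c p)) p (delta_mx ord0 m)) (chart_map c x) (delta_mx ord0 j).
  by apply: cderive_near; apply: open_near oI xI _ => p /(chart_invK ac)[_ pE]; rewrite /cpart pE.
rewrite !E; apply: (cschwarz _ _ (chart_imageI_open ac oU) _ (fs c ac)).
by exists x.
Qed.

Lemma cpart_coord c k l x : atlas c -> chart_dom c x -> cpart c k (coord c l) x = (k == l)%:R.
Proof.
move=> ac cx.
have oI := chart_image_open ac.
have xI : chart_image c (chart_map c x) by exists x.
have -> : cpart c k (coord c l) x = cderive (fun p : V => (p ord0 l)%:C) (chart_map c x) (delta_mx ord0 k).
  by apply: cderive_near; apply: open_near oI xI _ => p /(chart_invK ac)[_ pE]; rewrite /coord pE.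
have : is_derive (chart_map c x) (delta_mx ord0 k) (fun p : V => p ord0 l) ((k == l)%:R : R).
  apply: DeriveDef; first by apply: diff_derivable; exact: differentiable_coord.
  have := @derive_id R V (chart_map c x) (delta_mx ord0 k).
  rewrite derive_mx; last exact: derivable_id.
  by move=> /matrixP/(_ ord0 l); rewrite !mxE eqxx /= eq_sym.
move=> /is_cderive_real[_ ->].
by case: eqP.
Qed.

Lemma chart_vecE c x (u : 'rV[C]_(n + n)) f : smooth_near x f ->
  chart_vec c x u f = \sum_k u ord0 k * cpart c k f x.
Proof. by move=> fx; rewrite /chart_vec; case: asboolP. Qed.

Lemma chart_vec_not c x (u : 'rV[C]_(n + n)) f : ~ smooth_near x f -> chart_vec c x u f = 0.
Proof. by move=> fx; rewrite /chart_vec; case: asboolP. Qed.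

Lemma chart_vec_coord c x (u : 'rV[C]_(n + n)) l : atlas c -> chart_dom c x ->
  chart_vec c x u (coord c l) = u ord0 l.
Proof.
move=> ac cx; rewrite chart_vecE; last first.
  by exists (chart_dom c); split; [exact: chart_open| |exact: coord_smooth].
rewrite (bigD1 l) //= cpart_coord // eqxx mulr1 big1 ?addr0 // => k kl.
by rewrite cpart_coord // (negPf kl) mulr0.
Qed.

Lemma chart_vec_inj c x (u w : 'rV[C]_(n + n)) : atlas c -> chart_dom c x ->
  chart_vec c x u = chart_vec c x w -> u = w.
Proof.
by move=> ac cx E; apply/rowP => k; rewrite -(chart_vec_coord u k ac cx) E chart_vec_coord.
Qed.

Lemma chart_vecD c x (u w : 'rV[C]_(n + n)) :
  chart_vec c x (u + w) = chart_vec c x u + chart_vec c x w.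
Proof.
apply/funext => f; rewrite /chart_vec fctE; case: ifP => _; last by rewrite addr0.
by rewrite -big_split; apply: eq_bigr => k _; rewrite mxE mulrDl.
Qed.

Lemma chart_vecZ c x (a : C) (u : 'rV[C]_(n + n)) :
  chart_vec c x (a *: u) = a *: chart_vec c x u.
Proof.
apply/funext => f; rewrite /chart_vec fctE; case: ifP => _; last by rewrite scaler0.
by rewrite scaler_sumr; apply: eq_bigr => k _; rewrite mxE -mulrA.
Qed.

Lemma chart_vec_sum c x (I : Type) (r : seq I) (P : pred I) (u : I -> 'rV[C]_(n + n)) :
  chart_vec c x (\sum_(i <- r | P i) u i) = \sum_(i <- r | P i) chart_vec c x (u i).
Proof.
apply: (big_morph (chart_vec c x)); first exact: chart_vecD.
by rewrite -[0 in LHS](scale0r 0) chart_vecZ scale0r.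
Qed.

Lemma chart_vec0 c x : chart_vec c x 0 = 0.
Proof. by rewrite -[0 in LHS](scale0r 0) chart_vecZ scale0r. Qed.

(** Row convention: components [u] in [c'] become [u *m jac c' c x] in [c]. *)
Definition jac c' c x : 'M[R]_(n + n) :=
  \matrix_(k, j) 'D_(delta_mx ord0 k) (fun p => chart_map c (chart_inv c' p) ord0 j) (chart_map c' x).

Lemma jac_smooth c' c k j : atlas c -> atlas c' ->
  smooth_fun (chart_dom c' `&` chart_dom c) (fun x => (jac c' c x k j)%:C).
Proof.
move=> ac ac'; have [tr _] := atlas_holomorphic ac' ac.
have oU : open (chart_dom c' `&` chart_dom c) by apply: openI; exact: chart_open.
apply: (smooth_fun_chart ac') => //.
have oI : open (chart_map c' @` (chart_dom c' `&` chart_dom c)).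
  by rewrite setIC; apply: chart_imageI_open => //; exact: chart_open.
apply: (csmooth_ext oI _ (csmooth_real (smooth_on_derive (delta_mx ord0 k) (tr j)))).
by move=> p [x [cx c'x] <-]; rewrite mxE chart_mapK.
Qed.

Lemma chart_vec_change c c' x (u : 'rV[C]_(n + n)) : atlas c -> atlas c' ->
  chart_dom c x -> chart_dom c' x ->
  chart_vec c' x u = chart_vec c x (u *m map_mx (real_complex R) (jac c' c x)).
Proof.
move=> ac ac' cx c'x; apply/funext => f.
have [fx|nfx] := pselect (smooth_near x f); last by rewrite !chart_vec_not.
rewrite !chart_vecE //.
have [tr _] := atlas_holomorphic ac' ac.
pose F p := chart_map c (chart_inv c' p).
have Ox : (chart_map c' @` (chart_dom c' `&` chart_dom c)) (chart_map c' x) by exists x.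
have oO : open (chart_map c' @` (chart_dom c' `&` chart_dom c)).
  by rewrite setIC; apply: chart_imageI_open => //; exact: chart_open.
have dF : differentiable F (chart_map c' x).
  by apply: differentiable_row => k; exact: smooth_on_diff (tr k) Ox.
have Fx : F (chart_map c' x) = chart_map c x by rewrite /F chart_mapK.
have E k : cpart c' k f x = \sum_j (jac c' c x k j)%:C * cpart c j f x.
  have := cderive_comp_row (g := fun p => f (chart_inv c p)) (delta_mx ord0 k) dF.
  rewrite Fx => /(_ (smooth_near_cdiff ac cx fx))[_ H].
  transitivity (cderive (fun q => f (chart_inv c (F q))) (chart_map c' x) (delta_mx ord0 k)).
    apply: cderive_near; apply: open_near oO Ox _ => _ [y [c'y cy] <-].
    by rewrite /F !chart_mapK.
  by rewrite H; apply: eq_bigr => j _; rewrite mxE.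
under eq_bigr do rewrite E mulr_sumr.
rewrite exchange_big /=; apply: eq_bigr => j _.
rewrite mxE mulr_suml; apply: eq_bigr => k _.
by rewrite mulrA [X in _ = _ * X * _]mxE.
Qed.

(** Multiplication by the Jacobian is the differential of the transition map, so this is its
    Cauchy-Riemann equation. *)
Lemma jac_stdJ c c' x : atlas c -> atlas c' -> chart_dom c x -> chart_dom c' x ->
  forall u : 'rV[R]_(n + n), stdJ u *m jac c' c x = stdJ (u *m jac c' c x).
Proof.
move=> ac ac' cx c'x; have [tr CR] := atlas_holomorphic ac' ac.
pose F p := chart_map c (chart_inv c' p).
have Ox : (chart_map c' @` (chart_dom c' `&` chart_dom c)) (chart_map c' x) by exists x.
have dF : differentiable F (chart_map c' x).
  by apply: differentiable_row => k; exact: smooth_on_diff (tr k) Ox.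
have E (v : V) : v *m jac c' c x = 'D_v F (chart_map c' x).
  rewrite [v in RHS]row_sum_delta deriveE // linear_sum.
  rewrite mulmx_sum_row; apply: eq_bigr => k _; rewrite linearZ /= -deriveE //.
  congr (_ *: _); rewrite derive_mx; last exact: diff_derivable.
  by apply/rowP => j; rewrite !mxE.
by move=> u; rewrite !E; exact: CR.
Qed.

End Charts.

Local Notation smooth_row U p := (forall k, smooth_fun U (fun x => p x ord0 k)).

(** * Complex rows and their splitting by type *)

Section ComplexRows.
Context {R : realType}.
Local Notation C := R[i].

Definition rcx {m k} (u : 'M[R]_(m, k)) : 'M[C]_(m, k) := map_mx (real_complex R) u.
Definition reM {m k} (u : 'M[C]_(m, k)) : 'M[R]_(m, k) := map_mx (@complex.Re R) u.
Definition imM {m k} (u : 'M[C]_(m, k)) : 'M[R]_(m, k) := map_mx (@complex.Im R) u.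

Lemma rcx_parts {m k} (u : 'M[C]_(m, k)) : u = rcx (reM u) + 'i%C *: rcx (imM u).
Proof. by apply/matrixP => i j; rewrite !mxE [LHS]complexE. Qed.

Lemma rcx_inj {m k} : injective (@rcx m k).
Proof. by move=> u v /matrixP E; apply/matrixP => i j; have := E i j; rewrite !mxE => -[]. Qed.

Lemma rcxM {m k l} (u : 'M[R]_(m, k)) (v : 'M[R]_(k, l)) : rcx (u *m v) = rcx u *m rcx v.
Proof. exact: map_mxM. Qed.

Lemma addC_conj (z : C) : z + conjc z = 2 * (complex.Re z)%:C.
Proof. by rewrite mulr_natl mulr2n; case: z => a b; apply: complex_ext; rewrite /= ?subrr ?addr0. Qed.

Lemma subC_conj (z : C) : z - conjc z = 2 * 'i%C * (complex.Im z)%:C.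
Proof.
rewrite -mulrA mulr_natl mulr2n; case: z => a b; by apply: complex_ext; rewrite /=; ring.
Qed.

Context {n : nat}.

Lemma stdJD (T : pzRingType) (u v : 'rV[T]_(n + n)) : stdJ (u + v) = stdJ u + stdJ v.
Proof. by rewrite /stdJ !linearD add_row_mx. Qed.

Lemma stdJZ (T : pzRingType) (a : T) (u : 'rV[T]_(n + n)) : stdJ (a *: u) = a *: stdJ u.
Proof. by rewrite /stdJ !linearZ /= scale_row_mx scalerN. Qed.

Lemma stdJ_rcx (u : 'rV[R]_(n + n)) : stdJ (rcx u) = rcx (stdJ u).
Proof. by rewrite /stdJ /rcx map_row_mx -map_lsubmx -map_rsubmx map_mxN. Qed.

(** [iota10 p] holds the components of [2 sum_k p_k d/dz^k], and [iota01 p] those of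
    [2 sum_k p_k d/dzbar^k]; the factors 2 and [2^-1] below come from here. *)
Definition iota10 (p : 'rV[C]_n) : 'rV[C]_(n + n) := row_mx p (- ('i%C : C) *: p).
Definition iota01 (p : 'rV[C]_n) : 'rV[C]_(n + n) := row_mx p (('i%C : C) *: p).

Let ii : 'i%C * 'i%C = -1 :> C.
Proof. by rewrite -expr2 sqr_i. Qed.

Lemma stdJ_iota10 p : stdJ (iota10 p) = 'i%C *: iota10 p.
Proof.
rewrite /stdJ /iota10 row_mxKl row_mxKr scale_row_mx scalerA mulrN ii opprK scale1r.
by rewrite scaleNr opprK.
Qed.

Lemma stdJ_iota01 p : stdJ (iota01 p) = - ('i%C : C) *: iota01 p.
Proof.
by rewrite /stdJ /iota01 row_mxKl row_mxKr scale_row_mx scalerA mulNr ii opprK scale1r scaleNr.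
Qed.

Lemma iota10P (u : 'rV[C]_(n + n)) : stdJ u = 'i%C *: u -> u = iota10 (lsubmx u).
Proof.
move=> E; have : row_mx (- rsubmx u) (lsubmx u) = row_mx ('i%C *: lsubmx u) ('i%C *: rsubmx u).
  by rewrite -scale_row_mx hsubmxK.
move=> /eq_row_mx[_ El].
by rewrite -[LHS]hsubmxK /iota10 El scalerA mulNr ii opprK scale1r.
Qed.

Lemma iota10D p q : iota10 (p + q) = iota10 p + iota10 q.
Proof. by rewrite /iota10 scalerDr add_row_mx. Qed.

Lemma iota10Z a p : iota10 (a *: p) = a *: iota10 p.
Proof. by rewrite /iota10 scale_row_mx !scalerA mulrC. Qed.

Lemma iota10_sum (I : Type) (r : seq I) (P : pred I) (F : I -> 'rV[C]_n) :
  iota10 (\sum_(i <- r | P i) F i) = \sum_(i <- r | P i) iota10 (F i).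
Proof.
apply: (big_morph iota10); first exact: iota10D.
by rewrite -[0 in LHS](scale0r 0) iota10Z scale0r.
Qed.

Lemma iota10_inj : injective iota10.
Proof. by move=> p q /eq_row_mx[]. Qed.

Lemma iota10_l p (k : 'I_n) : iota10 p ord0 (lshift n k) = p ord0 k.
Proof. by rewrite /iota10 row_mxEl. Qed.

Lemma iota10_r p (k : 'I_n) : iota10 p ord0 (rshift n k) = - 'i%C * p ord0 k.
Proof. by rewrite /iota10 row_mxEr mxE. Qed.

Lemma iota01_conj p : iota01 (map_mx conjc p) = map_mx conjc (iota10 p).
Proof.
rewrite /iota01 /iota10 map_row_mx; congr row_mx; apply/rowP => k; rewrite !mxE rmorphM /=.
by congr (_ * _); apply: complex_ext => /=; rewrite ?oppr0 ?opprK.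
Qed.

End ComplexRows.

(** * Tangent vectors and sections in a chart *)

Section TangentVectors.
Context {R : realType} {n : nat} {M : complexManifold R n}.
Local Notation C := R[i].
Implicit Types (c : chart R n M) (U W : set M) (f : M -> C) (x y : M) (v w : tvec M).

Lemma jac_stdJ_complex c c' x (u : 'rV[C]_(n + n)) : atlas c -> atlas c' ->
  chart_dom c x -> chart_dom c' x ->
  stdJ u *m rcx (jac c' c x) = stdJ (u *m rcx (jac c' c x)).
Proof.
move=> ac ac' cx c'x.
have E (v : 'rV[R]_(n + n)) : stdJ (rcx v) *m rcx (jac c' c x) = stdJ (rcx v *m rcx (jac c' c x)).
  by rewrite stdJ_rcx -!rcxM stdJ_rcx jac_stdJ.
have -> : stdJ u = stdJ (rcx (reM u)) + 'i%C *: stdJ (rcx (imM u)).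
  by rewrite -stdJZ -stdJD -rcx_parts.
rewrite mulmxDl -scalemxAl !E -stdJZ -stdJD scalemxAl -mulmxDl -rcx_parts //.
Qed.

(** [is_J] refers to some chart; Jacobians commute with [stdJ], so every chart around [x] gives the
    same operator. *)
Lemma is_J_chart c x (u : 'rV[C]_(n + n)) w : atlas c -> chart_dom c x ->
  is_J x (chart_vec c x u) w <-> w = chart_vec c x (stdJ u).
Proof.
move=> ac cx; split=> [[c' [u' [ac' c'x E ->]]]|->]; last by exists c, u.
rewrite (chart_vec_change u' ac ac' cx c'x) in E.
by rewrite (chart_vec_change _ ac ac' cx c'x) (chart_vec_inj ac cx E) jac_stdJ_complex.
Qed.

Lemma is_J_chart_ex c x v w : atlas c -> chart_dom c x -> is_J x v w ->
  exists u, v = chart_vec c x u.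
Proof.
move=> ac cx [c' [u' [ac' c'x -> _]]]; exists (u' *m rcx (jac c' c x)).
exact: chart_vec_change.
Qed.

Lemma tangent_chart c x v : atlas c -> chart_dom c x -> tangent x v ->
  exists u : 'rV[R]_(n + n), v = chart_vec c x (rcx u).
Proof.
move=> ac cx [c' [u [ac' c'x ->]]]; exists (u *m jac c' c x).
by rewrite (chart_vec_change _ ac ac' cx c'x) -map_mxM.
Qed.

Lemma tangent_rcx c x (u : 'rV[R]_(n + n)) : atlas c -> chart_dom c x ->
  tangent x (chart_vec c x (rcx u)).
Proof. by move=> ac cx; exists c, u. Qed.

Definition vec10 c x (p : 'rV[C]_n) : tvec M := chart_vec c x (iota10 p).

Lemma T10_vec10 c x p : atlas c -> chart_dom c x -> T10 x (vec10 c x p).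
Proof.
by move=> ac cx; apply/is_J_chart => //; rewrite stdJ_iota10 chart_vecZ.
Qed.

Lemma T10_chart c x v : atlas c -> chart_dom c x -> T10 x v -> exists p, v = vec10 c x p.
Proof.
move=> ac cx Tv; have [u E] := is_J_chart_ex ac cx Tv.
exists (lsubmx u); rewrite E /vec10 -iota10P //.
move: Tv; rewrite /T10 E => /(is_J_chart _ _ ac cx).
by rewrite -chart_vecZ => /(chart_vec_inj ac cx).
Qed.

(** The first half of [iota10 p] is [p], so the coordinates [x^k] alone recover a (1,0) vector. *)
Definition comp10 c v : 'rV[C]_n := \row_k v (coord c (lshift n k)).

Lemma comp10K c x p : atlas c -> chart_dom c x -> comp10 c (vec10 c x p) = p.
Proof.
move=> ac cx; apply/rowP => k; rewrite mxE /vec10 chart_vec_coord //.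
exact: iota10_l.
Qed.

Lemma vec10_comp c x v : atlas c -> chart_dom c x -> T10 x v -> vec10 c x (comp10 c v) = v.
Proof. by move=> ac cx /(T10_chart ac cx)[p ->]; rewrite comp10K. Qed.

Lemma vec10D c x p q : vec10 c x (p + q) = vec10 c x p + vec10 c x q.
Proof. by rewrite /vec10 iota10D chart_vecD. Qed.

Lemma vec10Z c x a p : vec10 c x (a *: p) = a *: vec10 c x p.
Proof. by rewrite /vec10 iota10Z chart_vecZ. Qed.

Lemma vec10_sum c x (I : Type) (r : seq I) (P : pred I) (F : I -> 'rV[C]_n) :
  vec10 c x (\sum_(i <- r | P i) F i) = \sum_(i <- r | P i) vec10 c x (F i).
Proof. by rewrite /vec10 iota10_sum chart_vec_sum. Qed.

Lemma csection_sub U W X : W `<=` U -> csection U X -> csection W X.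
Proof.
move=> WU H c ac; have [u [us uE]] := H c ac; exists u; split.
  by move=> k; apply: smooth_fun_sub (us k) => x [/WU].
by move=> x /WU Ux; exact: uE.
Qed.

Lemma csection_chart c U X : atlas c -> U `<=` chart_dom c -> csection U X ->
  exists u : M -> 'rV[C]_(n + n), smooth_row U u /\
    forall x, U x -> X x = chart_vec c x (u x).
Proof.
move=> ac Uc H; have [u [us uE]] := H c ac; exists u; split.
  by move=> k; apply: smooth_fun_sub (us k) => x Ux; split=> //; exact: Uc.
by move=> x Ux; apply: uE => //; exact: Uc.
Qed.

Lemma csection_intro c U X (u : M -> 'rV[C]_(n + n)) : atlas c -> open U -> U `<=` chart_dom c ->
  smooth_row U u ->
  (forall x, U x -> X x = chart_vec c x (u x)) -> csection U X.
Proof.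
move=> ac oU Uc us uE c' ac'.
have oU' : open (U `&` chart_dom c') by apply: openI => //; exact: chart_open.
exists (fun x => u x *m rcx (jac c c' x)); split=> [k|x Ux c'x]; last first.
  by rewrite uE // (chart_vec_change _ ac' ac c'x (Uc _ Ux)).
apply: (@smooth_fun_ext _ _ _ _ (fun x => \sum_j u x ord0 j * (jac c c' x j k)%:C)) => //.
  by move=> x _; rewrite mxE; apply: eq_bigr => j _; rewrite [RHS]mulrC [in RHS]mxE mulrC.
apply: smooth_fun_sum => // j _; apply: smooth_funM => //.
  by apply: smooth_fun_sub (us j) => x [].
by apply: smooth_fun_sub (jac_smooth j k ac' ac) => x [/Uc].
Qed.

Lemma rsection_sub U W X : W `<=` U -> rsection U X -> rsection W X.
Proof. by move=> WU [h1 h2]; split; [exact: csection_sub h1|move=> x /WU; exact: h2]. Qed.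

Lemma rsection_chart c U X : atlas c -> U `<=` chart_dom c -> rsection U X ->
  exists u : M -> 'rV[R]_(n + n), (forall k, smooth_fun U (fun x => (u x ord0 k)%:C)) /\
    forall x, U x -> X x = chart_vec c x (rcx (u x)).
Proof.
move=> ac Uc [/(csection_chart ac Uc)[u [us uE]] tX].
exists (fun x => reM (u x)); split.
  move=> k; have := smooth_fun_Re (us k); congr smooth_fun.
  by apply/funext => x; rewrite mxE.
move=> x Ux; have cx := Uc _ Ux; rewrite uE //; congr chart_vec.
have [r E] := tangent_chart ac cx (tX _ Ux).
rewrite uE // in E; rewrite (chart_vec_inj ac cx E); congr rcx.
by apply/rowP => k; rewrite !mxE.
Qed.

Lemma rsection_intro c U X (u : M -> 'rV[R]_(n + n)) : atlas c -> open U -> U `<=` chart_dom c ->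
  (forall k, smooth_fun U (fun x => (u x ord0 k)%:C)) ->
  (forall x, U x -> X x = chart_vec c x (rcx (u x))) -> rsection U X.
Proof.
move=> ac oU Uc us uE; split.
  apply: (csection_intro ac oU Uc _ uE) => k.
  by have := us k; congr smooth_fun; apply/funext => x; rewrite mxE.
by move=> x Ux; rewrite uE //; apply: tangent_rcx => //; exact: Uc.
Qed.

Lemma section10_sub U W X : W `<=` U -> section10 U X -> section10 W X.
Proof. by move=> WU [h1 h2]; split; [exact: csection_sub h1|move=> x /WU; exact: h2]. Qed.

Lemma section10_chart c U X : atlas c -> U `<=` chart_dom c -> section10 U X ->
  exists p : M -> 'rV[C]_n, smooth_row U p /\
    forall x, U x -> X x = vec10 c x (p x).
Proof.
move=> ac Uc [/(csection_chart ac Uc)[u [us uE]] tX].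
exists (fun x => lsubmx (u x)); split.
  by move=> k; have := us (lshift n k); congr smooth_fun; apply/funext => x; rewrite mxE.
move=> x Ux; have cx := Uc _ Ux.
have [p E] := T10_chart ac cx (tX _ Ux); rewrite E.
by move: E; rewrite uE // => /(chart_vec_inj ac cx) ->; rewrite /iota10 row_mxKl.
Qed.

Lemma iota10_smooth U (p : M -> 'rV[C]_n) k : open U ->
  smooth_row U p -> smooth_fun U (fun x => iota10 (p x) ord0 k).
Proof.
move=> oU ps; case: (split_ordP k) => j ->.
  by apply: smooth_fun_eq (ps j) => x; exact: iota10_l.
apply: (smooth_fun_eq (fun x => iota10_r _ _)).
by apply: smooth_funM => //; exact: smooth_fun_cst.
Qed.

Lemma section10_intro c U X (p : M -> 'rV[C]_n) : atlas c -> open U -> U `<=` chart_dom c ->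
  smooth_row U p ->
  (forall x, U x -> X x = vec10 c x (p x)) -> section10 U X.
Proof.
move=> ac oU Uc ps pE; split.
  by apply: (csection_intro ac oU Uc _ pE) => k; exact: iota10_smooth.
by move=> x Ux; rewrite pE //; apply: T10_vec10 => //; exact: Uc.
Qed.

Lemma smooth_near_conj x f : smooth_near x f -> smooth_near x (fun y => conjc (f y)).
Proof. by move=> [U [oU Ux fs]]; exists U; split=> //; exact: smooth_fun_conj. Qed.

Lemma chart_vec_conj c x (u : 'rV[C]_(n + n)) f : atlas c -> chart_dom c x ->
  conjc (chart_vec c x u (fun y => conjc (f y))) = chart_vec c x (map_mx conjc u) f.
Proof.
move=> ac cx; have [fx|nfx] := pselect (smooth_near x f).
  rewrite !chart_vecE //; last exact: smooth_near_conj.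
  rewrite rmorph_sum; apply: eq_bigr => k _.
  by rewrite cpart_conj // rmorphM mxE; congr (_ * _); exact: conjcK.
rewrite !chart_vec_not ?conjc0 // => h; apply: nfx.
by have := smooth_near_conj h; under [X in smooth_near _ X]eq_fun do rewrite conjcK.
Qed.

Lemma re_vec_chart c x (u : 'rV[C]_(n + n)) : atlas c -> chart_dom c x ->
  re_vec (chart_vec c x u) = chart_vec c x (rcx (reM u)).
Proof.
move=> ac cx; apply/funext => f; rewrite /re_vec chart_vec_conj //.
rewrite -[LHS]/((chart_vec c x u + chart_vec c x (map_mx conjc u)) f / 2).
rewrite -chart_vecD [X in chart_vec _ _ X](_ : _ = 2 *: rcx (reM u)).
  by rewrite chart_vecZ fctE /GRing.scale /= mulrC mulKf // pnatr_eq0.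
by apply/rowP => k; rewrite !mxE addC_conj.
Qed.

Lemma im_vec_chart c x (u : 'rV[C]_(n + n)) : atlas c -> chart_dom c x ->
  im_vec (chart_vec c x u) = chart_vec c x (rcx (imM u)).
Proof.
move=> ac cx; apply/funext => f; rewrite /im_vec chart_vec_conj //.
have -> : chart_vec c x u f - chart_vec c x (map_mx conjc u) f =
    (chart_vec c x (u - map_mx conjc u)) f by rewrite -[- map_mx _ _]scaleN1r chart_vecD chart_vecZ scaleN1r.
rewrite [X in chart_vec _ _ X](_ : _ = (2 * 'i%C) *: rcx (imM u)).
  rewrite chart_vecZ fctE /GRing.scale /= mulrC mulKf // mulf_neq0 ?pnatr_eq0 //.
  by rewrite neq0Ci.
by apply/rowP => k; rewrite !mxE subC_conj.
Qed.

(** The terms with second derivatives of [f] in [X (Y f)] and [Y (X f)] agree by symmetry of partial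
    derivatives. The function [f] is smooth only near [x], hence the passage to the intersection
    [O]. *)
Lemma bracket_chart c U X Y (u w : M -> 'rV[C]_(n + n)) x : atlas c -> open U ->
  U `<=` chart_dom c -> U x ->
  smooth_row U u -> smooth_row U w ->
  (forall y, U y -> X y = chart_vec c y (u y)) -> (forall y, U y -> Y y = chart_vec c y (w y)) ->
  bracket X Y x = chart_vec c x (\row_k \sum_a
    (u x ord0 a * cpart c a (fun y => w y ord0 k) x - w x ord0 a * cpart c a (fun y => u y ord0 k) x)).
Proof.
move=> ac oU Uc Ux us ws XE YE; have cx := Uc _ Ux; apply/funext => f; rewrite /bracket.
case: asboolP => [fx|nfx]; last by rewrite chart_vec_not.
have [W [oW Wx fs]] := fx.
pose O := U `&` W.
have oO : open O by exact: openI.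
have Ox : O x by [].
have Oc : O `<=` chart_dom c by move=> y [/Uc].
have fO : smooth_fun O f by apply: smooth_fun_sub fs => y [].
have key (Z Y' : vfield M) (z w' : M -> 'rV[C]_(n + n)) :
    smooth_row U w' ->
    (forall y, U y -> Z y = chart_vec c y (z y)) -> (forall y, U y -> Y' y = chart_vec c y (w' y)) ->
    Z x (fun y => Y' y f) = \sum_k (\sum_a z x ord0 a * cpart c a (fun y => w' y ord0 k) x) * cpart c k f x
      + \sum_a \sum_k z x ord0 a * w' x ord0 k * cpart c a (cpart c k f) x.
  move=> w's ZE Y'E.
  pose h y := \sum_k w' y ord0 k * cpart c k f y.
  have wk k : smooth_fun O (fun y => w' y ord0 k) by apply: smooth_fun_sub (w's k) => y [].
  have fk k : smooth_fun O (cpart c k f) by exact: cpart_smooth.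
  have hE y : O y -> Y' y f = h y.
    by move=> Oy; rewrite Y'E ?chart_vecE //; [exists O|case: Oy].
  have hs : smooth_fun O h by apply: smooth_fun_sum => // k _; exact: smooth_funM.
  have gs : smooth_fun O (fun y => Y' y f) by apply: smooth_fun_ext hs => // y /hE ->.
  have near_h : \forall y \near x, Y' y f = h y.
    by apply: filterS hE _; apply: open_nbhs_nbhs.
  rewrite ZE // chart_vecE; last by exists O.
  have E a : cpart c a (fun y => Y' y f) x =
      \sum_k (cpart c a (fun y => w' y ord0 k) x * cpart c k f x + w' x ord0 k * cpart c a (cpart c k f) x).
    rewrite (cpart_near a ac cx near_h) cpart_sum //; last first.
      by move=> k _; exists O; split=> //; exact: smooth_funM.
    by apply: eq_bigr => k _; apply: cpartM => //; exists O.
  under eq_bigr do rewrite E mulr_sumr.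
  under eq_bigr do under eq_bigr do rewrite mulrDr !mulrA.
  under eq_bigr do rewrite big_split /=.
  rewrite big_split /=; congr (_ + _).
  by rewrite exchange_big /=; apply: eq_bigr => k _; rewrite mulr_suml.
rewrite (key X Y u w) // (key Y X w u) // chart_vecE //.
have -> : \sum_a \sum_k w x ord0 a * u x ord0 k * cpart c a (cpart c k f) x =
          \sum_a \sum_k u x ord0 a * w x ord0 k * cpart c a (cpart c k f) x.
  rewrite exchange_big /=; apply: eq_bigr => a _; apply: eq_bigr => k _.
  by rewrite (cpart_sym _ _ ac oO Ox Oc fO) [w x ord0 k * _]mulrC.
rewrite opprD addrACA subrr addr0 -sumrB; apply: eq_bigr => k _.
by rewrite mxE -mulrBl -sumrB.
Qed.

Lemma bracket_csection U X Y : open U -> csection U X -> csection U Y -> csection U (bracket X Y).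
Proof.
move=> oU hX hY c ac.
have oU' : open (U `&` chart_dom c) by apply: openI => //; exact: chart_open.
have [u [us uE]] := hX c ac; have [w [ws wE]] := hY c ac.
exists (fun x => \row_k \sum_a
    (u x ord0 a * cpart c a (fun y => w y ord0 k) x - w x ord0 a * cpart c a (fun y => u y ord0 k) x)); split.
  move=> k; apply: (smooth_fun_eq (fun x => mxE _ _ _ _)).
  apply: smooth_fun_sum => // a _; apply: smooth_funD => //; last apply: smooth_funN => //.
    by apply: smooth_funM => //; apply: cpart_smooth.
  by apply: smooth_funM => //; apply: cpart_smooth.
move=> x Ux cx; apply: (bracket_chart ac oU') => //.
- by move=> y [Uy cy]; exact: uE.
- by move=> y [Uy cy]; exact: wE.
Qed.

End TangentVectors.

(** * The torsion-twisted connection in a chart *)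

Section Connections.
Context {R : realType} {n : nat} {M : complexManifold R n}.
Local Notation C := R[i].
Local Notation N := (n + n)%N.
Implicit Types (c : chart R n M) (U W : set M) (f : M -> C) (x y : M) (X Y : vfield M).
Implicit Types (u w : M -> 'rV[C]_N) (D : vfield M -> vfield M -> vfield M).

Definition cgrad c w x : 'M[C]_N := \matrix_(a, k) cpart c a (fun y => w y ord0 k) x.

(** With [K a b] the components of [D_{d_a} d_b], this is the part of [D_u w] without derivatives of
    [w]. *)
Definition chr (K : 'I_N -> 'I_N -> 'rV[C]_N) (u w : 'rV[C]_N) : 'rV[C]_N :=
  \sum_a \sum_b (u ord0 a * w ord0 b) *: K a b.

Lemma chrDl K (u u' w : 'rV[C]_N) : chr K (u + u') w = chr K u w + chr K u' w.
Proof.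
rewrite /chr -big_split /=; apply: eq_bigr => a _; rewrite -big_split /=; apply: eq_bigr => b _.
by rewrite -scalerDl mxE mulrDl.
Qed.

Lemma chrZl K t (u w : 'rV[C]_N) : chr K (t *: u) w = t *: chr K u w.
Proof.
rewrite /chr scaler_sumr; apply: eq_bigr => a _; rewrite scaler_sumr; apply: eq_bigr => b _.
by rewrite mxE scalerA mulrA.
Qed.

Lemma chr_swap K (u w : 'rV[C]_N) : chr (fun a b => K b a) u w = chr K w u.
Proof.
rewrite /chr exchange_big; apply: eq_bigr => a _; apply: eq_bigr => b _.
by rewrite mulrC.
Qed.

Lemma chrDr K (u w w' : 'rV[C]_N) : chr K u (w + w') = chr K u w + chr K u w'.
Proof. by rewrite -!(chr_swap K) chrDl. Qed.

Lemma chrZr K t (u w : 'rV[C]_N) : chr K u (t *: w) = t *: chr K u w.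
Proof. by rewrite -!(chr_swap K) chrZl. Qed.

Lemma chr_sumr K (I : Type) (r : seq I) (P : pred I) (u : 'rV[C]_N) (F : I -> 'rV[C]_N) :
  chr K u (\sum_(i <- r | P i) F i) = \sum_(i <- r | P i) chr K u (F i).
Proof.
apply: (big_morph (chr K u)); first exact: chrDr.
by rewrite -[0 in LHS](scale0r 0) chrZr scale0r.
Qed.

Lemma chr_suml K (I : Type) (r : seq I) (P : pred I) (w : 'rV[C]_N) (F : I -> 'rV[C]_N) :
  chr K (\sum_(i <- r | P i) F i) w = \sum_(i <- r | P i) chr K (F i) w.
Proof. by rewrite -chr_swap chr_sumr; under eq_bigr do rewrite chr_swap. Qed.

(** [K] are the Christoffel symbols of [D] in [c]. The formula is asked for real fields, the ones
    covered by the axioms of a connection. *)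
Definition christoffel c D (K : M -> 'I_N -> 'I_N -> 'rV[C]_N) := forall U X Y (u w : M -> 'rV[R]_N) x,
  open U -> U `<=` chart_dom c -> U x ->
  (forall k, smooth_fun U (fun y => (u y ord0 k)%:C)) ->
  (forall k, smooth_fun U (fun y => (w y ord0 k)%:C)) ->
  (forall y, U y -> X y = chart_vec c y (rcx (u y))) ->
  (forall y, U y -> Y y = chart_vec c y (rcx (w y))) ->
  D X Y x = chart_vec c x (rcx (u x) *m cgrad c (fun y => rcx (w y)) x + chr (K x) (rcx (u x)) (rcx (w x))).

(** The local formula is complex bilinear over the constants, as is [complexify] by construction, so
    the four real instances recombine to the same formula. *)
Lemma complexify_chart c D K : atlas c -> christoffel c D K ->
  forall U X Y u w x, open U -> U `<=` chart_dom c -> U x ->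
  smooth_row U u ->
  smooth_row U w ->
  (forall y, U y -> X y = chart_vec c y (u y)) ->
  (forall y, U y -> Y y = chart_vec c y (w y)) ->
  complexify D X Y x = chart_vec c x (u x *m cgrad c w x + chr (K x) (u x) (w x)).
Proof.
move=> ac HD U X Y u w x oU Uc Ux us ws XE YE; have cx := Uc _ Ux.
have smRe (z : M -> 'rV[C]_N) k : smooth_fun U (fun y => z y ord0 k) ->
    smooth_fun U (fun y => (reM (z y) ord0 k)%:C).
  by move=> /smooth_fun_Re; apply: smooth_fun_eq => y; rewrite mxE.
have smIm (z : M -> 'rV[C]_N) k : smooth_fun U (fun y => z y ord0 k) ->
    smooth_fun U (fun y => (imM (z y) ord0 k)%:C).
  by move=> /smooth_fun_Im; apply: smooth_fun_eq => y; rewrite mxE.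
have reE (Z : vfield M) (z : M -> 'rV[C]_N) : (forall y, U y -> Z y = chart_vec c y (z y)) ->
    forall y, U y -> re_field Z y = chart_vec c y (rcx (reM (z y))).
  by move=> ZE y Uy; rewrite /re_field ZE // re_vec_chart //; exact: Uc.
have imE (Z : vfield M) (z : M -> 'rV[C]_N) : (forall y, U y -> Z y = chart_vec c y (z y)) ->
    forall y, U y -> im_field Z y = chart_vec c y (rcx (imM (z y))).
  by move=> ZE y Uy; rewrite /im_field ZE // im_vec_chart //; exact: Uc.
rewrite /complexify.
rewrite (HD U (re_field X) (re_field Y) (fun y => reM (u y)) (fun y => reM (w y)))
  ?(HD U (im_field X) (im_field Y) (fun y => imM (u y)) (fun y => imM (w y)))
  ?(HD U (re_field X) (im_field Y) (fun y => reM (u y)) (fun y => imM (w y)))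
  ?(HD U (im_field X) (re_field Y) (fun y => imM (u y)) (fun y => reM (w y))); auto.
have -> : cgrad c w x = cgrad c (fun y => rcx (reM (w y))) x + 'i%C *: cgrad c (fun y => rcx (imM (w y))) x.
  apply/matrixP => a k; rewrite !mxE.
  have nr : smooth_near x (fun y => rcx (reM (w y)) ord0 k).
    exists U; split=> //; apply: smooth_fun_eq (smRe w k (ws k)) => y; by rewrite mxE.
  have ni : smooth_near x (fun y => rcx (imM (w y)) ord0 k).
    exists U; split=> //; apply: smooth_fun_eq (smIm w k (ws k)) => y; by rewrite mxE.
  have nii : smooth_near x (fun y => 'i%C * rcx (imM (w y)) ord0 k).
    case: ni => W [oW Wx Ws]; exists W; split=> //; apply: smooth_funM => //.
    exact: smooth_fun_cst.
  rewrite (_ : (fun y => w y ord0 k) = (fun y => rcx (reM (w y)) ord0 k + 'i%C * rcx (imM (w y)) ord0 k)); last first.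
    by apply/funext => y; rewrite {1}[w y]rcx_parts !mxE.
  rewrite cpartD // cpartM //; last exact: smooth_near_cst.
  by rewrite cpart_cst mul0r add0r.
set ur := rcx (reM (u x)); set ui := rcx (imM (u x)).
set wr := rcx (reM (w x)); set wi := rcx (imM (w x)).
set gr := cgrad c (fun y => rcx (reM (w y))) x; set gi := cgrad c (fun y => rcx (imM (w y))) x.
rewrite (rcx_parts (u x) : u x = ur + 'i%C *: ui) (rcx_parts (w x) : w x = wr + 'i%C *: wi).
rewrite -!chart_vecD -chart_vecZ -scaleN1r -chart_vecZ -!chart_vecD; congr chart_vec.
rewrite !(mulmxDl, mulmxDr, chrDl, chrDr, chrZl, chrZr) -?scalemxAl -?scalemxAr.
rewrite !scalerDr !scalerA.
have -> : 'i%C * 'i%C = -1 :> C by rewrite -expr2 sqr_i.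
move: (ur *m gr) (ur *m gi) (ui *m gr) (ui *m gi) => a1 a2 a3 a4.
move: (chr _ ur wr) (chr _ ur wi) (chr _ ui wr) (chr _ ui wi) => b1 b2 b3 b4.
apply/rowP => k; rewrite !mxE; ring.
Qed.

Lemma bracket_grad c U X Y u w x : atlas c -> open U ->
  U `<=` chart_dom c -> U x ->
  smooth_row U u -> smooth_row U w ->
  (forall y, U y -> X y = chart_vec c y (u y)) -> (forall y, U y -> Y y = chart_vec c y (w y)) ->
  bracket X Y x = chart_vec c x (u x *m cgrad c w x - w x *m cgrad c u x).
Proof.
move=> ac oU Uc Ux us ws XE YE; rewrite (bracket_chart ac oU Uc Ux us ws XE YE).
congr chart_vec; apply/rowP => k; rewrite !mxE -sumrB; apply: eq_bigr => a _.
by rewrite !mxE.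
Qed.

(** In [nabla_Y X + [X, Y]] the bracket replaces the derivatives of [X] by those of [Y], while the
    symbols keep the order of [nabla_Y X]. *)
Lemma torsion_twisted_christoffel c D K : atlas c -> christoffel c D K ->
  christoffel c (torsion_twisted D) (fun x a b => K x b a).
Proof.
move=> ac HD U X Y u w x oU Uc Ux us ws XE YE.
rewrite /torsion_twisted /torsion opprB addrC opprB addrA subrK.
rewrite (HD U Y X w u) //.
rewrite (@bracket_grad c U X Y (fun y => rcx (u y)) (fun y => rcx (w y))) //; last 2 first.
- by move=> k; apply: smooth_fun_eq (us k) => y; rewrite mxE.
- by move=> k; apply: smooth_fun_eq (ws k) => y; rewrite mxE.
by rewrite -chart_vecD (chr_swap (K x)) addrA subrK.
Qed.

(** * Locality of a connection and its Christoffel symbols *)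

Section RealConnection.
Variable (D : vfield M -> vfield M -> vfield M).
Hypothesis connD : connection D.

(** The axioms of a connection ask for smoothness on [U] only. There the indicator is constant,
    hence smooth, and it erases everything outside [U]; it plays the part of a bump function. *)
Definition indic U : M -> R := fun x => if `[< U x >] then 1 else 0.

Lemma indic1 U x : U x -> indic U x = 1.
Proof. by rewrite /indic; case: asboolP. Qed.

Lemma indic0 U x : ~ U x -> indic U x = 0.
Proof. by rewrite /indic; case: asboolP. Qed.

Lemma indic_smooth U : open U -> smooth_fun U (fun x => (indic U x)%:C).
Proof.
move=> oU; apply: (smooth_fun_ext oU _ (smooth_fun_cst U 1)) => x Ux.
by rewrite indic1.
Qed.

Lemma indic_eq U X Y : (forall x, U x -> X x = Y x) ->
  (fun x => (indic U x)%:C *: X x) = (fun x => (indic U x)%:C *: Y x).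
Proof.
move=> XY; apply/funext => x; have [Ux|nUx] := pselect (U x); first by rewrite XY.
by rewrite indic0 // !scale0r.
Qed.

(** The Leibniz rule for [indic U] times [Y] and times [Y']: these products are equal fields, and
    the terms differentiating [indic U] agree since [Y x = Y' x]. *)
Lemma conn_local_r U X Y Y' x : open U -> U x -> rsection U X -> rsection U Y -> rsection U Y' ->
  (forall y, U y -> Y y = Y' y) -> D X Y x = D X Y' x.
Proof.
move=> oU Ux sX sY sY' YY'.
have := conn_leibniz connD oU Ux (indic_smooth oU) sX sY.
rewrite (indic_eq YY') (conn_leibniz connD oU Ux (indic_smooth oU) sX sY') YY' //.
by rewrite indic1 // !scale1r => /addrI.
Qed.

Lemma conn_local_l U X X' Y x : open U -> U x -> rsection U X -> rsection U X' -> rsection U Y ->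
  (forall y, U y -> X y = X' y) -> D X Y x = D X' Y x.
Proof.
move=> oU Ux sX sX' sY XX'.
have := conn_scale connD oU Ux (indic_smooth oU) sX sY.
rewrite (indic_eq XX') (conn_scale connD oU Ux (indic_smooth oU) sX' sY).
by rewrite indic1 // !scale1r.
Qed.

Definition cfield c (a : 'I_N) : vfield M := fun x => chart_vec c x (rcx (delta_mx ord0 a)).

Lemma rsection_combo c U (r : seq 'I_N) (u : M -> 'rV[R]_N) : atlas c -> open U -> U `<=` chart_dom c ->
  (forall k, smooth_fun U (fun x => (u x ord0 k)%:C)) ->
  rsection U (fun x => \sum_(a <- r) (u x ord0 a)%:C *: cfield c a x).
Proof.
move=> ac oU Uc us.
apply: (@rsection_intro _ _ _ c U _ (fun x => \sum_(a <- r) u x ord0 a *: delta_mx ord0 a)) => //.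
  move=> k; apply: (@smooth_fun_eq _ _ _ _ (fun x => \sum_(a <- r) (u x ord0 a)%:C * (k == a)%:R)).
    move=> x; rewrite summxE rmorph_sum; apply: eq_bigr => a _.
    by rewrite !mxE eqxx /= rmorphM rmorph_nat.
  by apply: smooth_fun_sum => // a _; apply: smooth_funM => //; exact: smooth_fun_cst.
move=> x Ux; rewrite /rcx map_mx_sum chart_vec_sum; apply: eq_bigr => a _.
by rewrite map_mxZ chart_vecZ.
Qed.

Lemma rsection_term c U a (u : M -> R) : atlas c -> open U -> U `<=` chart_dom c ->
  smooth_fun U (fun x => (u x)%:C) -> rsection U (fun x => (u x)%:C *: cfield c a x).
Proof.
move=> ac oU Uc us.
apply: (@rsection_intro _ _ _ c U _ (fun x => u x *: delta_mx ord0 a)) => //.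
  move=> k; apply: (@smooth_fun_eq _ _ _ _ (fun x => (u x)%:C * (k == a)%:R)).
    by move=> x; rewrite !mxE eqxx /= rmorphM rmorph_nat.
  by apply: smooth_funM => //; exact: smooth_fun_cst.
by move=> x Ux; rewrite /rcx map_mxZ chart_vecZ.
Qed.

Lemma cfield_rsection c U a : atlas c -> open U -> U `<=` chart_dom c -> rsection U (cfield c a).
Proof.
move=> ac oU Uc; apply: (@rsection_intro _ _ _ c U _ (fun=> delta_mx ord0 a)) => //.
by move=> k; exact: smooth_fun_cst.
Qed.

Lemma conn_sum_r c U (r : seq 'I_N) (u : M -> 'rV[R]_N) X x : atlas c -> open U -> U `<=` chart_dom c ->
  U x -> (forall k, smooth_fun U (fun x => (u x ord0 k)%:C)) -> rsection U X ->
  D X (fun x => \sum_(a <- r) (u x ord0 a)%:C *: cfield c a x) x =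
  \sum_(a <- r) D X (fun x => (u x ord0 a)%:C *: cfield c a x) x.
Proof.
move=> ac oU Uc Ux us sX; elim: r => [|a r IH].
  rewrite big_nil.
  have s0 := rsection_combo [::] ac oU Uc us.
  (* For the empty sum, [D X 0 = 0] is the Leibniz rule with factor 0. *)
  have := conn_leibniz (f := fun=> 0) connD oU Ux (smooth_fun_cst _ _) sX s0.
  rewrite scale0r addr0 big_nil scaler0 => E; rewrite -[RHS]E; congr (D X _ x).
  by apply/funext => y; rewrite scale0r big_nil.
rewrite big_cons -IH -(conn_addr connD oU Ux sX).
- by congr (D X _ x); apply/funext => y; rewrite big_cons.
- exact: rsection_term.
- exact: rsection_combo.
Qed.

Lemma conn_sum_l c U (r : seq 'I_N) (u : M -> 'rV[R]_N) Y x : atlas c -> open U -> U `<=` chart_dom c ->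
  U x -> (forall k, smooth_fun U (fun x => (u x ord0 k)%:C)) -> rsection U Y ->
  D (fun x => \sum_(a <- r) (u x ord0 a)%:C *: cfield c a x) Y x =
  \sum_(a <- r) (u x ord0 a)%:C *: D (cfield c a) Y x.
Proof.
move=> ac oU Uc Ux us sY; elim: r => [|a r IH].
  rewrite big_nil.
  have s0 := rsection_combo [::] ac oU Uc us.
  have := conn_scale (f := fun=> 0) connD oU Ux (smooth_fun_cst _ _) s0 sY.
  rewrite scale0r => E; rewrite -[RHS]E; congr (D _ Y x).
  by apply/funext => y; rewrite scale0r big_nil.
rewrite big_cons -IH -(conn_scale connD oU Ux (us a) _ sY); last exact: cfield_rsection.
rewrite -(conn_addl connD oU Ux _ _ sY).
- by congr (D _ Y x); apply/funext => y; rewrite big_cons.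
- exact: rsection_term.
- exact: rsection_combo.
Qed.

(** By locality [X] and [Y] may be replaced by their expansions in the coordinate fields, where the
    axioms apply term by term. *)
Lemma christoffel_ex c : atlas c -> exists K : M -> 'I_N -> 'I_N -> 'rV[R]_N,
  (forall a b k, smooth_fun (chart_dom c) (fun x => (K x a b ord0 k)%:C)) /\
  christoffel c D (fun x a b => rcx (K x a b)).
Proof.
move=> ac; have oc := chart_open ac.
have H (ab : 'I_N * 'I_N) : exists u : M -> 'rV[R]_N,
    (forall k, smooth_fun (chart_dom c) (fun x => (u x ord0 k)%:C)) /\
    (forall x, chart_dom c x -> D (cfield c ab.1) (cfield c ab.2) x = chart_vec c x (rcx (u x))).
  apply: (rsection_chart ac) => //; apply: (conn_section connD oc); exact: cfield_rsection.
have [K HK] := choice H.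
exists (fun x a b => K (a, b) x); split=> [a b k|]; first exact: (HK (a, b)).1.
move=> U X Y u w x oU Uc Ux us ws XE YE; have cx := Uc _ Ux.
have sX : rsection U X by exact: (rsection_intro ac oU Uc us).
have sY : rsection U Y by exact: (rsection_intro ac oU Uc ws).
have combo (z : M -> 'rV[R]_N) y : chart_vec c y (rcx (z y)) =
    \sum_a (z y ord0 a)%:C *: cfield c a y.
  rewrite {1}[z y]row_sum_delta /rcx map_mx_sum chart_vec_sum; apply: eq_bigr => a _.
  by rewrite map_mxZ chart_vecZ.
have XE' y : U y -> X y = \sum_a (u y ord0 a)%:C *: cfield c a y by move=> Uy; rewrite XE.
have YE' y : U y -> Y y = \sum_a (w y ord0 a)%:C *: cfield c a y by move=> Uy; rewrite YE.
have sX' := rsection_combo (index_enum _) ac oU Uc us.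
have sY' := rsection_combo (index_enum _) ac oU Uc ws.
rewrite (conn_local_l oU Ux sX sX' sY XE') (conn_sum_l _ ac oU Uc Ux us sY).
have step a : D (cfield c a) Y x = chart_vec c x
    (\sum_b (cpart c a (fun y => (w y ord0 b)%:C) x *: rcx (delta_mx ord0 b) +
      (w x ord0 b)%:C *: rcx (K (a, b) x))).
  have sa : rsection U (cfield c a) by exact: cfield_rsection.
  rewrite (conn_local_r oU Ux sa sY sY' YE') (conn_sum_r _ ac oU Uc Ux ws sa).
  rewrite chart_vec_sum; apply: eq_bigr => b _.
  rewrite (conn_leibniz connD oU Ux (ws b) sa (cfield_rsection _ ac oU Uc)) chart_vecD !chart_vecZ.
  rewrite ((HK (a, b)).2 x cx); congr (_ *: _ + _).
  rewrite /cfield chart_vecE; last by exists U.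
  rewrite (bigD1 a) //= big1 => [|k ka]; rewrite !mxE ?eqxx ?mul1r ?addr0 //.
  by rewrite (negPf ka) mul0r.
under eq_bigr do rewrite step -chart_vecZ.
rewrite -chart_vec_sum; congr chart_vec.
under eq_bigr do rewrite big_split /= scalerDr !scaler_sumr.
rewrite big_split /=; congr (_ + _).
  apply/rowP => k; rewrite summxE !mxE; apply: eq_bigr => a _.
  rewrite summxE (bigD1 k) //= big1 => [|j jk]; rewrite !mxE ?eqxx ?mulr1 ?addr0.
    rewrite (_ : (fun y => rcx (w y) ord0 k) = fun y => (w y ord0 k)%:C) //.
    by apply/funext => y; rewrite mxE.
  by rewrite eq_sym (negPf jk) !mulr0.
apply: eq_bigr => a _; apply: eq_bigr => b _.
by rewrite scalerA !mxE.
Qed.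

End RealConnection.

End Connections.

(** * Derivatives along complex vectors in a chart *)

Section ChernChart.
Context {R : realType} {n : nat} {M : complexManifold R n}.
Local Notation C := R[i].
Local Notation N := (n + n)%N.
Implicit Types (c : chart R n M) (U W : set M) (f : M -> C) (x y : M).
Implicit Types (u w : 'rV[C]_N) (p q : 'rV[C]_n).

Local Notation e_ := (delta_mx ord0).

Let ii : 'i%C * 'i%C = -1 :> C.
Proof. by rewrite -expr2 sqr_i. Qed.

Lemma iota_decomp u : u =
  iota10 (2^-1 *: (lsubmx u + 'i%C *: rsubmx u)) + iota01 (2^-1 *: (lsubmx u - 'i%C *: rsubmx u)).
Proof.
rewrite -[LHS]hsubmxK /iota10 /iota01 add_row_mx.
have h2 : (2 : C) != 0 by rewrite pnatr_eq0.
move: (lsubmx u) (rsubmx u) => s t.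
congr row_mx; apply/rowP => k; rewrite !mxE.
  by field.
have E (z : C) : 'i%C * ('i%C * z) = - z by rewrite mulrA ii mulN1r.
rewrite !(mulrDr, mulrN, mulNr) ![2^-1 * ('i%C * _)]mulrCA !E.
by field.
Qed.

Lemma chr_conj (K : 'I_N -> 'I_N -> 'rV[R]_N) u w :
  chr (fun a b => rcx (K a b)) (map_mx conjc u) (map_mx conjc w) =
  map_mx conjc (chr (fun a b => rcx (K a b)) u w).
Proof.
apply/rowP => k; rewrite [RHS]mxE !summxE rmorph_sum; apply: eq_bigr => a _.
rewrite !summxE rmorph_sum; apply: eq_bigr => b _.
by rewrite !mxE !rmorphM; congr (_ * _); rewrite /= oppr0.
Qed.

Definition cdir c u f x : C := \sum_j u ord0 j * cpart c j f x.

Lemma cdirDl c u w f x : cdir c (u + w) f x = cdir c u f x + cdir c w f x.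
Proof. by rewrite /cdir -big_split; apply: eq_bigr => j _; rewrite mxE mulrDl. Qed.

Lemma cdirZl c t u f x : cdir c (t *: u) f x = t * cdir c u f x.
Proof. by rewrite /cdir mulr_sumr; apply: eq_bigr => j _; rewrite mxE mulrA. Qed.

Lemma cdir_suml c (I : Type) (r : seq I) (P : pred I) (F : I -> 'rV[C]_N) f x :
  cdir c (\sum_(i <- r | P i) F i) f x = \sum_(i <- r | P i) cdir c (F i) f x.
Proof.
apply: (big_morph (fun u => cdir c u f x)) => [u w|]; first exact: cdirDl.
by rewrite -[0 in LHS](scale0r 0) cdirZl mul0r.
Qed.

Lemma cdir_near c u x f h : atlas c -> chart_dom c x -> (\forall y \near x, f y = h y) ->
  cdir c u f x = cdir c u h x.
Proof. by move=> ac cx fh; apply: eq_bigr => j _; rewrite (cpart_near _ ac cx fh). Qed.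

Lemma cdirD c u x f h : atlas c -> chart_dom c x -> smooth_near x f -> smooth_near x h ->
  cdir c u (fun y => f y + h y) x = cdir c u f x + cdir c u h x.
Proof.
move=> ac cx fs hs; rewrite /cdir -big_split; apply: eq_bigr => j _.
by rewrite cpartD // mulrDr.
Qed.

Lemma cdirM c u x f h : atlas c -> chart_dom c x -> smooth_near x f -> smooth_near x h ->
  cdir c u (fun y => f y * h y) x = cdir c u f x * h x + f x * cdir c u h x.
Proof.
move=> ac cx fs hs; rewrite /cdir mulr_suml mulr_sumr -big_split; apply: eq_bigr => j _ /=.
by rewrite cpartM // mulrDr mulrA mulrCA.
Qed.

Lemma cdir_cst c u x (t : C) : cdir c u (fun=> t) x = 0.
Proof. by rewrite /cdir big1 // => j _; rewrite cpart_cst mulr0. Qed.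

Lemma cdir_sum c u x (I : Type) (r : seq I) (P : pred I) (F : I -> M -> C) : atlas c ->
  chart_dom c x -> (forall i, P i -> smooth_near x (F i)) ->
  cdir c u (fun y => \sum_(i <- r | P i) F i y) x = \sum_(i <- r | P i) cdir c u (F i) x.
Proof.
move=> ac cx Fs; rewrite /cdir exchange_big; apply: eq_bigr => j _.
by rewrite cpart_sum // mulr_sumr.
Qed.

Lemma cdir_smooth c u U f : atlas c -> open U -> U `<=` chart_dom c ->
  smooth_fun U f -> smooth_fun U (cdir c u f).
Proof.
move=> ac oU Uc fs; apply: smooth_fun_sum => // j _.
by apply: smooth_funM => //; [exact: smooth_fun_cst|exact: cpart_smooth].
Qed.

Lemma cdir_sym c u w U x f : atlas c -> open U -> U x -> U `<=` chart_dom c -> smooth_fun U f ->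
  cdir c u (cdir c w f) x = cdir c w (cdir c u f) x.
Proof.
move=> ac oU Ux Uc fs; have cx := Uc _ Ux.
have E v v' : cdir c v (cdir c v' f) x =
    \sum_j \sum_k v ord0 j * v' ord0 k * cpart c j (cpart c k f) x.
  apply: eq_bigr => j _; rewrite cpart_sum // => [|k _]; last first.
    by exists U; split=> //; apply: smooth_funM => //; [exact: smooth_fun_cst|exact: cpart_smooth].
  rewrite mulr_sumr; apply: eq_bigr => k _; rewrite cpartM //.
  - by rewrite cpart_cst mul0r add0r mulrA.
  - exact: smooth_near_cst.
  - by exists U; split=> //; exact: cpart_smooth.
rewrite !E exchange_big; apply: eq_bigr => j _; apply: eq_bigr => k _ /=.
by rewrite (cpart_sym _ _ ac oU Ux Uc fs) [w _ _ * _]mulrC.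
Qed.

(** Components of [d/dz^m], and then of [d/dzbar^m]. *)
Definition dzv (m : 'I_n) : 'rV[C]_N := 2^-1 *: iota10 (e_ m).
Definition dzbv (m : 'I_n) : 'rV[C]_N := 2^-1 *: iota01 (e_ m).
Local Notation cdz c m := (cdir c (dzv m)).
Local Notation cdzb c m := (cdir c (dzbv m)).

(* [u_m + i u_{n+m}] is [dz^m(u)], so [nabla_mx Gam] is the connection form
   [sum_m dz^m Gam_m]; it acts on row vectors from the right. *)
Definition nabla_mx (Gam : 'I_n -> 'M[C]_n) u : 'M[C]_n :=
  \sum_m (u ord0 (lshift n m) + 'i%C * u ord0 (rshift n m)) *: Gam m.

Definition nabla c (Gam : M -> 'I_n -> 'M[C]_n) (p : M -> 'rV[C]_n) x u : 'rV[C]_n :=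
  \row_k cdir c u (fun y => p y ord0 k) x + p x *m nabla_mx (Gam x) u.

Lemma iota01_sum p : iota01 p = \sum_l p ord0 l *: iota01 (e_ l).
Proof.
rewrite [p in LHS]row_sum_delta (big_morph (@iota01 R n) (id1 := 0) (op1 := +%R)).
- by apply: eq_bigr => l _; rewrite /iota01 scale_row_mx !scalerA mulrC.
- by move=> s t; rewrite /iota01 scalerDr add_row_mx.
- by rewrite /iota01 scaler0 row_mx0.
Qed.

Lemma iota01_l p (k : 'I_n) : iota01 p ord0 (lshift n k) = p ord0 k.
Proof. by rewrite /iota01 row_mxEl. Qed.

Lemma iota01_r p (k : 'I_n) : iota01 p ord0 (rshift n k) = 'i%C * p ord0 k.
Proof. by rewrite /iota01 row_mxEr mxE. Qed.

Lemma iota10_0 : iota10 0 = 0 :> 'rV[C]_N.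
Proof. by rewrite /iota10 scaler0 row_mx0. Qed.

Local Opaque iota10 iota01.

(** * Connection matrices of the Chern and the twisted connection *)

Section ConnectionMatrix.
Variables (g : M -> tvec M -> tvec M -> R) (D : vfield M -> vfield M -> vfield M).
Hypothesis chernD : chern_connection g D.
Hypothesis metricg : hermitian_metric g.
Variable (c : chart R n M).
Hypothesis ac : atlas c.
Variable (K : M -> 'I_N -> 'I_N -> 'rV[R]_N).
Hypothesis Ksmooth : forall i j k, smooth_fun (chart_dom c) (fun x => (K x i j ord0 k)%:C).
Hypothesis HK : christoffel c D (fun x i j => rcx (K x i j)).

Local Notation KC x := (fun i j => rcx (K x i j)).

Let oc : open (chart_dom c). Proof. exact: chart_open. Qed.

Lemma cgrad_cst w x : cgrad c (fun=> w) x = 0.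
Proof. by apply/matrixP => i j; rewrite !mxE cpart_cst. Qed.

Lemma conn_const (u w : 'rV[R]_N) x : chart_dom c x ->
  D (fun y => chart_vec c y (rcx u)) (fun y => chart_vec c y (rcx w)) x =
  chart_vec c x (chr (KC x) (rcx u) (rcx w)).
Proof.
move=> cx; rewrite (HK (U := chart_dom c) (u := fun=> u) (w := fun=> w) oc) //; last 2 first.
- by move=> k; exact: smooth_fun_cst.
- by move=> k; exact: smooth_fun_cst.
by rewrite cgrad_cst mulmx0 add0r.
Qed.

Lemma const_rsection (u : 'rV[R]_N) : rsection (chart_dom c) (fun y => chart_vec c y (rcx u)).
Proof.
apply: (@rsection_intro _ _ _ c _ _ (fun=> u)) => // k; exact: smooth_fun_cst.
Qed.

(** [nabla J = 0] evaluated on fields with constant components, a class that [stdJ] preserves. *)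
Lemma chr_stdJ x u w : chart_dom c x -> chr (KC x) u (stdJ w) = stdJ (chr (KC x) u w).
Proof.
move=> cx.
have real i (v : 'rV[R]_N) : chr (KC x) (rcx (e_ i)) (stdJ (rcx v)) = stdJ (chr (KC x) (rcx (e_ i)) (rcx v)).
  have := chern_J chernD oc cx (const_rsection (e_ i)) (const_rsection v) (const_rsection (stdJ v)).
  rewrite !conn_const // is_J_chart // stdJ_rcx => H.
  apply: (chart_vec_inj ac cx); apply: H => y cy.
  by apply/is_J_chart => //; rewrite stdJ_rcx.
have rE i : e_ i = rcx (e_ i) :> 'rV[C]_N.
  by apply/rowP => k; rewrite !mxE rmorph_nat.
rewrite [u]row_sum_delta !chr_suml.
have -> : stdJ (\sum_i chr (KC x) (u 0 i *: e_ i) w) = \sum_i stdJ (chr (KC x) (u 0 i *: e_ i) w).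
  apply: (big_morph stdJ); first exact: stdJD.
  by rewrite -[0 in LHS](scale0r 0) stdJZ scale0r.
apply: eq_bigr => i _; rewrite !chrZl stdJZ; congr (_ *: _).
by rewrite rE [w]rcx_parts stdJD stdJZ !chrDr !chrZr !real stdJD stdJZ.
Qed.

Lemma complexify_const u w x : chart_dom c x ->
  complexify D (fun y => chart_vec c y u) (fun y => chart_vec c y w) x =
  chart_vec c x (chr (KC x) u w).
Proof.
move=> cx; rewrite (complexify_chart ac HK (U := chart_dom c) (u := fun=> u) (w := fun=> w)) //; last 2 first.
- by move=> k; exact: smooth_fun_cst.
- by move=> k; exact: smooth_fun_cst.
by rewrite cgrad_cst mulmx0 add0r.
Qed.

(** The condition [nabla^{0,1} = dbar] on a field with constant coefficients, where its right-hand
    side is 0. *)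
Lemma chr_01_10 x p q : chart_dom c x -> chr (KC x) (iota01 p) (iota10 q) = 0.
Proof.
move=> cx.
have s01 : section01 (chart_dom c) (fun y => chart_vec c y (iota01 p)).
  split=> [|y cy].
    apply: (@csection_intro _ _ _ c _ _ (fun=> iota01 p)) => // k; exact: smooth_fun_cst.
  by apply/is_J_chart => //; rewrite stdJ_iota01 chart_vecZ.
have := chern_dbar (Z := fun k => fun=> q ord0 k) chernD ac oc (@subset_refl _ _) cx s01
  (fun k => smooth_fun_cst _ _).
rewrite [RHS]big1 => [|k _]; last first.
  rewrite chart_vecE; last exact: smooth_near_cst.
  by rewrite big1 ?scale0r // => j _; rewrite cpart_cst mulr0.
have -> : (fun y => \sum_k q ord0 k *: dz c k y) = (fun y => chart_vec c y (2^-1 *: iota10 q)).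
  apply/funext => y; rewrite [q in RHS]row_sum_delta iota10_sum scaler_sumr chart_vec_sum.
  by apply: eq_bigr => k _; rewrite /dz iota10Z !chart_vecZ !scalerA mulrC.
rewrite complexify_const // chrZr chart_vecZ => H.
have := congr1 (fun v : tvec M => (2 : C) *: v) H.
rewrite scalerA divff ?pnatr_eq0 // scale1r scaler0 -(chart_vec0 c x).
exact: chart_vec_inj.
Qed.

(** Complex conjugate of [chr_01_10], the symbols [K] being real. *)
Lemma chr_10_01 x p q : chart_dom c x -> chr (KC x) (iota10 p) (iota01 q) = 0.
Proof.
move=> cx.
have E : map_mx conjc (map_mx conjc q) = q by apply/rowP => k; rewrite !mxE conjcK.
have E' r : map_mx conjc (iota01 (map_mx conjc r)) = iota10 r :> 'rV[C]_N.
  by rewrite iota01_conj; apply/rowP => k; rewrite !mxE conjcK.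
have -> : iota01 q = map_mx conjc (iota10 (map_mx conjc q)) by rewrite -iota01_conj E.
rewrite -(E' p) (chr_conj (K x)) (chr_01_10 _ _ cx).
by apply/rowP => k; rewrite !mxE conjc0.
Qed.

(** The entry [gam x m b k] is the coefficient of [d/dz^k] in [nabla_{d/dz^b} d/dz^m]; by the
    exchange of indices, [gam x m] is then the matrix of [nabla^T] in the direction [d/dz^m]. The
    factor [2^-1] compensates [iota10 (e_ b) = 2 d/dz^b]. *)
Definition gam x (m : 'I_n) : 'M[C]_n :=
  \matrix_(b, k) (2^-1 * chr (KC x) (iota10 (e_ b)) (iota10 (e_ m)) ord0 (lshift n k)).

Lemma chr_10_10 x p q : chart_dom c x ->
  chr (KC x) (iota10 p) (iota10 q) = iota10 (2 *: (p *m \sum_m q ord0 m *: gam x m)).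
Proof.
move=> cx.
rewrite [LHS](_ : _ = iota10 (lsubmx (chr (KC x) (iota10 p) (iota10 q)))); last first.
  by apply: iota10P; rewrite -chr_stdJ // stdJ_iota10 chrZr.
congr iota10; rewrite [p in LHS]row_sum_delta [q in LHS]row_sum_delta !iota10_sum chr_suml.
apply/rowP => k; rewrite !mxE summxE mulr_sumr; apply: eq_bigr => b _.
rewrite iota10Z chrZl mxE chr_sumr summxE !summxE !mulr_sumr; apply: eq_bigr => m _.
rewrite iota10Z chrZr mxE [in RHS]mxE [gam _ _ _ _]mxE.
by rewrite (mulrCA 2) (mulrCA 2) mulVKf ?pnatr_eq0.
Qed.

(** The (0,1) part of [u] drops out by [chr_10_01]. After the exchange of indices [u] is the
    direction of differentiation, so the connection form of [nabla^T] has type (1,0). *)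
Lemma chr_10 x p u : chart_dom c x ->
  chr (KC x) (iota10 p) u = iota10 (p *m nabla_mx (gam x) u).
Proof.
move=> cx; rewrite {1}[u]iota_decomp chrDr [X in _ + X](chr_10_01 p _ cx) addr0 (chr_10_10 p _ cx).
congr iota10; rewrite scalemxAr scaler_sumr; congr (_ *m _); apply: eq_bigr => m _.
by rewrite scalerA 5!mxE mulVKf // pnatr_eq0.
Qed.

Lemma gam_smooth m b k : smooth_fun (chart_dom c) (fun x => gam x m b k).
Proof.
apply: (@smooth_fun_eq _ _ _ _ (fun x => 2^-1 * \sum_i \sum_j
   (iota10 (e_ b) ord0 i * iota10 (e_ m) ord0 j) * (K x i j ord0 (lshift n k))%:C)).
  move=> x; rewrite mxE; congr (_ * _); rewrite summxE; apply: eq_bigr => i _.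
  rewrite summxE; apply: eq_bigr => j _.
  by rewrite mxE; congr (_ * _); rewrite mxE.
apply: smooth_funM => //; first exact: smooth_fun_cst.
apply: smooth_fun_sum => // i _; apply: smooth_fun_sum => // j _; apply: smooth_funM => //.
exact: smooth_fun_cst.
Qed.

Lemma torsion_twisted_nabla U X Z (u : M -> 'rV[C]_N) (p : M -> 'rV[C]_n) x :
  open U -> U `<=` chart_dom c -> U x ->
  smooth_row U u -> smooth_row U p ->
  (forall y, U y -> X y = chart_vec c y (u y)) -> (forall y, U y -> Z y = vec10 c y (p y)) ->
  complexify (torsion_twisted D) X Z x = vec10 c x (nabla c gam p x (u x)).
Proof.
move=> oU Uc Ux us ps XE ZE; have cx := Uc _ Ux.
rewrite (complexify_chart ac (torsion_twisted_christoffel ac HK) oU Uc Ux us (fun k => iota10_smooth k oU ps) XE ZE).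
rewrite (chr_swap (KC x)) chr_10 // /vec10 /nabla iota10D; congr (chart_vec _ _ (_ + _)).
apply/rowP => k; rewrite mxE.
case: (split_ordP k) => j ->.
  rewrite iota10_l mxE; apply: eq_bigr => i _; rewrite [cgrad _ _ _ _ _]mxE.
  rewrite (_ : (fun y => _) = fun y => p y ord0 j) //.
  by apply/funext => y; rewrite iota10_l.
rewrite iota10_r mxE mulr_sumr; apply: eq_bigr => i _; rewrite [cgrad _ _ _ _ _]mxE mulrCA; congr (_ * _).
rewrite (_ : (fun y => _) = fun y => - 'i%C * p y ord0 j); last first.
  by apply/funext => y; rewrite iota10_r.
rewrite cpartM //; last 2 first.
- exact: smooth_near_cst.
- by exists U.
by rewrite cpart_cst mul0r add0r.
Qed.

Definition gmat x (i j : 'I_N) : R := g x (cfield c i x) (cfield c j x).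

(** Complex bilinear, not sesquilinear, extension of [g]: metric compatibility extends to it without
    conjugations, and the Hermitian form arises by pairing (1,0) with (0,1) vectors. *)
Definition gC x u w : C := \sum_i \sum_j u ord0 i * w ord0 j * (gmat x i j)%:C.

Lemma gmat_smooth i j : smooth_fun (chart_dom c) (fun x => (gmat x i j)%:C).
Proof. by apply: (metric_smooth metricg oc); exact: const_rsection. Qed.

Lemma gmat_sym x i j : chart_dom c x -> gmat x i j = gmat x j i.
Proof. by move=> cx; apply: (Defs.metric_sym metricg); exact: tangent_rcx. Qed.

Lemma metric_expand_l x (u : 'rV[R]_N) v : chart_dom c x -> tangent x v ->
  g x (chart_vec c x (rcx u)) v = \sum_i u ord0 i * g x (cfield c i x) v.
Proof.
move=> cx tv.
have g0 : g x (chart_vec c x (rcx 0)) v = 0.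
  have := metric_linear metricg 1 (tangent_rcx 0 ac cx) (tangent_rcx 0 ac cx) tv.
  rewrite mul1r scale1r -chart_vecD -map_mxD addr0.
  by move/eqP; rewrite -subr_eq subrr => /eqP <-.
rewrite [u in LHS]row_sum_delta.
elim: (index_enum _) => [|i r IH]; first by rewrite !big_nil.
rewrite !big_cons -IH {1}/rcx map_mxD map_mxZ chart_vecD chart_vecZ.
by rewrite (metric_linear metricg) //; exact: tangent_rcx.
Qed.

Lemma metric_expand x (u w : 'rV[R]_N) : chart_dom c x ->
  (g x (chart_vec c x (rcx u)) (chart_vec c x (rcx w)))%:C = gC x (rcx u) (rcx w).
Proof.
move=> cx; have tw := tangent_rcx w ac cx.
rewrite metric_expand_l // rmorph_sum; apply: eq_bigr => i _.
have ti : tangent x (cfield c i x) by exact: tangent_rcx.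
rewrite (Defs.metric_sym metricg ti tw) metric_expand_l // mulr_sumr rmorph_sum.
apply: eq_bigr => j _; rewrite !mxE -!rmorphM mulrA; congr (_%:C); congr (_ * _).
by rewrite -/(gmat x j i) gmat_sym.
Qed.

Lemma gCDl x u u' w : gC x (u + u') w = gC x u w + gC x u' w.
Proof.
rewrite /gC -big_split; apply: eq_bigr => i _; rewrite -big_split; apply: eq_bigr => j _ /=.
by rewrite mxE !mulrDl.
Qed.

Lemma gCZl x t u w : gC x (t *: u) w = t * gC x u w.
Proof.
rewrite /gC mulr_sumr; apply: eq_bigr => i _; rewrite mulr_sumr; apply: eq_bigr => j _ /=.
by rewrite mxE !mulrA.
Qed.

Lemma gC_sym x u w : chart_dom c x -> gC x u w = gC x w u.
Proof.
move=> cx; rewrite /gC exchange_big; apply: eq_bigr => i _; apply: eq_bigr => j _.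
by rewrite [w ord0 i * _]mulrC gmat_sym.
Qed.

Lemma gCDr x u w w' : chart_dom c x -> gC x u (w + w') = gC x u w + gC x u w'.
Proof. by move=> cx; rewrite !(gC_sym u) // gCDl. Qed.

Lemma gCZr x t u w : chart_dom c x -> gC x u (t *: w) = t * gC x u w.
Proof. by move=> cx; rewrite !(gC_sym u) // gCZl. Qed.

Lemma gC_smooth u w : smooth_fun (chart_dom c) (fun x => gC x u w).
Proof.
apply: smooth_fun_sum => // i _; apply: smooth_fun_sum => // j _.
by apply: smooth_funM => //; [exact: smooth_fun_cst|exact: gmat_smooth].
Qed.

Lemma gC_compat_real i (u w : 'rV[R]_N) x : chart_dom c x ->
  cpart c i (fun y => gC y (rcx u) (rcx w)) x =
  gC x (chr (KC x) (e_ i) (rcx u)) (rcx w) + gC x (rcx u) (chr (KC x) (e_ i) (rcx w)).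
Proof.
move=> cx.
have rE : e_ i = rcx (e_ i) :> 'rV[C]_N by apply/rowP => k; rewrite !mxE rmorph_nat.
have real (v : 'rV[R]_N) : exists r : 'rV[R]_N, chr (KC x) (rcx (e_ i)) (rcx v) = rcx r.
  exists (\sum_i0 \sum_j ((e_ i : 'rV[R]_N) ord0 i0 * v ord0 j) *: K x i0 j).
  rewrite /rcx map_mx_sum; apply: eq_bigr => i0 _; rewrite map_mx_sum; apply: eq_bigr => j _.
  by rewrite map_mxZ !mxE rmorphM.
have := chern_metric chernD oc cx (const_rsection (e_ i)) (const_rsection u) (const_rsection w).
rewrite !conn_const // rE.
have [ru ->] := real u; have [rw ->] := real w.
rewrite rmorphD /= !metric_expand // => <-.
have fs : smooth_fun (chart_dom c)
    (fun y => (g y (chart_vec c y (rcx u)) (chart_vec c y (rcx w)))%:C).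
  by apply: (metric_smooth metricg oc); exact: const_rsection.
rewrite chart_vecE; last by exists (chart_dom c).
rewrite (bigD1 i) //= big1 => [|k ki]; last by rewrite !mxE (negPf ki) /= mul0r.
rewrite !mxE !eqxx mul1r addr0; apply: cpart_near => //.
apply: filterS (open_nbhs_nbhs (conj oc cx)) => y cy.
by rewrite metric_expand.
Qed.

Lemma gC_compat i u w x : chart_dom c x ->
  cpart c i (fun y => gC y u w) x = gC x (chr (KC x) (e_ i) u) w + gC x u (chr (KC x) (e_ i) w).
Proof.
move=> cx.
have sn u' w' : smooth_near x (fun y => gC y u' w').
  by exists (chart_dom c); split=> //; exact: gC_smooth.
have sc (t : C) u' w' : smooth_near x (fun y => t * gC y u' w').
  exists (chart_dom c); split=> //; apply: smooth_funM => //; [exact: smooth_fun_cst|exact: gC_smooth].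
have snc (t : C) : smooth_near x (fun=> t) by exact: smooth_near_cst.
have right (u' : 'rV[R]_N) w' : cpart c i (fun y => gC y (rcx u') w') x =
    gC x (chr (KC x) (e_ i) (rcx u')) w' + gC x (rcx u') (chr (KC x) (e_ i) w').
  rewrite [w']rcx_parts; set wr := rcx (reM w'); set wi := rcx (imM w').
  rewrite (@cpart_near _ _ _ c i x _ (fun y => gC y (rcx u') wr + 'i%C * gC y (rcx u') wi)) //; last first.
    apply: filterS (open_nbhs_nbhs (conj oc cx)) => y cy.
    by rewrite gCDr // gCZr.
  rewrite cpartD // cpartM // cpart_cst mul0r add0r !gC_compat_real //.
  rewrite chrDr chrZr !gCDr // !gCZr //; ring.
rewrite [u]rcx_parts; set ur := rcx (reM u); set ui := rcx (imM u).
rewrite (_ : (fun y => gC y _ w) = fun y => gC y ur w + 'i%C * gC y ui w); last first.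
  by apply/funext => y; rewrite gCDl gCZl.
rewrite cpartD // cpartM // cpart_cst mul0r add0r !right //.
rewrite chrDr chrZr !gCDl !gCZl; ring.
Qed.

(** Four times the matrix of the [g(d/dz^m, d/dzbar^l)], a harmless constant. *)
Definition hmat x : 'M[C]_n := \matrix_(m, l) gC x (iota10 (e_ m)) (iota01 (e_ l)).

(** The indices exchanged back: row [m] of [gamd x a] gives [nabla_{d/dz^a} d/dz^m], so this is the
    matrix of the Chern connection itself. *)
Definition gamd x (a : 'I_n) : 'M[C]_n := \matrix_(m, k) gam x m a k.

(** Metric compatibility: of the two terms in the derivative of [g(d/dz^m, d/dzbar^l)] along
    [d/dz^a], the one that differentiates [d/dzbar^l] vanishes by [chr_10_01]. *)
Lemma hmat_dz a m l x : chart_dom c x ->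
  cdz c a (fun y => hmat y m l) x = (gamd x a *m hmat x) m l.
Proof.
move=> cx.
have E : cdz c a (fun y => hmat y m l) x =
    2^-1 * \sum_j iota10 (e_ a) ord0 j * cpart c j (fun y => gC y (iota10 (e_ m)) (iota01 (e_ l))) x.
  rewrite (_ : (fun y => hmat y m l) = fun y => gC y (iota10 (e_ m)) (iota01 (e_ l))) ?cdirZl //.
  by apply/funext => y; rewrite mxE.
rewrite E; under eq_bigr do rewrite gC_compat // mulrDr.
rewrite big_split /=.
have sumK w w' : \sum_j iota10 (e_ a) ord0 j * gC x (chr (KC x) (e_ j) w) w' =
    gC x (chr (KC x) (iota10 (e_ a)) w) w'.
  rewrite [X in chr _ X w]row_sum_delta chr_suml.
  transitivity (\sum_j gC x (chr (KC x) (iota10 (e_ a) ord0 j *: e_ j) w) w').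
    by apply: eq_bigr => j _; rewrite chrZl gCZl.
  apply/esym; apply: (big_morph (fun z => gC x z w')); first by move=> *; exact: gCDl.
  by rewrite -[0 in LHS](scale0r 0) gCZl mul0r.
under [X in _ + X]eq_bigr do rewrite gC_sym //.
have z0 w : gC x 0 w = 0 by rewrite -[0 in LHS](scale0r 0) gCZl mul0r.
rewrite [X in _ * (X + _)](etrans (sumK _ _) (congr1 (fun z => gC x z _) (chr_10_10 _ _ cx))).
rewrite [X in _ * (_ + X)](etrans (sumK _ _) (congr1 (fun z => gC x z _) (chr_10_01 _ _ cx))).
rewrite z0 addr0 iota10Z gCZl mulKf ?pnatr_eq0 //.
rewrite (bigD1 m) //= big1 => [|k km]; last by rewrite [e_ m _ _]mxE (negPf km) scale0r.
rewrite [e_ m _ _]mxE !eqxx scale1r addr0 -rowE [row a _]row_sum_delta iota10_sum [RHS]mxE.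
rewrite [LHS](big_morph (fun z => gC x z (iota01 (e_ l))) (id1 := 0) (op1 := +%R)); last 2 first.
- by move=> *; exact: gCDl.
- by rewrite -[0 in LHS](scale0r 0) gCZl mul0r.
by apply: eq_bigr => k _; rewrite iota10Z gCZl; congr (_ * _); rewrite !mxE.
Qed.

(** If [p h = 0], then [gC] pairs [iota10 p] with its conjugate to 0; this number is
    [g(r, r) + g(s, s)] for the real and imaginary parts [r] and [s], and [g] is positive. *)
Lemma hmat_inj x p : chart_dom c x -> p *m hmat x = 0 -> p = 0.
Proof.
move=> cx ph.
have E : gC x (iota10 p) (map_mx conjc (iota10 p)) = 0.
  rewrite -iota01_conj gC_sym //.
  rewrite iota01_sum; under eq_bigr do rewrite mxE.
  rewrite (big_morph (fun z => gC x z (iota10 p)) (id1 := 0) (op1 := +%R)); last 2 first.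
  - by move=> *; exact: gCDl.
  - by rewrite -[0 in LHS](scale0r 0) gCZl mul0r.
  rewrite big1 // => l _; rewrite gCZl gC_sym // [p in iota10 p]row_sum_delta iota10_sum.
  rewrite (big_morph (fun z => gC x z (iota01 (e_ l))) (id1 := 0) (op1 := +%R)); last 2 first.
  - by move=> *; exact: gCDl.
  - by rewrite -[0 in LHS](scale0r 0) gCZl mul0r.
  have /rowP/(_ l) := ph; rewrite !mxE => H.
  rewrite [X in _ * X](_ : _ = 0) ?mulr0 // -[RHS]H; apply: eq_bigr => m _.
  by rewrite iota10Z gCZl mxE.
set r := reM (iota10 p); set s := imM (iota10 p).
have E' : map_mx conjc (iota10 p) = rcx r + (- 'i%C) *: rcx s.
  apply/rowP => k; rewrite [LHS]mxE [(rcx r + _) _ _]mxE !mxE conjcE.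
  by apply: complex_ext; rewrite /= ?mul0r ?mulr0 ?oppr0; ring.
rewrite E' [iota10 p]rcx_parts gCDl !gCDr // gCZl !gCZr // gCZl in E.
rewrite (gC_sym (rcx s) (rcx r)) // in E.
have {E} : gC x (rcx r) (rcx r) + gC x (rcx s) (rcx s) = 0.
  rewrite -[RHS]E -/r -/s -[X in _ + X = _]mul1r -[1]opprK -ii; ring.
rewrite -!metric_expand // -rmorphD => -[] E.
have pos (v : 'rV[R]_N) : 0 <= g x (chart_vec c x (rcx v)) (chart_vec c x (rcx v)) /\
    (g x (chart_vec c x (rcx v)) (chart_vec c x (rcx v)) = 0 -> v = 0).
  have [->|v0] := eqVneq v 0.
    by rewrite metric_expand_l ?big1 //; [move=> i _; rewrite mxE mul0r|exact: tangent_rcx].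
  have nz : chart_vec c x (rcx v) != 0.
    apply/eqP; rewrite -(chart_vec0 c x) => /(chart_vec_inj ac cx) /eqP.
    by rewrite -[0](map_mx0 (real_complex R)) => /eqP/rcx_inj/eqP; apply/negP.
  have gp := metric_pos metricg (tangent_rcx v ac cx) nz.
  by split; [exact: ltW|move=> gE; rewrite gE ltxx in gp].
have [r0 rz] := pos r; have [s0 sz] := pos s.
have gr : g x (chart_vec c x (rcx r)) (chart_vec c x (rcx r)) = 0 by lra.
have gs : g x (chart_vec c x (rcx s)) (chart_vec c x (rcx s)) = 0 by lra.
apply: iota10_inj; rewrite [LHS]rcx_parts -/r -/s (rz gr) (sz gs).
by rewrite /rcx !map_mx0 scaler0 addr0 iota10_0.
Qed.

Lemma hmat_smooth m l : smooth_fun (chart_dom c) (fun x => hmat x m l).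
Proof. by apply: smooth_fun_eq (gC_smooth (iota10 (e_ m)) (iota01 (e_ l))) => x; rewrite mxE. Qed.

Lemma gamd_smooth a m k : smooth_fun (chart_dom c) (fun x => gamd x a m k).
Proof. by apply: smooth_fun_eq (gam_smooth m a k) => x; rewrite mxE. Qed.

(* The (2,0) part of the Chern curvature vanishes: by [hmat_dz] the connection matrices are
   (d_a h) h^-1, and mixed second derivatives of h commute. *)
Lemma chern_curvature20 x a b : chart_dom c x ->
  \matrix_(m, k) cdz c b (fun y => gamd y a m k) x + gamd x a *m gamd x b =
  \matrix_(m, k) cdz c a (fun y => gamd y b m k) x + gamd x b *m gamd x a.
Proof.
move=> cx.
have second a' b' : \matrix_(m, l) cdz c b' (cdz c a' (fun y => hmat y m l)) x =
    (\matrix_(m, k) cdz c b' (fun y => gamd y a' m k) x + gamd x a' *m gamd x b') *m hmat x.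
  apply/matrixP => m l; rewrite mxE.
  have nE : \forall y \near x, cdz c a' (fun y => hmat y m l) y = \sum_k gamd y a' m k * hmat y k l.
    apply: filterS (open_nbhs_nbhs (conj oc cx)) => y cy.
    by rewrite hmat_dz // mxE.
  rewrite (cdir_near _ ac cx nE) cdir_sum // => [|k _]; last first.
    by exists (chart_dom c); split=> //; apply: smooth_funM => //; [exact: gamd_smooth|exact: hmat_smooth].
  rewrite mulmxDl [RHS]mxE -mulmxA [X in _ + X]mxE [X in X + _]mxE -big_split; apply: eq_bigr => k _ /=.
  rewrite cdirM //.
  - by rewrite hmat_dz // [X in _ = X * _ + _]mxE.
  - by exists (chart_dom c); split=> //; exact: gamd_smooth.
  - by exists (chart_dom c); split=> //; exact: hmat_smooth.
have S : \matrix_(m, l) cdz c b (cdz c a (fun y => hmat y m l)) x =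
         \matrix_(m, l) cdz c a (cdz c b (fun y => hmat y m l)) x.
  apply/matrixP => m l; rewrite [LHS]mxE [RHS]mxE.
  by apply: (cdir_sym _ _ ac oc cx) => //; exact: hmat_smooth.
have {}S := etrans (esym (second a b)) (etrans S (second b a)).
apply/eqP; rewrite -subr_eq0; apply/eqP/row_matrixP => i; rewrite row0.
by apply: (hmat_inj cx); rewrite -row_mul mulmxBl S subrr row0.
Qed.

End ConnectionMatrix.

(** * Parallel (1,0) fields and their brackets in components *)

Lemma nabla_mxD (Gam : 'I_n -> 'M[C]_n) u w : nabla_mx Gam (u + w) = nabla_mx Gam u + nabla_mx Gam w.
Proof.
rewrite /nabla_mx -big_split; apply: eq_bigr => m _ /=; rewrite -scalerDl !mxE; congr (_ *: _); ring.
Qed.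

Lemma nabla_mxZ (Gam : 'I_n -> 'M[C]_n) t u : nabla_mx Gam (t *: u) = t *: nabla_mx Gam u.
Proof.
rewrite /nabla_mx scaler_sumr; apply: eq_bigr => m _ /=; rewrite scalerA !mxE; congr (_ *: _); ring.
Qed.

Lemma nabla_mx_iota10 (Gam : 'I_n -> 'M[C]_n) p : nabla_mx Gam (iota10 p) = 2 *: \sum_m p ord0 m *: Gam m.
Proof.
rewrite /nabla_mx scaler_sumr; apply: eq_bigr => m _; rewrite iota10_l iota10_r scalerA.
by congr (_ *: _); rewrite mulNr mulrN mulrA ii mulN1r opprK mulr_natl mulr2n.
Qed.

Lemma nabla_mx_dzv (Gam : 'I_n -> 'M[C]_n) m : nabla_mx Gam (dzv m) = Gam m.
Proof.
rewrite nabla_mxZ nabla_mx_iota10 scalerA mulVf ?pnatr_eq0 // scale1r (bigD1 m) //= mxE !eqxx scale1r.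
by rewrite big1 ?addr0 // => k km; rewrite mxE (negPf km) scale0r.
Qed.

Lemma nabla_mx_iota01 (Gam : 'I_n -> 'M[C]_n) p : nabla_mx Gam (iota01 p) = 0.
Proof.
rewrite /nabla_mx big1 // => m _.
by rewrite iota01_l iota01_r mulrA ii mulN1r subrr scale0r.
Qed.

Lemma nablaD c (Gam : M -> 'I_n -> 'M[C]_n) (p : M -> 'rV[C]_n) x u w :
  nabla c Gam p x (u + w) = nabla c Gam p x u + nabla c Gam p x w.
Proof.
rewrite /nabla nabla_mxD mulmxDr addrACA; congr (_ + _).
by apply/rowP => k; rewrite !mxE cdirDl.
Qed.

Lemma nablaZ c (Gam : M -> 'I_n -> 'M[C]_n) (p : M -> 'rV[C]_n) x t u :
  nabla c Gam p x (t *: u) = t *: nabla c Gam p x u.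
Proof.
rewrite /nabla nabla_mxZ -scalemxAr scalerDr; congr (_ + _).
by apply/rowP => k; rewrite !mxE cdirZl.
Qed.

(** By linearity in [u] it suffices to test [d/dz^m] and [d/dzbar^m], and the connection form
    vanishes on the latter: the components of a parallel field are holomorphic. *)
Lemma nabla_eq0 c (Gam : M -> 'I_n -> 'M[C]_n) (p : M -> 'rV[C]_n) x :
  (forall u, nabla c Gam p x u = 0) <->
  (forall m k, cdz c m (fun y => p y ord0 k) x = - (p x *m Gam x m) ord0 k) /\
  (forall m k, cdzb c m (fun y => p y ord0 k) x = 0).
Proof.
split=> [H|[H1 H2] u].
  split=> m k.
    have /rowP/(_ k) := H (dzv m); rewrite /nabla nabla_mx_dzv !mxE => /eqP.
    by rewrite addr_eq0 => /eqP.
  have /rowP/(_ k) := H (dzbv m); rewrite /nabla /dzbv nabla_mxZ nabla_mx_iota01 scaler0 mulmx0 addr0.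
  by rewrite !mxE.
rewrite [u]iota_decomp; move: (_ *: _) => s; move: (_ *: _) => t.
have two z : z = 2 *: (2^-1 *: z) :> 'rV[C]_N by rewrite scalerA divff ?pnatr_eq0 // scale1r.
rewrite nablaD [s]row_sum_delta iota10_sum [t]row_sum_delta.
rewrite [iota01 _](_ : _ = \sum_l t ord0 l *: iota01 (e_ l)); last by rewrite -row_sum_delta iota01_sum.
have nsum (F : 'I_n -> 'rV[C]_N) : nabla c Gam p x (\sum_i F i) = \sum_i nabla c Gam p x (F i).
  apply: (big_morph (nabla c Gam p x)) => [? ?|]; first exact: nablaD.
  by rewrite -[0 in LHS](scale0r 0) nablaZ scale0r.
rewrite !nsum !big1 ?addr0 // => l _.
  rewrite nablaZ [iota01 _]two nablaZ -/(dzbv l) [nabla _ _ _ _ _](_ : _ = 0) ?scaler0 //.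
  rewrite /nabla {2}/dzbv nabla_mxZ nabla_mx_iota01 scaler0 mulmx0 addr0.
  by apply/rowP => k; rewrite [LHS]mxE [RHS]mxE; exact: H2.
rewrite iota10Z nablaZ [iota10 _]two nablaZ -/(dzv l) [nabla _ _ _ _ _](_ : _ = 0) ?scaler0 //.
rewrite /nabla nabla_mx_dzv; apply/rowP => k; rewrite !mxE H1.
by rewrite [X in - X]mxE addNr.
Qed.

Lemma cdir_iota10 c p f x : cdir c (iota10 p) f x = \sum_m 2 * (p ord0 m * cdz c m f x).
Proof.
rewrite [p in LHS]row_sum_delta iota10_sum cdir_suml; apply: eq_bigr => m _.
by rewrite iota10Z !cdirZl mulrCA mulVKf ?pnatr_eq0.
Qed.

Local Opaque dzv dzbv.

Definition bracket10 c (p q : M -> 'rV[C]_n) x : 'rV[C]_n :=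
  \row_k (cdir c (iota10 (p x)) (fun y => q y ord0 k) x - cdir c (iota10 (q x)) (fun y => p y ord0 k) x).

Lemma bracket10E c (Gam : M -> 'I_n -> 'M[C]_n) (p q : M -> 'rV[C]_n) x :
  bracket10 c p q x = nabla c Gam q x (iota10 (p x)) - nabla c Gam p x (iota10 (q x)) +
    (p x *m nabla_mx (Gam x) (iota10 (q x)) - q x *m nabla_mx (Gam x) (iota10 (p x))).
Proof.
rewrite /nabla; apply/rowP => k; rewrite !mxE; ring.
Qed.

(** The second half of the components of the bracket is [- i] times the first, so a bracket of (1,0)
    fields is again of type (1,0). *)
Lemma bracket10_chart c U X Y (p q : M -> 'rV[C]_n) x : atlas c -> open U ->
  U `<=` chart_dom c -> U x ->
  smooth_row U p -> smooth_row U q ->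
  (forall y, U y -> X y = vec10 c y (p y)) -> (forall y, U y -> Y y = vec10 c y (q y)) ->
  bracket X Y x = vec10 c x (bracket10 c p q x).
Proof.
move=> ac oU Uc Ux ps qs XE YE.
rewrite (bracket_chart ac oU Uc Ux (fun k => iota10_smooth k oU ps) (fun k => iota10_smooth k oU qs) XE YE).
congr chart_vec; apply/rowP => k; rewrite mxE.
have sn (s : M -> 'rV[C]_n) j : smooth_row U s ->
  smooth_near x (fun y => s y ord0 j) by exists U.
case: (split_ordP k) => j ->.
  rewrite iota10_l mxE sumrB; congr (_ - _); apply: eq_bigr => a _; congr (_ * _).
    by rewrite (_ : (fun y => iota10 _ _ _) = fun y => q y ord0 j) //; apply/funext => y; rewrite iota10_l.
  by rewrite (_ : (fun y => iota10 _ _ _) = fun y => p y ord0 j) //; apply/funext => y; rewrite iota10_l.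
rewrite iota10_r mxE sumrB mulrBr !mulr_sumr; congr (_ - _); apply: eq_bigr => a _; rewrite mulrCA; congr (_ * _).
  rewrite (_ : (fun y => iota10 _ _ _) = fun y => - 'i%C * q y ord0 j); last by apply/funext => y; rewrite iota10_r.
  by rewrite (cpartM a ac (Uc _ Ux) (smooth_near_cst _ _) (sn q j qs)) cpart_cst mul0r add0r.
rewrite (_ : (fun y => iota10 _ _ _) = fun y => - 'i%C * p y ord0 j); last by apply/funext => y; rewrite iota10_r.
by rewrite (cpartM a ac (Uc _ Ux) (smooth_near_cst _ _) (sn p j ps)) cpart_cst mul0r add0r.
Qed.

Lemma bracket10_smooth c U (p q : M -> 'rV[C]_n) : atlas c -> open U -> U `<=` chart_dom c ->
  smooth_row U p -> smooth_row U q ->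
  forall k, smooth_fun U (fun y => bracket10 c p q y ord0 k).
Proof.
move=> ac oU Uc ps qs k; apply: (smooth_fun_eq (fun x => mxE _ _ _ _)).
apply: smooth_funD => //; last apply: smooth_funN => //; apply: smooth_fun_sum => // j _;
  apply: smooth_funM => //; try exact: iota10_smooth; exact: cpart_smooth.
Qed.

Local Opaque cdir cpart.

(** Here [a] and [b] are row indices of the matrices [Gam y m], not directions: this is the (2,0)
    curvature of the Chern connection, written with the matrices of the twisted one. *)
Definition curvature_free c (Gam : M -> 'I_n -> 'M[C]_n) x := forall a b m k,
  cdz c b (fun y => Gam y m a k) x + \sum_j Gam x m a j * Gam x j b k =
  cdz c a (fun y => Gam y m b k) x + \sum_j Gam x m b j * Gam x j a k.

(** Both sides are values of one bilinear form, [sum_{b,j} S_b T_j (sum_m H b m G j m - dG b j)], at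
    [(P, Q)] and at [(Q, P)]; the hypothesis is its symmetry. *)
Let curvature_cancel (P Q : 'I_n -> C) (G : 'I_n -> 'I_n -> C) (H : 'I_n -> 'I_n -> C)
    (dG : 'I_n -> 'I_n -> C) :
  (forall b j, dG j b + \sum_m H b m * G j m = dG b j + \sum_m H j m * G b m) ->
  \sum_m (\sum_b P b * H b m) * (\sum_j Q j * G j m) - \sum_m P m * \sum_j Q j * dG m j =
  \sum_m (\sum_b Q b * H b m) * (\sum_j P j * G j m) - \sum_m Q m * \sum_j P j * dG m j.
Proof.
move=> E.
have F (S T : 'I_n -> C) :
    \sum_m (\sum_b S b * H b m) * (\sum_j T j * G j m) - \sum_m S m * \sum_j T j * dG m j =
    \sum_b \sum_j S b * T j * (\sum_m H b m * G j m - dG b j).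
  under eq_bigr do rewrite mulr_suml.
  rewrite exchange_big -sumrB; apply: eq_bigr => b _ /=.
  under eq_bigr do rewrite mulr_sumr.
  rewrite exchange_big mulr_sumr -sumrB; apply: eq_bigr => j _ /=.
  rewrite mulrBr mulr_sumr mulrA; congr (_ - _); apply: eq_bigr => m _; ring.
rewrite !F exchange_big /=; apply: eq_bigr => b _; apply: eq_bigr => j _.
rewrite [Q b * _]mulrC; congr (_ * _).
have := E b j; move: (\sum_m _) (\sum_m _) (dG _ _) (dG _ _) => s t u v H1.
by rewrite -[s](addKr u) -[in RHS](addKr v t) -H1; ring.
Qed.

(** The components of [p] and [q] are killed by the [d/dzbar^m], hence so are those of the bracket.
    Along [d/dz^a], substituting the equations of [p] and [q] gives the expected [- [p, q] Gam_a]
    and an antisymmetrised bilinear expression in [p] and [q], which [curvature_cancel] removes. *)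
Lemma bracket10_parallel c U (Gam : M -> 'I_n -> 'M[C]_n) (p q : M -> 'rV[C]_n) x :
  atlas c -> open U -> U `<=` chart_dom c -> U x ->
  smooth_row U p -> smooth_row U q ->
  (forall m b k, smooth_fun U (fun y => Gam y m b k)) -> curvature_free c Gam x ->
  (forall y u, U y -> nabla c Gam p y u = 0) -> (forall y u, U y -> nabla c Gam q y u = 0) ->
  forall u, nabla c Gam (bracket10 c p q) x u = 0.
Proof.
move=> ac oU Uc Ux ps qs Gs curv Hp Hq; have cx := Uc _ Ux.
have sn (f : M -> C) : smooth_fun U f -> smooth_near x f by exists U.
have zero2 (v v' w w' : C) : v = 0 -> w' = 0 -> 2 * (v * v' + w * w') = 0.
  by move=> -> ->; rewrite mul0r mulr0 addr0 mulr0.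
have nearU (P : M -> Prop) : (forall y, U y -> P y) -> \forall y \near x, P y.
  by move=> HP; apply: filterS HP _; apply: open_nbhs_nbhs.
have eqn (s : M -> 'rV[C]_n) : (forall y u, U y -> nabla c Gam s y u = 0) -> forall y, U y ->
    (forall m k, cdz c m (fun y => s y ord0 k) y = - \sum_j s y ord0 j * Gam y m j k) /\
    (forall m k, cdzb c m (fun y => s y ord0 k) y = 0).
  move=> Hs y Uy; have [H1 H2] := (nabla_eq0 _ _ _ _).1 (fun u => Hs y u Uy).
  by split=> m k; [rewrite H1 mxE|exact: H2].
have pE := eqn p Hp; have qE := eqn q Hq.
have zE k y : bracket10 c p q y ord0 k = \sum_m 2 * (p y ord0 m * cdz c m (fun y => q y ord0 k) y) -
    \sum_m 2 * (q y ord0 m * cdz c m (fun y => p y ord0 k) y).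
  by rewrite mxE !cdir_iota10.
have sd (s : M -> 'rV[C]_n) m k : smooth_row U s ->
    smooth_fun U (cdz c m (fun y => s y ord0 k)) by move=> ss; exact: cdir_smooth.
have st (s t : M -> 'rV[C]_n) m k : smooth_row U s ->
    smooth_row U t ->
    smooth_fun U (fun y => 2 * (s y ord0 m * cdz c m (fun y => t y ord0 k) y)).
  move=> ss ts; apply: smooth_funM => //; first exact: smooth_fun_cst.
  by apply: smooth_funM => //; exact: sd.
(* The derivative along [w] is commuted past [d/dz^m], next to a component of [t], where the
   equation of a parallel field applies. *)
have dz2 w (s t : M -> 'rV[C]_n) k : smooth_row U s ->
    smooth_row U t ->
    cdir c w (fun y => \sum_m 2 * (s y ord0 m * cdz c m (fun y => t y ord0 k) y)) x =
    \sum_m 2 * (cdir c w (fun y => s y ord0 m) x * cdz c m (fun y => t y ord0 k) x +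
               s x ord0 m * cdz c m (cdir c w (fun y => t y ord0 k)) x).
  move=> ss ts; rewrite cdir_sum // => [|m _]; last exact/sn/st.
  apply: eq_bigr => m _.
  rewrite (cdirM _ ac cx (sn _ (smooth_fun_cst U 2)) (sn _ (smooth_funM oU (ss m) (sd t m k ts)))).
  rewrite cdir_cst mul0r add0r (cdirM _ ac cx (sn _ (ss m)) (sn _ (sd t m k ts))).
  by rewrite (cdir_sym w (dzv m) ac oU Ux Uc (ts k)).
have dz3 w k : cdir c w (fun y => bracket10 c p q y ord0 k) x =
    \sum_m 2 * (cdir c w (fun y => p y ord0 m) x * cdz c m (fun y => q y ord0 k) x +
               p x ord0 m * cdz c m (cdir c w (fun y => q y ord0 k)) x) -
    \sum_m 2 * (cdir c w (fun y => q y ord0 m) x * cdz c m (fun y => p y ord0 k) x +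
               q x ord0 m * cdz c m (cdir c w (fun y => p y ord0 k)) x).
  have s1 : smooth_near x (fun y => \sum_m 2 * (p y ord0 m * cdz c m (fun y => q y ord0 k) y)).
    by apply: sn; apply: smooth_fun_sum => // m _; exact: st.
  have s2 : smooth_fun U (fun y => \sum_m 2 * (q y ord0 m * cdz c m (fun y => p y ord0 k) y)).
    by apply: smooth_fun_sum => // m _; exact: st.
  rewrite (cdir_near _ ac cx (nearU _ (fun y _ => zE k y))).
  rewrite (_ : (fun y => _ - _) = fun y => \sum_m 2 * (p y ord0 m * cdz c m (fun y => q y ord0 k) y) +
     -1 * \sum_m 2 * (q y ord0 m * cdz c m (fun y => p y ord0 k) y)); last first.
    by apply/funext => y; rewrite mulN1r.
  rewrite cdirD //; last by apply: sn; apply: smooth_funM => //; exact: smooth_fun_cst.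
  rewrite (cdirM _ ac cx (sn _ (smooth_fun_cst U (-1))) (sn _ s2)).
  by rewrite cdir_cst mul0r add0r mulN1r (dz2 _ p q) // (dz2 _ q p).
apply/nabla_eq0; split=> a k; last first.
  have z (s : M -> 'rV[C]_n) m : (forall y, U y -> forall m k, cdzb c m (fun y => s y ord0 k) y = 0) ->
      cdz c m (cdzb c a (fun y => s y ord0 k)) x = 0.
    by move=> Hs; rewrite (cdir_near _ ac cx (nearU _ (fun y Uy => Hs y Uy a k))) cdir_cst.
  have zs (s t : M -> 'rV[C]_n) :
      (forall y, U y -> forall m k, cdzb c m (fun y => s y ord0 k) y = 0) ->
      (forall y, U y -> forall m k, cdzb c m (fun y => t y ord0 k) y = 0) ->
      \sum_m 2 * (cdzb c a (fun y => s y ord0 m) x * cdz c m (fun y => t y ord0 k) x +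
                 s x ord0 m * cdz c m (cdzb c a (fun y => t y ord0 k)) x) = 0.
    move=> Hs Ht; apply: big1 => m _.
    apply: zero2; [exact: Hs x Ux a m|exact: z t m Ht].
  have pZ y Uy := (pE y Uy).2; have qZ y Uy := (qE y Uy).2.
  have zsub (v w : C) : v = 0 -> w = 0 -> v - w = 0 by move=> -> ->; rewrite subrr.
  rewrite dz3; apply: zsub; [exact: zs p q pZ qZ|exact: zs q p qZ pZ].
have z (s : M -> 'rV[C]_n) m : smooth_row U s ->
    (forall y, U y -> forall m k, cdz c m (fun y => s y ord0 k) y = - \sum_j s y ord0 j * Gam y m j k) ->
    cdz c m (cdz c a (fun y => s y ord0 k)) x =
    - (\sum_j cdz c m (fun y => s y ord0 j) x * Gam x a j k) -
    \sum_j s x ord0 j * cdz c m (fun y => Gam y a j k) x.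
  move=> ss Hs.
  rewrite (cdir_near (h := fun y => \sum_j (-1 * s y ord0 j) * Gam y a j k) _ ac cx); last first.
    apply: nearU => y Uy; rewrite (Hs y Uy) -sumrN; apply: eq_bigr => j _.
    by rewrite mulN1r mulNr.
  have sN j : smooth_fun U (fun y => -1 * s y ord0 j).
    by apply: smooth_funM => //; exact: smooth_fun_cst.
  rewrite cdir_sum // => [|j _]; last by apply: sn; apply: smooth_funM.
  rewrite -opprD -big_split -sumrN; apply: eq_bigr => j _ /=.
  rewrite cdirM //; last 2 first.
  - exact: sn.
  - exact: sn.
  rewrite cdirM //; last 2 first.
  - by apply: sn; exact: smooth_fun_cst.
  - exact: sn.
  by rewrite cdir_cst; ring.
(* Separates the contraction of the bracket with [Gam] from the expression that has to cancel. *)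
have dist (s t : M -> 'rV[C]_n) :
    \sum_m 2 * (cdz c a (fun y => s y ord0 m) x * cdz c m (fun y => t y ord0 k) x +
      s x ord0 m * (- (\sum_j cdz c m (fun y => t y ord0 j) x * Gam x a j k) -
        \sum_j t x ord0 j * cdz c m (fun y => Gam y a j k) x)) =
    2 * (\sum_m cdz c a (fun y => s y ord0 m) x * cdz c m (fun y => t y ord0 k) x -
      \sum_m s x ord0 m * \sum_j t x ord0 j * cdz c m (fun y => Gam y a j k) x) -
    \sum_j (\sum_m 2 * (s x ord0 m * cdz c m (fun y => t y ord0 j) x)) * Gam x a j k.
  have -> : \sum_j (\sum_m 2 * (s x ord0 m * cdz c m (fun y => t y ord0 j) x)) * Gam x a j k =
      \sum_m 2 * (s x ord0 m * \sum_j cdz c m (fun y => t y ord0 j) x * Gam x a j k).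
    under eq_bigr do rewrite mulr_suml.
    rewrite exchange_big; apply: eq_bigr => m _ /=; rewrite !mulr_sumr.
    by apply: eq_bigr => j _; ring.
  rewrite mulrBr !mulr_sumr -!sumrB; apply: eq_bigr => m _; ring.
have step (s t : M -> 'rV[C]_n) : smooth_row U t ->
    (forall y, U y -> forall m k, cdz c m (fun y => t y ord0 k) y = - \sum_j t y ord0 j * Gam y m j k) ->
    \sum_m 2 * (cdz c a (fun y => s y ord0 m) x * cdz c m (fun y => t y ord0 k) x +
               s x ord0 m * cdz c m (cdz c a (fun y => t y ord0 k)) x) =
    2 * (\sum_m cdz c a (fun y => s y ord0 m) x * cdz c m (fun y => t y ord0 k) x -
      \sum_m s x ord0 m * \sum_j t x ord0 j * cdz c m (fun y => Gam y a j k) x) -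
    \sum_j (\sum_m 2 * (s x ord0 m * cdz c m (fun y => t y ord0 j) x)) * Gam x a j k.
  move=> ts Ht; rewrite -dist; apply: eq_bigr => m _.
  by congr (2 * (_ + _ * _)); exact: z t m ts Ht.
have pS y Uy := (pE y Uy).1; have qS y Uy := (qE y Uy).1.
have sub (s t : M -> 'rV[C]_n) : (forall y, U y -> forall m k, cdz c m (fun y => s y ord0 k) y = - \sum_j s y ord0 j * Gam y m j k) ->
   (forall y, U y -> forall m k, cdz c m (fun y => t y ord0 k) y = - \sum_j t y ord0 j * Gam y m j k) ->
   \sum_m cdz c a (fun y => s y ord0 m) x * cdz c m (fun y => t y ord0 k) x =
   \sum_m (\sum_b s x ord0 b * Gam x a b m) * (\sum_j t x ord0 j * Gam x m j k).
  move=> Hs Ht; apply: eq_bigr => m _.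
  exact: etrans (congr2 *%R (Hs x Ux a m) (Ht x Ux m k)) (mulrNN _ _).
have key := @curvature_cancel (fun b => p x ord0 b) (fun b => q x ord0 b)
  (fun j m => Gam x m j k) (fun b m => Gam x a b m)
  (fun m j => cdz c m (fun y => Gam y a j k) x) (fun b j => curv b j a k).
have alg (A B A' B' E E' S S' : C) : A - B = A' - B' -> S = 2 * (A - B) - E -> S' = 2 * (A' - B') - E' ->
    S - S' = - (E - E') by move=> H -> ->; rewrite H; ring.
apply: etrans (dz3 _ _) _.
rewrite mxE; under [X in _ = - X]eq_bigr => j _ do rewrite zE mulrBl.
rewrite sumrB; apply: alg (step p q qs qS) (step q p ps pS).
by rewrite (sub p q pS qS) (sub q p qS pS).
Qed.

(** All that is used of [nabla^T] in the sequel; from here on [DT] is any operator that has such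
    coefficients in every chart. *)
Definition torsion_chart (DT : vfield M -> vfield M -> vfield M) c (Gam : M -> 'I_n -> 'M[C]_n) :=
  [/\ (forall m b k, smooth_fun (chart_dom c) (fun x => Gam x m b k)),
      (forall U X Z (u : M -> 'rV[C]_N) (p : M -> 'rV[C]_n) x,
        open U -> U `<=` chart_dom c -> U x ->
        smooth_row U u -> smooth_row U p ->
        (forall y, U y -> X y = chart_vec c y (u y)) -> (forall y, U y -> Z y = vec10 c y (p y)) ->
        DT X Z x = vec10 c x (nabla c Gam p x (u x))) &
      (forall x, chart_dom c x -> curvature_free c Gam x)].

Lemma chern_torsion_chart g D c : atlas c -> hermitian_metric g -> chern_connection g D ->
  exists Gam, torsion_chart (complexify (torsion_twisted D)) c Gam.
Proof.
move=> ac mg cD; have [K [Ks HK]] := christoffel_ex (chern_conn cD) ac.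
exists (gam K); split.
- exact: gam_smooth.
- by move=> *; apply: torsion_twisted_nabla; eauto.
move=> x cx a b m k.
have F a' b' : (\matrix_(m, k) cdz c b' (fun y => gamd K y a' m k) x + gamd K x a' *m gamd K x b') m k =
    cdz c b' (fun y => gam K y m a' k) x + \sum_j gam K x m a' j * gam K x j b' k.
  rewrite [LHS]mxE; congr (_ + _).
    rewrite mxE (_ : (fun y => gamd K y a' m k) = fun y => gam K y m a' k) //.
    by apply/funext => y; rewrite mxE.
  by rewrite mxE; apply: eq_bigr => j _; rewrite [gamd _ _ _ _ _]mxE [gamd _ _ _ _ _]mxE.
have /matrixP/(_ m k) := chern_curvature20 cD mg ac Ks HK a b cx.
by move=> H; have := etrans (esym (F a b)) (etrans H (F b a)).
Qed.

End ChernChart.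

Notation cdz c m := (cdir c (dzv m)).
Notation cdzb c m := (cdir c (dzbv m)).

(** * Parallel transport *)

Section FlatFunction.
Context {R : realType}.
Implicit Types (x y : R) (k m : nat).

(* [flatf k x = x^-k e^(-1/x)] for [x > 0]; this family is closed under differentiation up to
   linear combinations, which makes each member smooth. *)
Definition flatf k x : R := if 0 < x then x ^- k * expR (- x^-1) else 0.

Lemma flatf_le0 k x : x <= 0 -> flatf k x = 0.
Proof. by rewrite /flatf ltNge => ->. Qed.

Lemma flatf_gt0 k x : 0 < x -> flatf k x = x ^- k * expR (- x^-1).
Proof. by rewrite /flatf => ->. Qed.

(** For [y = x^-1], [expR y >= y^(k+2) / (k+2)!]. A bound of second order at 0 gives derivative 0
    there. *)
Lemma flatf_bound k x : `|flatf k x| <= (k.+2)`!%:R * `|x| ^+ 2.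
Proof.
have [x0|x0] := ltP 0 x; last by rewrite flatf_le0 // normr0 mulr_ge0 // exprn_ge0.
rewrite flatf_gt0 // ger0_norm; last by rewrite mulr_ge0 ?expR_ge0 // invr_ge0 exprn_ge0 // ltW.
rewrite ger0_norm ?(ltW x0) //.
have y0 : 0 <= x^-1 by rewrite invr_ge0 ltW.
have E := expR_ge1Dxn k.+1 y0.
have f0 : 0 < ((k.+2)`!%:R : R) by rewrite ltr0n fact_gt0.
have E' : (x^-1) ^+ k.+2 / (k.+2)`!%:R <= expR x^-1 by apply: le_trans E; rewrite lerDr.
rewrite expRN -[X in _ <= X]mulr1 -[X in _ <= _ * X](divff (lt0r_neq0 (expR_gt0 x^-1))).
rewrite mulrA ler_pM2r ?invr_gt0 ?expR_gt0 //.
apply: le_trans (ler_wpM2l _ E'); last by rewrite mulr_ge0 ?ler0n // exprn_ge0 // ltW.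
have x0' : x != 0 by rewrite lt0r_neq0.
have f0' : (k.+2)`!%:R != 0 :> R by rewrite lt0r_neq0.
move: f0'; set F : R := _%:R => f0'.
suff -> : F * x ^+ 2 * (x^-1 ^+ k.+2 / F) = x ^- k by [].
rewrite exprVn -[k.+2]addn2 exprD; field.
by rewrite f0' x0' expf_neq0.
Qed.

Lemma flatf_derive k x : is_derive x 1 (flatf k) (flatf k.+2 x - k%:R * flatf k.+1 x).
Proof.
have [x0|x0|x0] := ltgtP 0 x.
- have P : is_derive x 1 (fun x => x ^- k * expR (- x^-1)) (flatf k.+2 x - k%:R * flatf k.+1 x).
    have xn0 : x != 0 by rewrite gt_eqF.
    have dV : is_derive x 1 (fun y : R => y^-1) (- x ^- 2).
      by have := is_deriveV xn0 (is_derive_id x 1); rewrite scaler1.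
    have dX : is_derive x 1 (fun y : R => y ^- k) (- (k%:R * x ^- k.+1)).
      have dk := @is_deriveX R R id k x 1 1 (is_derive_id x 1).
      have xk : (id ^+ k : R -> R) x != 0 by rewrite fctE /= expf_neq0.
      have xk' : x ^+ k != 0 by rewrite expf_neq0.
      have Ek : (id ^+ k : R -> R) = fun y => y ^+ k by apply/funext => y; rewrite fctE.
      rewrite Ek in dk xk; have Q := @is_deriveV R (fun y => y ^+ k) x _ 1 xk dk; apply: is_derive_eq Q _.
      rewrite scaler1 /GRing.scale /= mulNr; congr (- _).
      case: k xk' {dk xk Ek} => [|k] xk'; first by rewrite !mul0r mulr0.
      have xk : x ^+ k != 0 by rewrite expf_neq0.
      rewrite /= !exprS; field.
      by rewrite xn0 xk.
    have dE : is_derive x 1 (fun y : R => expR (- y^-1)) (expR (- x^-1) * x ^- 2).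
      have := @is_derive1_comp R expR (fun y => - y^-1) x _ _ (is_derive_expR _) (is_deriveN dV).
      by rewrite opprK.
    apply: is_derive_eq (is_deriveM dX dE) _.
    rewrite !flatf_gt0 // /GRing.scale /=.
    by rewrite !exprS; field; rewrite expf_neq0 xn0.
  apply: near_eq_is_derive P.
  by near=> y; rewrite flatf_gt0 //; near: y; exact: lt_nbhsr.
- have P : is_derive x 1 (fun=> 0 : R) (0 : R) by exact: is_derive_cst.
  rewrite !flatf_le0 ?(ltW x0) // mulr0 subr0; apply: near_eq_is_derive P.
  by apply: filterS (lt_nbhsl x0) => y y0; rewrite flatf_le0 // ltW.
- rewrite -x0 !flatf_le0 // mulr0 subr0.
  pose L := 'd (cst (0 : R) : R -> R) (0 : R).
  have LE h : L h = 0 by rewrite /L diff_cst.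
  have [||d E] := @differentiable_intro R R (flatf k) L 0.
  + by apply: diff_continuous; exact: differentiable_cst.
  + move=> e e0.
    have e1 : 0 < e / (k.+2)`!%:R by rewrite divr_gt0 // ltr0n fact_gt0.
    apply/nbhs_ballP; exists (e / (k.+2)`!%:R) => //=.
    move=> h; rewrite -ball_normE /ball_ /= sub0r normrN => he.
    rewrite addr0 (flatf_le0 k (lexx 0)) LE !subr0.
    apply: le_trans (flatf_bound k h) _.
    rewrite expr2 mulrA ler_wpM2r // mulrC -ler_pdivlMr ?ltr0n ?fact_gt0 //.
    exact: ltW.
  apply: DeriveDef; first exact: diff_derivable.
  by rewrite deriveE // E LE.
Unshelve. all: by end_near.
Qed.

Lemma flatf_smooth k (U : set R) : smooth_on U (flatf k).
Proof.
move=> m; apply: (@Ck_sub _ _ _ _ setT) => //; elim: m k => [|m IH] k.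
  move=> x _; apply: differentiable_continuous; apply/derivable1_diffP.
  by case: (flatf_derive k x).
have dk x : differentiable (flatf k) x by apply/derivable1_diffP; case: (flatf_derive k x).
split=> // v; apply: (@Ck_ext _ _ _ _ (fun x => v * (flatf k.+2 x + (- k%:R) * flatf k.+1 x))).
- exact: openT.
- move=> x _; rewrite -[v in RHS]mulr1 (derive_linear_arg (dk x)).2.
  by have [_ ->] := flatf_derive k x; rewrite mulNr.
- apply: CkM; [exact: openT|exact: Ck_cst|apply: CkD => //; first exact: openT].
  by apply: CkM => //; [exact: openT|exact: Ck_cst].
Qed.

Lemma flatf0_homo x y : x <= y -> flatf 0 x <= flatf 0 y.
Proof.
move=> xy; have [x0|x0] := ltP 0 x; last first.
  by rewrite flatf_le0 // /flatf; case: ifP => // _; rewrite expr0 invr1 mul1r expR_ge0.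
have y0 := lt_le_trans x0 xy.
by rewrite !flatf_gt0 // expr0 invr1 !mul1r ler_expR lerN2 lef_pV2.
Qed.

(** Rises from 0, flat at 0, to 1 at [2^-1]. It exceeds 1 afterwards, so it is evaluated at points
    up to [2^-1] where values in [[0, 1]] are needed. *)
Definition ramp x : R := flatf 0 x / flatf 0 2^-1.

Lemma flatf_half : 0 < flatf 0 (2^-1 : R).
Proof. by rewrite flatf_gt0 ?invr_gt0 // expr0 invr1 mul1r expR_gt0. Qed.

Lemma ramp_le0 x : x <= 0 -> ramp x = 0.
Proof. by move=> x0; rewrite /ramp flatf_le0 // mul0r. Qed.

Lemma ramp_half : ramp 2^-1 = 1.
Proof. by rewrite /ramp divff // gt_eqF // flatf_half. Qed.

Lemma ramp_itv x : x <= 2^-1 -> 0 <= ramp x <= 1.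
Proof.
move=> x2; apply/andP; split.
  rewrite divr_ge0 ?(ltW flatf_half) //.
  by rewrite /flatf; case: ifP => // _; rewrite expr0 invr1 mul1r expR_ge0.
by rewrite ler_pdivrMr ?flatf_half // mul1r flatf0_homo.
Qed.

Lemma ramp_smooth (U : set R) : open U -> smooth_on U ramp.
Proof.
by move=> oU k; apply: CkM => //; [exact: flatf_smooth|exact: Ck_cst].
Qed.

End FlatFunction.

(** * Complex linear systems on an interval *)

Section ComplexLinearODE.
Context {R : realType} {n : nat}.
Local Notation C := R[i].
Local Notation I := (bool * 'I_n)%type.
Implicit Types (eta : R -> 'rV[C]_n) (B : R -> 'M[C]_n) (a b c d e s t K : R).

Definition part (i : I) (z : 'rV[C]_n) : R :=
  if i.1 then complex.Re (z ord0 i.2) else complex.Im (z ord0 i.2).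

Definition norm1 (z : 'rV[C]_n) : R := \sum_(i : I) `|part i z|.

Definition solves_at eta B t :=
  forall k, is_cderive (fun s => eta s ord0 k) t 1 ((eta t *m B t) ord0 k).

Lemma sum_parts (V : zmodType) (F : I -> V) : \sum_i F i = \sum_j (F (true, j) + F (false, j)).
Proof.
transitivity (\sum_b \sum_j F (b, j)); last by rewrite big_bool /= -big_split.
by rewrite pair_bigA /=; apply: eq_bigr => -[].
Qed.

Lemma norm1_eq0 z : norm1 z <= 0 -> z = 0.
Proof.
move=> z0; have H i : part i z = 0.
  apply/eqP; rewrite -normr_le0; apply: le_trans z0.
  by rewrite /norm1 (bigD1 i) //= lerDl sumr_ge0.
apply/rowP => k; rewrite mxE; apply: complex_ext.
  exact: (H (true, k)).
exact: (H (false, k)).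
Qed.

Lemma norm10 : norm1 0 = 0.
Proof. by rewrite /norm1 big1 // => -[[] k] _; rewrite /part /= mxE normr0. Qed.

(** [gronwall_short] for real and imaginary parts. The first bound serves uniqueness; the second, a
    Lipschitz estimate, serves the continuity in [total_ode_smooth]. *)
Lemma gronwall_complex eta B K a b s :
  0 <= K -> a <= s <= b -> (b - a) * K * #|{: I}|%:R <= 2^-1 ->
  (forall t, a <= t <= b -> solves_at eta B t) ->
  (forall t j k, a <= t <= b -> `|complex.Re (B t j k)| <= K /\ `|complex.Im (B t j k)| <= K) ->
  (forall t, a <= t <= b -> norm1 (eta t) <= 2 * norm1 (eta s)) /\
  (forall i t, a <= t <= b -> `|part i (eta t) - part i (eta s)| <= K * (2 * norm1 (eta s)) * `|t - s|).
Proof.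
move=> K0 asb small sol BK.
pose dy (i : I) t := part i (eta t *m B t).
have yP i t : a <= t <= b -> is_derive t 1 (fun t => part i (eta t)) (dy i t).
  by move=> /sol/(_ i.2)/is_cderiveP; rewrite /dy /part; case: i => -[] k [].
have dyK i t : a <= t <= b -> `|dy i t| <= K * \sum_j `|part j (eta t)|.
  move=> tab; rewrite sum_parts mulr_sumr.
  have tri (x y u v : R) : `|x| <= K -> `|y| <= K -> `|u * x + v * y| <= K * (`|u| + `|v|).
    move=> xK yK; apply: le_trans (ler_normD _ _) _; rewrite !normrM mulrDr.
    by rewrite [K * `|u|]mulrC [K * `|v|]mulrC lerD // ler_wpM2l.
  case: i => -[] k; rewrite /dy /part /= mxE.
    rewrite cRe_sum; apply: le_trans (ler_norm_sum _ _ _) _; apply: ler_sum => j _.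
    have [h1 h2] := BK t j k tab.
    by rewrite cReM -mulrN; apply: tri; rewrite ?normrN.
  rewrite cIm_sum; apply: le_trans (ler_norm_sum _ _ _) _; apply: ler_sum => j _.
  have [h1 h2] := BK t j k tab.
  by rewrite cImM; apply: tri.
have G := @gronwall_short R _ (fun i t => part i (eta t)) dy K a b s K0 asb small yP dyK.
split=> // i t tab.
apply: (mean_value_bound (a := a) (b := b) (df := dy i)) => // x xab.
by apply: le_trans (dyK i x xab) _; rewrite ler_wpM2l //; exact: G.
Qed.

Lemma linear_ode_complex B c d : 0 < d ->
  (forall j k t, c - d < t < c + d -> {for t, continuous (fun t => complex.Re (B t j k))}) ->
  (forall j k t, c - d < t < c + d -> {for t, continuous (fun t => complex.Im (B t j k))}) ->
  exists2 e, 0 < e <= d & forall s (v : 'rV[C]_n), c - e < s < c + e ->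
    exists eta, eta s = v /\ forall t, c - e < t < c + e -> solves_at eta B t.
Proof.
move=> d0 cRe cIm.
(* Right multiplication by [B] as a real matrix acting on real and imaginary parts. *)
pose m (i j : I) t : R := let z := B t j.2 i.2 in
  if i.1 then (if j.1 then complex.Re z else - complex.Im z)
  else (if j.1 then complex.Im z else complex.Re z).
have mc i j t : c - d < t < c + d -> {for t, continuous (m i j)}.
  move=> tc; case: i => -[] k; case: j => -[] j; rewrite /m /=.
  - exact: cRe.
  - by apply: (@continuousN _ R^o); exact: cIm.
  - exact: cIm.
  - exact: cRe.
have [e e0 He] := linear_ode d0 mc.
exists e => // s v sc; have [y [ys yP]] := He s (part^~ v) sc.
exists (fun t => \row_k (y (true, k) t +i* y (false, k) t)); split.
  by apply/rowP => k; rewrite mxE !ys /part /=; case: (v ord0 k).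
move=> t tc k; apply/is_cderiveP; split.
  rewrite (_ : (fun _ => _) = y (true, k)); last by apply/funext => x; rewrite mxE.
  apply: is_derive_eq (yP (true, k) t tc) _.
  rewrite sum_parts mxE cRe_sum; apply: eq_bigr => j _.
  by rewrite cReM !mxE /m /= mulrC mulNr [complex.Im _ * _]mulrC.
rewrite (_ : (fun _ => _) = y (false, k)); last by apply/funext => x; rewrite mxE.
apply: is_derive_eq (yP (false, k) t tc) _.
rewrite sum_parts mxE cIm_sum; apply: eq_bigr => j _.
by rewrite cImM !mxE /m /= mulrC [complex.Re _ * y _ _]mulrC.
Qed.

End ComplexLinearODE.

(** * Curves and covariant derivatives along them *)

Section Curves.
Context {R : realType} {n : nat} {M : complexManifold R n}.
Local Notation C := R[i].
Local Notation N := (n + n)%N.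
Implicit Types (c : chart R n M) (U W : set M) (f : M -> C) (x y : M) (gamma : R -> M).
Implicit Types (Y : R -> tvec M) (s t : R).

Definition curve_diff gamma t := {for t, continuous gamma} /\
  forall c, atlas c -> chart_dom c (gamma t) -> differentiable (fun s => chart_map c (gamma s)) t.

Definition vel c gamma t : 'rV[R]_N := \row_k 'D_1 (fun s => chart_map c (gamma s) ord0 k) t.

Lemma curve_near gamma t U : {for t, continuous gamma} -> open U -> U (gamma t) ->
  \forall s \near t, U (gamma s).
Proof. by move=> cg oU Ut; apply: cg; exact: open_nbhs_nbhs. Qed.

Lemma chart_curve_open c gamma (I : set R) : atlas c -> open I ->
  (forall t, I t -> {for t, continuous gamma}) -> open (I `&` gamma @^-1` chart_dom c).
Proof.
move=> ac oI cg; rewrite openE => t [It ct].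
apply: filterI; first exact: open_nbhs_nbhs.
by apply: (curve_near (cg t It)) => //; exact: chart_open.
Qed.

Lemma smooth_curve_diff gamma (I : set R) : open I -> (forall t, I t -> {for t, continuous gamma}) ->
  (forall c : chart R n M, atlas c -> forall k,
     smooth_on (I `&` gamma @^-1` chart_dom c) (fun t => chart_map c (gamma t) ord0 k)) ->
  forall t, I t -> curve_diff gamma t.
Proof.
move=> oI cg sg t It; split=> [|c ac ct]; first exact: cg.
by apply: differentiable_row => k; exact: (smooth_on_diff (sg c ac k)).
Qed.

Lemma curve_chain c gamma t f : atlas c -> chart_dom c (gamma t) -> curve_diff gamma t ->
  smooth_near (gamma t) f ->
  is_cderive (fun s => f (gamma s)) t 1 (cdir c (rcx (vel c gamma t)) f (gamma t)).
Proof.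
move=> ac ct [cg dg] ft.
have := cderive_comp_row (g := fun p => f (chart_inv c p)) (1 : R) (dg c ac ct) (smooth_near_cdiff ac ct ft).
rewrite (_ : \sum_k _ = cdir c (rcx (vel c gamma t)) f (gamma t)); last first.
  by apply: eq_bigr => k _; rewrite !mxE.
apply: is_cderive_near; apply: filterS (curve_near cg (chart_open ac) ct) => s cs.
by rewrite chart_mapK.
Qed.

Lemma velocity_chart c gamma t : atlas c -> chart_dom c (gamma t) -> curve_diff gamma t ->
  velocity gamma t = chart_vec c (gamma t) (rcx (vel c gamma t)).
Proof.
move=> ac ct dg; apply/funext => f; rewrite /velocity.
case: asboolP => [ft|nft]; last by rewrite chart_vec_not.
by have [_ ->] := curve_chain ac ct dg ft; rewrite chart_vecE.
Qed.

Lemma cov_deriv_near DT gamma gamma' Y Y' t w : (\forall s \near t, gamma s = gamma' s) ->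
  (\forall s \near t, Y s = Y' s) -> cov_deriv DT gamma Y t w -> cov_deriv DT gamma' Y' t w.
Proof.
move=> gg' YY' [U [X [m [E [y [[oU Ut] [sX Xt] HE YE ->]]]]]].
have g0 : gamma t = gamma' t by exact: (nbhs_singleton gg').
have vE : velocity gamma t = velocity gamma' t.
  apply/funext => f; rewrite /velocity -g0; case: ifP => // _.
  by apply: cderive_near; apply: filterS gg' => s ->.
exists U, X, m, E, y; split; rewrite -?g0 -?vE //.
by apply: filterS (filterI YE (filterI gg' YY')) => s [h [<- <-]].
Qed.

Section Transport.
Variable DT : vfield M -> vfield M -> vfield M.

Definition transport_mx (Gam : M -> 'I_n -> 'M[C]_n) c gamma t : 'M[C]_n :=
  - nabla_mx (Gam (gamma t)) (rcx (vel c gamma t)).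

(** [cov_deriv] is witnessed by an arbitrary family [E] with coefficients [y]. Expanding [E] in the
    chart and applying the chain rule along [gamma] leaves a linear system for the components of
    [Y], independent of the witnesses. *)
Lemma cov_deriv_solves c Gam gamma Y t : atlas c -> chart_dom c (gamma t) ->
  torsion_chart DT c Gam -> curve_diff gamma t -> cov_deriv DT gamma Y t 0 ->
  solves_at (fun s => comp10 c (Y s)) (transport_mx Gam c gamma) t /\
  \forall s \near t, Y s = vec10 c (gamma s) (comp10 c (Y s)).
Proof.
move=> ac ct [Gs HDT _] dg [U [X [m [E [y [[oU Ut] [sX Xt] HE YE zE]]]]]].
pose W := U `&` chart_dom c.
have oW : open W by apply: openI => //; exact: chart_open.
have Wc : W `<=` chart_dom c by move=> z [].
have WU : W `<=` U by move=> z [].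
have Wt : W (gamma t) by [].
have [ux [us uE]] := rsection_chart ac Wc (rsection_sub WU sX).
have /choice[e He] : forall j, exists p : M -> 'rV[C]_n, smooth_row W p /\
    forall x, W x -> E j x = vec10 c x (p x).
  by move=> j; apply: (section10_chart ac Wc); apply: section10_sub WU _; case: (HE j).
have near_W : \forall s \near t, W (gamma s) by apply: curve_near => //; case: dg.
pose eta s := \sum_j y j s *: e j (gamma s).
have near_Y : \forall s \near t, Y s = vec10 c (gamma s) (eta s).
  apply: filterS (filterI YE near_W) => s [-> Ws].
  by rewrite vec10_sum; apply: eq_bigr => j _; rewrite (He j).2 // vec10Z.
have near_eta : \forall s \near t, comp10 c (Y s) = eta s.
  by apply: filterS (filterI near_Y near_W) => s [-> [_ cs]]; rewrite comp10K.
split; last first.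
  by apply: filterS (filterI near_Y near_eta) => s [E1 E2]; rewrite E2.
(* [X] is an arbitrary extension of the velocity; its value at [gamma t] is all that enters
   [nabla]. *)
have uv : ux (gamma t) = vel c gamma t.
  apply: rcx_inj; apply: (chart_vec_inj ac ct).
  by rewrite -uE // Xt (velocity_chart ac ct dg).
set v := rcx (vel c gamma t).
have ns j k : smooth_near (gamma t) (fun x => e j x ord0 k) by exists W; split=> //; exact: (He j).1.
have DE j : DT X (E j) (gamma t) = vec10 c (gamma t) (nabla c Gam (e j) (gamma t) v).
  have us' k : smooth_fun W (fun y => rcx (ux y) ord0 k) by apply: smooth_fun_eq (us k) => x; rewrite mxE.
  have := HDT W X (E j) (fun x => rcx (ux x)) (e j) (gamma t) oW Wc Wt us' (He j).1 (fun x Wx => uE x Wx) (He j).2.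
  by rewrite uv.
have z0 : \sum_j (cderive (y j) t 1 *: e j (gamma t) + y j t *: nabla c Gam (e j) (gamma t) v) = 0.
  rewrite -[LHS](comp10K _ ac ct) vec10_sum.
  under eq_bigr => j _ do rewrite vec10D !vec10Z -DE -(He j).2 //.
  by rewrite -zE; apply/rowP => k; rewrite !mxE.
move=> k.
have D : is_cderive (fun s => eta s ord0 k) t 1
    (\sum_j (cderive (y j) t 1 * e j (gamma t) ord0 k + y j t * cdir c v (fun x => e j x ord0 k) (gamma t))).
  rewrite (_ : (fun s => eta s ord0 k) = fun s => \sum_j y j s * e j (gamma s) ord0 k); last first.
    by apply/funext => s; rewrite /eta summxE; apply: eq_bigr => j _; rewrite mxE.
  apply: is_cderive_sum => j _; apply: is_cderiveM; last exact: curve_chain.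
  by split=> //; case: (HE j) => _ [].
have -> : ((comp10 c (Y t)) *m transport_mx Gam c gamma t) ord0 k =
    \sum_j (cderive (y j) t 1 * e j (gamma t) ord0 k + y j t * cdir c v (fun x => e j x ord0 k) (gamma t)).
  rewrite (nbhs_singleton near_eta) /transport_mx mulmxN /eta mulmx_suml -/v.
  have /rowP/(_ k) := z0; rewrite summxE [RHS]mxE => z0k.
  apply/eqP; rewrite mxE eq_sym -addr_eq0 summxE -big_split -[X in _ == X]z0k; apply/eqP.
  apply: eq_bigr => j _ /=; rewrite -scalemxAl [RHS]mxE; rewrite [X in _ = X + _]mxE [X in _ = _ + X]mxE.
  by rewrite /nabla [X in _ = _ + _ * X]mxE [X in _ = _ + _ * (X + _)]mxE [X in _ + X = _]mxE mulrDr addrA.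
by apply: is_cderive_near D; apply: filterS near_eta => s ->.
Qed.

Lemma solves_cov_deriv c Gam gamma Y eta t : atlas c -> chart_dom c (gamma t) ->
  torsion_chart DT c Gam -> curve_diff gamma t ->
  solves_at eta (transport_mx Gam c gamma) t -> (\forall s \near t, Y s = vec10 c (gamma s) (eta s)) ->
  cov_deriv DT gamma Y t 0.
Proof.
move=> ac ct [Gs HDT _] dg sol YE.
have oc := chart_open ac.
set v := rcx (vel c gamma t).
pose e_ := fun j : 'I_n => (delta_mx ord0 j : 'rV[C]_n).
(* The velocity at [t] extended with constant components, and the coordinate frame of [T^{1,0}M],
   whose covariant derivatives are given by [Gam] alone. *)
exists (chart_dom c), (fun x => chart_vec c x v), n, (fun j x => vec10 c x (e_ j)), (fun j s => eta s ord0 j).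
split=> //.
- split; last by rewrite (velocity_chart ac ct dg).
  by apply: (@rsection_intro _ _ _ c _ _ (fun=> vel c gamma t)) => // k; exact: smooth_fun_cst.
- move=> j; split; last by case: (sol j).
  by apply: (@section10_intro _ _ _ c _ _ (fun=> e_ j)) => // k; exact: smooth_fun_cst.
- apply: filterS YE => s ->; rewrite {1}[eta s]row_sum_delta vec10_sum.
  by apply: eq_bigr => j _; rewrite vec10Z.
have DE j : DT (fun x => chart_vec c x v) (fun x => vec10 c x (e_ j)) (gamma t) =
    vec10 c (gamma t) (e_ j *m nabla_mx (Gam (gamma t)) v).
  have := HDT (chart_dom c) (fun x => chart_vec c x v) (fun x => vec10 c x (e_ j)) (fun=> v) (fun=> e_ j)
    (gamma t) oc (@subset_refl _ _) ct (fun k => smooth_fun_cst _ _) (fun k => smooth_fun_cst _ _)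
    (fun _ _ => erefl) (fun _ _ => erefl).
  move=> ->.
  congr vec10; rewrite /nabla [X in X + _](_ : _ = 0) ?add0r //.
  by apply/rowP => k; rewrite mxE cdir_cst mxE.
under eq_bigr => j _ do rewrite DE -!vec10Z -vec10D.
have z0 : vec10 c (gamma t) 0 = 0.
  by have := vec10Z c (gamma t) 0 0; rewrite !scale0r.
rewrite -vec10_sum -[LHS]z0.
congr vec10; apply/esym; rewrite big_split /=.
have -> : \sum_j cderive (fun s => eta s ord0 j) t 1 *: e_ j = - (eta t *m nabla_mx (Gam (gamma t)) v).
  rewrite -mulmxN [RHS]row_sum_delta; apply: eq_bigr => j _.
  by have [_ ->] := sol j.
rewrite [in X in X + _ = _](row_sum_delta (eta t)) mulmx_suml.
rewrite -sumrN -big_split big1 // => j _ /=.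
by rewrite -scalemxAl addNr.
Qed.

End Transport.

End Curves.

(** * Induction over connected sets *)

Section Preliminaries.

(** [P] passes between any two points of a small neighbourhood, so the subsets of [A] where it holds
    and where it fails are both relatively open. *)
Lemma connected_induction (T : topologicalType) (A : set T) (P : T -> Prop) a :
  connected A -> A a -> P a ->
  (forall x, A x -> exists U, [/\ open U, U x &
    forall y z, A y -> A z -> U y -> U z -> P y -> P z]) ->
  forall x, A x -> P x.
Proof.
move=> cA Aa Pa H.
pose good U := open U /\ forall y z, A y -> A z -> U y -> U z -> P y -> P z.
pose O (Q : T -> Prop) := \bigcup_(U in [set U | good U /\ exists y, [/\ A y, U y & Q y]]) U.
have oO Q : open (O Q) by apply: bigcup_open => U [[]].
have E : [set x | A x /\ P x] = A.
  apply: cA.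
  - by exists a.
  - exists (O P) => //; apply/seteqP; split=> x /=.
      move=> [Ax Px]; split=> //; have [U [oU Ux HU]] := H x Ax.
      by exists U => //; split=> //; exists x.
    by move=> [Ax [U [[oU HU] [y [Ay Uy Py]]] Ux]]; split=> //; exact: (HU y).
  - exists (~` O (fun y => ~ P y)); first by rewrite closedC.
    apply/seteqP; split=> x /=.
      move=> [Ax Px]; split=> // -[U [[oU HU] [y [Ay Uy Py]]] Ux]; apply: Py.
      exact: (HU x).
    move=> [Ax nO]; split=> //; apply: contrapT => nPx; apply: nO.
    by have [U [oU Ux HU]] := H x Ax; exists U => //; split=> //; exists x.
by move=> x; rewrite -E => -[].
Qed.

Lemma near_bounded (R : realType) (T : topologicalType) (I : finType) (f : I -> T -> R) x :
  (forall i, {for x, continuous (f i)}) ->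
  exists2 K, 0 <= K & \forall y \near x, forall i, `|f i y| <= K.
Proof.
move=> cf; exists (\sum_i (`|f i x| + 1)); first by rewrite sumr_ge0 // => i _; rewrite addr_ge0.
apply: (@filter_forall _ _ _ _ _) => i.
have /cvgrPdist_lt/(_ 1 ltr01) := cf i; apply: filterS => y xy.
rewrite (bigD1 i) //=; apply: (@le_trans _ _ (`|f i x| + 1)); last first.
  by rewrite lerDl sumr_ge0 // => j _; rewrite addr_ge0.
rewrite -[f i y](subrK (f i x)) addrC; apply: le_trans (ler_normD _ _) _.
by rewrite lerD2l distrC ltW.
Qed.

Lemma near_refl (T : topologicalType) (T' : Type) (f : T -> T') (x : T) : \forall y \near x, f y = f y.
Proof. exact: nearW. Qed.

End Preliminaries.

(** * Existence and uniqueness of parallel transport along a curve *)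

Section Transport.
Context {R : realType} {n : nat} {M : complexManifold R n}.
Local Notation C := R[i].
Local Notation N := (n + n)%N.
Implicit Types (c : chart R n M) (U W : set M) (f : M -> C) (x y : M) (gamma : R -> M).
Implicit Types (Y : R -> tvec M) (s t : R) (I : set R).

Definition curve_on I gamma := [/\ open I, (forall t, I t -> {for t, continuous gamma}) &
  forall c : chart R n M, atlas c -> forall k,
    smooth_on (I `&` gamma @^-1` chart_dom c) (fun t => chart_map c (gamma t) ord0 k)].

Lemma curve_on_diff I gamma t : curve_on I gamma -> I t -> curve_diff gamma t.
Proof. by case=> oI cg sg; exact: smooth_curve_diff. Qed.

Lemma solves_atB (eta xi : R -> 'rV[C]_n) B t : solves_at eta B t -> solves_at xi B t ->
  solves_at (fun s => eta s - xi s) B t.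
Proof.
move=> H1 H2 k.
rewrite (_ : (fun s => _) = fun s => eta s ord0 k + (-1) * xi s ord0 k); last first.
  by apply/funext => s; rewrite !mxE mulN1r.
have -> : ((eta t - xi t) *m B t) ord0 k = (eta t *m B t) ord0 k + (-1) * (xi t *m B t) ord0 k.
  by rewrite mulmxBl !mxE mulN1r.
by apply: is_cderiveD => //; apply: is_cderiveMl.
Qed.

Variable DT : vfield M -> vfield M -> vfield M.
Hypothesis DT_chart : forall c, atlas c -> exists Gam, torsion_chart DT c Gam.

Definition parallel_at gamma Y t := T10 (gamma t) (Y t) /\ cov_deriv DT gamma Y t 0.

Lemma parallel_at_near gamma gamma' Y Y' t : (\forall s \near t, gamma s = gamma' s) ->
  (\forall s \near t, Y s = Y' s) -> parallel_at gamma Y t -> parallel_at gamma' Y' t.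
Proof.
move=> gg YY [TY cY]; split; last exact: cov_deriv_near cY.
by rewrite -(nbhs_singleton gg) -(nbhs_singleton YY).
Qed.

Lemma transport_mx_smooth I c Gam gamma : atlas c -> curve_on I gamma -> torsion_chart DT c Gam ->
  forall j k, csmooth_on (I `&` gamma @^-1` chart_dom c) (fun t => transport_mx Gam c gamma t j k).
Proof.
move=> ac [oI cg sg] [Gs _ _] j k.
have oW := chart_curve_open ac oI cg.
have E t : transport_mx Gam c gamma t j k = - \sum_m ((vel c gamma t ord0 (lshift n m))%:C +
    'i%C * (vel c gamma t ord0 (rshift n m))%:C) * Gam (gamma t) m j k.
  by rewrite mxE summxE; congr (- _); apply: eq_bigr => m _; rewrite !mxE.
rewrite (_ : (fun t => _) = fun t => - \sum_m ((vel c gamma t ord0 (lshift n m))%:C +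
    'i%C * (vel c gamma t ord0 (rshift n m))%:C) * Gam (gamma t) m j k); last exact/funext.
have sv l : csmooth_on (I `&` gamma @^-1` chart_dom c) (fun t => (vel c gamma t ord0 l)%:C).
  apply: csmooth_real; rewrite (_ : (fun _ => _) = (fun t => 'D_1 (fun s => chart_map c (gamma s) ord0 l) t)).
    exact: smooth_on_derive (sg c ac l).
  by apply/funext => t; rewrite mxE.
apply: csmoothN => //; apply: csmooth_sum => // m _; apply: csmoothM => //.
  by apply: csmoothD => //; apply: csmoothM => //; exact: csmooth_cst.
apply: (@csmooth_ext _ _ _ (fun t => Gam (chart_inv c (chart_map c (gamma t))) m j k)) => //.
  by move=> t [_ ct]; rewrite chart_mapK.
apply: (@csmooth_comp_row _ _ _ _ (chart_map c @` (chart_dom c `&` chart_dom c))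
  (fun t => chart_map c (gamma t)) (fun p => Gam (chart_inv c p) m j k)) => //.
- by move=> t [_ ct]; exists (gamma t).
- exact: sg.
- exact: Gs.
Qed.

(** One radius serves for everything inside a chart: solutions from any time and vector of the
    window, and uniqueness on closed subintervals. The connectedness arguments below then only
    compare nearby times. *)
Lemma local_transport I gamma t0 : curve_on I gamma -> I t0 ->
  exists2 e : R, 0 < e & [/\ (forall t, t0 - e < t < t0 + e -> I t),
    (forall s v, t0 - e < s < t0 + e -> T10 (gamma s) v ->
      exists2 Y, Y s = v & forall t, t0 - e < t < t0 + e -> parallel_at gamma Y t) &
    (forall Y1 Y2 a b s, t0 - e < a -> b < t0 + e -> a <= s <= b ->
      (forall t, a <= t <= b -> parallel_at gamma Y1 t) -> (forall t, a <= t <= b -> parallel_at gamma Y2 t) ->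
      Y1 s = Y2 s -> forall t, a <= t <= b -> Y1 t = Y2 t)].
Proof.
move=> cvg It; have [oI cg sg] := cvg.
have [c ac ct] := atlas_cover (gamma t0).
have [Gam TG] := DT_chart ac.
pose W := I `&` gamma @^-1` chart_dom c.
have oW : open W := chart_curve_open ac oI cg.
have Bs := transport_mx_smooth ac cvg TG.
have Rc j k t : W t -> {for t, continuous (fun t => complex.Re (transport_mx Gam c gamma t j k))}.
  by move=> Wt; have [/(_ 0%N) H _] := Bs j k; exact: H.
have Ic j k t : W t -> {for t, continuous (fun t => complex.Im (transport_mx Gam c gamma t j k))}.
  by move=> Wt; have [_ /(_ 0%N) H] := Bs j k; exact: H.
have Wt0 : W t0 by [].
pose Bp (i : 'I_n * 'I_n * bool) t := if i.2 then complex.Re (transport_mx Gam c gamma t i.1.1 i.1.2)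
  else complex.Im (transport_mx Gam c gamma t i.1.1 i.1.2).
have Bpc i : {for t0, continuous (Bp i)}.
  by case: i => -[j k] []; [exact: Rc|exact: Ic].
have [K K0 BK] := near_bounded Bpc.
have /nbhs_ballP[d /= d0 Hd] : \forall t \near t0, W t /\ forall i, `|Bp i t| <= K.
  by apply: filterI BK; exact: open_nbhs_nbhs.
have Hd' t : t0 - d < t < t0 + d -> W t /\
    forall j k, `|complex.Re (transport_mx Gam c gamma t j k)| <= K /\ `|complex.Im (transport_mx Gam c gamma t j k)| <= K.
  move=> td; have [|Wt H] := Hd t; first by rewrite /ball /= ltr_distl; lra.
  by split=> // j k; split; [exact: (H (j, k, true))|exact: (H (j, k, false))].
have [e1 /andP[e10 e1d] ode] := linear_ode_complex d0 (fun j k t td => Rc j k t (Hd' t td).1)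
  (fun j k t td => Ic j k t (Hd' t td).1).
pose L := K * #|{: bool * 'I_n}|%:R + 1.
have KI0 : 0 <= K * #|{: bool * 'I_n}|%:R by rewrite mulr_ge0.
have L0 : 0 < L by rewrite /L; lra.
(* Two times of the window differ by less than [2 * e], and [gronwall_complex] asks for
   [2 e K |I| <= 1/2]. *)
pose e := Num.min e1 (4^-1 / L).
have e0 : 0 < e by rewrite lt_min e10 divr_gt0.
have ee1 : e <= e1 by rewrite ge_min lexx.
have eL : e * L <= 4^-1 by rewrite -ler_pdivlMr // ge_min lexx orbT.
exists e => //; split.
- by move=> t te; case: (Hd' t) => [|[]//]; lra.
- move=> s v se Tv.
  have [_ cs] := (Hd' s ltac:(lra)).1.
  have [p pv] := T10_chart ac cs Tv.
  have [eta [etas sol]] := ode s p ltac:(lra).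
  exists (fun t => vec10 c (gamma t) (eta t)); first by rewrite etas.
  move=> t te; have [It' {}ct'] := (Hd' t ltac:(lra)).1.
  split; first exact: T10_vec10.
  apply: (solves_cov_deriv ac ct' TG (curve_on_diff cvg It') (sol t ltac:(lra))).
  exact: near_refl.
- move=> Y1 Y2 a b s ta tb sab P1 P2 Ys.
  have S Y' t : a <= t <= b -> parallel_at gamma Y' t ->
      solves_at (fun s => comp10 c (Y' s)) (transport_mx Gam c gamma) t /\ Y' t = vec10 c (gamma t) (comp10 c (Y' t)).
    move=> tab [_ cY]; have [It' {}ct'] := (Hd' t ltac:(lra)).1.
    have [sol YE] := cov_deriv_solves ac ct' TG (curve_on_diff cvg It') cY.
    by split=> //; exact: (nbhs_singleton YE).
  have small : (b - a) * K * #|{: bool * 'I_n}|%:R <= 2^-1.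
    rewrite -mulrA; have ba : b - a <= 2 * e by lra.
    apply: le_trans (ler_wpM2r KI0 ba) _.
    by move: eL; rewrite /L mulrDr mulr1; move: (K * _) => z; lra.
  have [G _] := gronwall_complex (eta := fun t => comp10 c (Y1 t) - comp10 c (Y2 t)) K0 sab small
    (fun t tab => solves_atB (S Y1 t tab (P1 t tab)).1 (S Y2 t tab (P2 t tab)).1)
    (fun t j k tab => (Hd' t ltac:(lra)).2 j k).
  move=> t tab; have := G t tab; rewrite Ys subrr norm10 mulr0 => /norm1_eq0/eqP.
  rewrite subr_eq0 => /eqP E.
  by rewrite (S Y1 t tab (P1 t tab)).2 (S Y2 t tab (P2 t tab)).2 E.
Qed.

Lemma parallel_at_unique I gamma Y1 Y2 : curve_on I gamma -> `[0, 1] `<=` I ->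
  (forall t, 0 <= t <= 1 -> parallel_at gamma Y1 t) -> (forall t, 0 <= t <= 1 -> parallel_at gamma Y2 t) ->
  Y1 0 = Y2 0 -> forall t, 0 <= t <= 1 -> Y1 t = Y2 t.
Proof.
move=> cvg II P1 P2 Y0 t t01.
apply: (@connected_induction R `[0, 1]%classic (fun t => Y1 t = Y2 t) 0); rewrite /= ?in_itv /= ?lexx ?ler01 //.
- exact: segment_connected.
- move=> t0 t001; have [e e0 [_ _ U]] := local_transport cvg (II t0 t001).
  exists (ball t0 e); split; [exact: ball_open|exact: ballxx|].
  move=> y z; rewrite /ball /= !in_itv /= !ltr_distl => y01 z01 yb zb E.
  have Yyz : forall u, Num.min y z <= u <= Num.max y z -> Y1 u = Y2 u.
    apply: (U Y1 Y2 _ _ y) => //.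
    - by rewrite lt_min; lra.
    - by rewrite gt_max; lra.
    - by rewrite ge_min le_max lexx.
    - by move=> u; rewrite ge_min le_max => ?; apply: P1; lra.
    - by move=> u; rewrite ge_min le_max => ?; apply: P2; lra.
  by apply: Yyz; rewrite ge_min le_max lexx !orbT.
Qed.

(** Continuation from 0. The property carried along concerns a field on the open interval
    [(- d, t + d)]: the margin lets the next piece be attached and makes the derivatives at the ends
    two-sided. *)
Lemma parallel_at_exists I gamma v : curve_on I gamma -> `[0, 1] `<=` I -> T10 (gamma 0) v ->
  exists2 Y, Y 0 = v & forall t, 0 <= t <= 1 -> parallel_at gamma Y t.
Proof.
move=> cvg II Tv.
pose P t := exists Y (d : R), [/\ 0 < d, Y 0 = v & forall u, - d < u < t + d -> parallel_at gamma Y u].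
suff [Y [d [d0 Y0 PY]]] : P 1 by exists Y => // t t01; apply: PY; lra.
apply: (@connected_induction R `[0, 1]%classic P 0); rewrite /= ?in_itv /= ?lexx ?ler01 //.
- exact: segment_connected.
- have [|e e0 [_ ex _]] := local_transport (t0 := 0) cvg; first by apply: II; rewrite /= in_itv /= lexx ler01.
  have [|Y Y0 PY] := ex 0 v _ Tv; first by lra.
  by exists Y, e; split=> // u; rewrite add0r -{1}[- e]add0r => ue; apply: PY; lra.
- move=> t0 t001; have [e e0 [_ ex un]] := local_transport cvg (II t0 t001).
  exists (ball t0 e); split; [exact: ball_open|exact: ballxx|].
  move=> s t; rewrite /ball /= !in_itv /= !ltr_distl => s01 t01 sb tb [Y [d [d0 Y0 PY]]].
  have [ts|st] := leP t s; first by exists Y, d; split=> // u ud; apply: PY; lra.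
  have [|Z Zs PZ] := ex s (Y s) _ (PY s ltac:(lra)).1; first by lra.
  exists (fun u => if u <= s then Y u else Z u), (Num.min d (t0 + e - t)).
  split; first by rewrite lt_min; lra.
    by rewrite ifT ?Y0 //; lra.
  move=> u; rewrite -ltrBlDl ltrNl !lt_min => ub.
  have [us|us|us] := ltgtP u s.
  + apply: (@parallel_at_near gamma _ Y); [exact: near_refl| |by apply: PY; lra].
    by near=> w; rewrite ifT //; apply: ltW; near: w; exact: lt_nbhsl.
  + apply: (@parallel_at_near gamma _ Z); [exact: near_refl| |by apply: PZ; lra].
    by near=> w; rewrite ifF //; apply/negbTE; rewrite -ltNge; near: w; exact: lt_nbhsr.
  + rewrite us; apply: (@parallel_at_near gamma _ Y); [exact: near_refl| |by apply: PY; lra].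
    (* Both fields are parallel around [s]; agreeing at [s], they agree within distance [r], chosen
       to stay inside both domains. So the glued field is [Y] near [s]. *)
    pose r := Num.min (d / 2) (Num.min ((t0 + e - s) / 2) ((s - t0 + e) / 2)).
    have r0 : 0 < r by rewrite !lt_min; lra.
    have [rd r1 r2] : [/\ r <= d / 2, r <= (t0 + e - s) / 2 & r <= (s - t0 + e) / 2].
      by rewrite /r !ge_min !lexx ?orbT.
    have E : forall w, s - r <= w <= s + r -> Y w = Z w.
      by apply: (un Y Z _ _ s); rewrite ?Zs //; try lra; move=> w wr; [apply: PY|apply: PZ]; lra.
    apply/nbhs_ballP; exists r => //= w; rewrite /ball /= ltr_distl => wr.
    by case: ifP => // _; apply: E; lra.
Unshelve. all: by end_near.
Qed.

End Transport.

Section AffineMaps.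
Context {R : realType}.
Implicit Types (U : set R).

Lemma is_derive_affine (a b t : R) : is_derive t 1 (fun t : R => a + t * b) b.
Proof.
apply: is_derive_eq (is_deriveD (is_derive_cst a t 1) (is_deriveM (is_derive_id t 1) (is_derive_cst b t 1))) _.
by rewrite scaler0 add0r add0r /GRing.scale /= mulr1.
Qed.

Lemma smooth_affine U (a b : R) : smooth_on U (fun t : R => a + t * b).
Proof.
move=> k; apply: (@Ck_sub _ _ _ _ setT) => //.
have d (t : R) : differentiable (fun t : R => a + t * b) t by apply/derivable1_diffP; case: (is_derive_affine a b t).
case: k => [|k]; first by move=> t _; exact: differentiable_continuous.
split=> // v; apply: (@Ck_ext _ _ _ _ (fun=> v * b)); [exact: openT| |exact: Ck_cst].
move=> t _; rewrite -[v in RHS]mulr1 (derive_linear_arg (d t)).2.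
by have [_ ->] := is_derive_affine a b t.
Qed.

Lemma is_cderive_comp1 (f : R -> R[i]) (r : R -> R) (t r' : R) d :
  is_derive t 1 r r' -> is_cderive f (r t) 1 d -> is_cderive (fun s => f (r s)) t 1 (r'%:C * d).
Proof.
move=> dr /is_cderiveP[d1 d2]; apply/is_cderiveP; split.
  by apply: is_derive_eq (is_derive1_comp d1 dr) _; rewrite cReM /= mul0r subr0 /GRing.scale /= mulrC.
by apply: is_derive_eq (is_derive1_comp d2 dr) _; rewrite cImM /= mul0r addr0 /GRing.scale /= mulrC.
Qed.

End AffineMaps.

(** * Concatenation and reversal of paths *)

Section Paths.
Context {R : realType} {n : nat} {M : complexManifold R n}.
Local Notation C := R[i].
Local Notation N := (n + n)%N.
Local Notation V := 'rV[R]_N.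
Implicit Types (c : chart R n M) (U W : set M) (f : M -> C) (x y : M) (gamma : R -> M).
Implicit Types (Y : R -> tvec M) (s t : R) (I : set R) (v w : tvec M).

Lemma curve_on_comp I gamma (r : R -> R) : smooth_on setT r -> curve_on I gamma ->
  curve_on (r @^-1` I) (fun t => gamma (r t)).
Proof.
move=> sr [oI cg sg].
have cr t : {for t, continuous r} by exact: (sr 0%N t).
have oI' : open (r @^-1` I).
  by rewrite openE => t It; apply: cr; exact: open_nbhs_nbhs.
have cgr t : (r @^-1` I) t -> {for t, continuous (fun t => gamma (r t))}.
  by move=> It; apply: (@continuous_comp _ _ _ r gamma) => //; exact: cg.
split=> // c ac k m.
apply: (@Ck_comp1 R R m _ (I `&` gamma @^-1` chart_dom c) r (fun t => chart_map c (gamma t) ord0 k)) => //.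
- exact: (chart_curve_open (gamma := fun t => gamma (r t)) ac oI' cgr).
- exact: Ck_sub (sr m).
- exact: sg.
Qed.

Lemma curve_line c (p w : V) : atlas c ->
  curve_on [set t | chart_image c (p + t *: w)] (fun t => chart_inv c (p + t *: w)).
Proof.
move=> ac.
have lc t : {for t, continuous (fun t : R => p + t *: w)}.
  apply: (@continuousD _ _ _ (fun=> p) (fun t : R => t *: w)); first exact: cst_continuous.
  exact: scalel_continuous.
have oI : open [set t : R | chart_image c (p + t *: w)].
  by rewrite openE => t It; apply: (lc t); apply: open_nbhs_nbhs; split=> //; exact: chart_image_open.
have cg t : [set t : R | chart_image c (p + t *: w)] t ->
    {for t, continuous (fun t => chart_inv c (p + t *: w))}.
  by move=> It; apply: (continuous_comp (lc t)); exact: chart_inv_continuous.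
have sl k (U : set R) : smooth_on U (fun t : R => (p + t *: w) ord0 k).
  rewrite (_ : (fun t => _) = fun t => p ord0 k + t * w ord0 k); first exact: smooth_affine.
  by apply/funext => t; rewrite !mxE.
split=> // c' ac' k m.
have oU := chart_curve_open (gamma := fun t => chart_inv c (p + t *: w)) ac' oI cg.
apply: (@Ck_comp_row _ _ m _ _ (chart_map c @` (chart_dom c `&` chart_dom c')) (fun t : R => p + t *: w)
  (fun q => chart_map c' (chart_inv c q) ord0 k)) => //.
- move=> t [/= It ct]; have [h1 h2] := chart_invK ac It.
  by exists (chart_inv c (p + t *: w)).
- by move=> j; exact: sl.
- exact: (atlas_holomorphic ac ac').1.
Qed.

(* Near [h] the coordinates of the concatenation are the sum of those of the two pieces, minus
   a constant; the same device works for the components in [parallel_at_glue]. *)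
Lemma curve_glue I1 I2 gamma1 gamma2 h x : curve_on I1 gamma1 -> curve_on I2 gamma2 ->
  (forall t, h <= t -> gamma1 t = x) -> (forall t, t <= h -> gamma2 t = x) ->
  curve_on (I1 `&` I2) (fun t => if t <= h then gamma1 t else gamma2 t).
Proof.
move=> cv1 cv2 g1 g2; have [op1 c1 s1] := cv1; have [op2 c2 s2] := cv2.
set gamma := fun t => _.
have gl t : t < h -> \forall s \near t, gamma1 s = gamma s.
  by move=> th; near=> s; rewrite /gamma ifT //; apply: ltW; near: s; exact: lt_nbhsl.
have gr t : h < t -> \forall s \near t, gamma2 s = gamma s.
  by move=> th; near=> s; rewrite /gamma ifF //; apply/negbTE; rewrite -ltNge; near: s; exact: lt_nbhsr.
have oI : open (I1 `&` I2) by exact: openI.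
have cg t : (I1 `&` I2) t -> {for t, continuous gamma}.
  move=> [t1 t2]; have [th|th|th] := ltgtP t h.
  - exact: near_eq_continuous_at (gl t th) (c1 t t1).
  - exact: near_eq_continuous_at (gr t th) (c2 t t2).
  - subst t; move=> A; rewrite /gamma lexx => Ah; have := c1 h t1 A Ah.
    have := c2 h t2 A; rewrite g2 // -(g1 h) // => /(_ Ah) A2 A1.
    have A12 : \forall s \near h, A (gamma1 s) /\ A (gamma2 s) .
      by apply: filterI; [exact: A1|exact: A2].
    by apply: filterS A12 => s [h3 h4] /=; case: ifP.
split=> // c ac k m.
apply: Ck_local => t [[t1 t2] ct].
pose W1 := I1 `&` gamma1 @^-1` chart_dom c; pose W2 := I2 `&` gamma2 @^-1` chart_dom c.
have oW1 : open W1 := chart_curve_open ac op1 c1.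
have oW2 : open W2 := chart_curve_open ac op2 c2.
have [th|th|th] := ltgtP t h.
- exists (W1 `&` [set s | s < h]); split; [by apply: openI => //; exact: open_lt| |].
    by split=> //; split=> //; move: ct; rewrite /= /gamma (ltW th).
  apply: (@Ck_ext _ _ _ _ (fun t => chart_map c (gamma1 t) ord0 k)).
  + by apply: openI => //; exact: open_lt.
  + by move=> s [_ /= sh]; rewrite /gamma (ltW sh).
  + by apply: (@Ck_sub _ _ _ _ W1); [move=> s []|exact: s1].
- exists (W2 `&` [set s | h < s]); split; [by apply: openI => //; exact: open_gt| |].
    by split=> //; split=> //; move: ct; rewrite /= /gamma leNgt th.
  apply: (@Ck_ext _ _ _ _ (fun t => chart_map c (gamma2 t) ord0 k)).
  + by apply: openI => //; exact: open_gt.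
  + by move=> s [_ /= sh]; rewrite /gamma leNgt sh.
  + by apply: (@Ck_sub _ _ _ _ W2); [move=> s []|exact: s2].
- subst t; move: ct; rewrite /= /gamma lexx => ct.
  exists (W1 `&` W2); split; first exact: openI.
    by split=> //; split=> //=; rewrite g2 // -(g1 h).
  apply: (@Ck_ext _ _ _ _ (fun t => chart_map c (gamma1 t) ord0 k + chart_map c (gamma2 t) ord0 k
     + - chart_map c x ord0 k)); first exact: openI.
    move=> s _ /=; case: (leP s h) => sh; first by rewrite (g2 s) // addrK.
    by rewrite (g1 s (ltW sh)) addrC addrA addNr add0r.
  have oW : open (W1 `&` W2) by exact: openI.
  apply: CkD => //; last exact: Ck_cst.
  apply: CkD => //.
    by apply: (@Ck_sub _ _ _ _ W1); [move=> s []|exact: s1].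
  by apply: (@Ck_sub _ _ _ _ W2); [move=> s []|exact: s2].
Unshelve. all: by end_near.
Qed.

Variable DT : vfield M -> vfield M -> vfield M.
Hypothesis DT_chart : forall c, atlas c -> exists Gam, torsion_chart DT c Gam.

(** The velocity, and with it the matrix of the transport equation, is multiplied by [r'], which may
    vanish, as it does at the junction of two paths. *)
Lemma parallel_at_comp I gamma Y (r : R -> R) t : curve_on I gamma -> smooth_on setT r -> I (r t) ->
  parallel_at DT gamma Y (r t) -> parallel_at DT (fun s => gamma (r s)) (fun s => Y (r s)) t.
Proof.
move=> cvg sr It [TY cY]; split=> //.
have [c ac ct] := atlas_cover (gamma (r t)).
have [Gam TG] := DT_chart ac.
have dg := curve_on_diff cvg It.
have [sol YE] := cov_deriv_solves ac ct TG dg cY.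
have dr : is_derive t 1 r ('D_1 r t).
  by apply: derivableP; apply: diff_derivable; exact: (smooth_on_diff sr).
have velE : vel c (fun s => gamma (r s)) t = 'D_1 r t *: vel c gamma (r t).
  apply/rowP => k; rewrite !mxE.
  have d1 : is_derive (r t) 1 (fun s => chart_map c (gamma s) ord0 k) ('D_1 (fun s => chart_map c (gamma s) ord0 k) (r t)).
    apply: derivableP; apply: diff_derivable.
    have [oI cg sg] := cvg.
    exact: (smooth_on_diff (sg c ac k)).
  by have [_ ->] := is_derive1_comp d1 dr; rewrite mulrC.
apply: (solves_cov_deriv (gamma := fun s => gamma (r s)) (eta := fun s => comp10 c (Y (r s))) ac ct TG).
- by apply: (@curve_on_diff _ _ _ (r @^-1` I)); [exact: curve_on_comp|].
- move=> k; have := is_cderive_comp1 dr (sol k).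
  rewrite (_ : _%:C * _ = (comp10 c (Y (r t)) *m transport_mx Gam c (fun s => gamma (r s)) t) ord0 k) //.
  rewrite /transport_mx velE (_ : rcx ('D_1 r t *: _) = ('D_1 r t)%:C *: rcx (vel c gamma (r t))); last first.
    by apply/rowP => j; rewrite !mxE rmorphM.
  by rewrite nabla_mxZ -scalerN -scalemxAr [RHS]mxE.
- have cr : {for t, continuous r} by exact: (sr 0%N t).
  exact: (cr _ YE).
Qed.

(** Where the pieces meet, the velocities add, hence so do the transport matrices; both solutions
    equal [v] there, so their equations add up to that of the glued field. *)
Lemma parallel_at_glue I1 I2 gamma1 gamma2 Y1 Y2 h x v : curve_on I1 gamma1 -> curve_on I2 gamma2 ->
  (forall t, h <= t -> gamma1 t = x) -> (forall t, t <= h -> gamma2 t = x) ->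
  (forall t, h <= t -> Y1 t = v) -> (forall t, t <= h -> Y2 t = v) ->
  forall t, I1 t -> I2 t -> (t <= h -> parallel_at DT gamma1 Y1 t) -> (h <= t -> parallel_at DT gamma2 Y2 t) ->
  parallel_at DT (fun t => if t <= h then gamma1 t else gamma2 t) (fun t => if t <= h then Y1 t else Y2 t) t.
Proof.
move=> cv1 cv2 g1 g2 y1 y2 t t1 t2 P1 P2.
set gamma := fun t => if _ then gamma1 t else _; set Y := fun t => _.
have [th|th|th] := ltgtP t h.
- apply: (parallel_at_near _ _ (P1 (ltW th))).
    by near=> s; rewrite /gamma ifT //; apply: ltW; near: s; exact: lt_nbhsl.
  by near=> s; rewrite /Y ifT //; apply: ltW; near: s; exact: lt_nbhsl.
- apply: (parallel_at_near _ _ (P2 (ltW th))).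
    by near=> s; rewrite /gamma ifF //; apply/negbTE; rewrite -ltNge; near: s; exact: lt_nbhsr.
  by near=> s; rewrite /Y ifF //; apply/negbTE; rewrite -ltNge; near: s; exact: lt_nbhsr.
subst t; have [T1 c1] := P1 (lexx h); have [T2 c2] := P2 (lexx h).
rewrite (g1 h (lexx h)) (y1 h (lexx h)) in T1.
have [c ac cx] := atlas_cover x.
have [Gam TG] := DT_chart ac.
have gh : gamma h = x by rewrite /gamma lexx g1.
have Yh : Y h = v by rewrite /Y lexx y1.
have d1 := curve_on_diff cv1 t1; have d2 := curve_on_diff cv2 t2.
have dg : curve_diff gamma h by apply: (curve_on_diff (curve_glue cv1 cv2 g1 g2)).
have [|sol1 E1] := cov_deriv_solves ac _ TG d1 c1; first by rewrite g1.
have [|sol2 E2] := cov_deriv_solves ac _ TG d2 c2; first by rewrite g2.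
split; first by rewrite gh Yh.
apply: (solves_cov_deriv (eta := fun s => comp10 c (Y s)) ac _ TG dg); first by rewrite gh.
- have velE : vel c gamma h = vel c gamma1 h + vel c gamma2 h.
    apply/rowP => k; rewrite !mxE.
    rewrite (_ : (fun s => chart_map c (gamma s) ord0 k) =
      fun s => chart_map c (gamma1 s) ord0 k + chart_map c (gamma2 s) ord0 k + - chart_map c x ord0 k); last first.
      apply/funext => s; rewrite /gamma; case: (leP s h) => sh; first by rewrite (g2 s) // addrK.
      by rewrite (g1 s (ltW sh)) addrC addrA addNr add0r.
    have e1 : derivable (fun s => chart_map c (gamma1 s) ord0 k) h 1.
      have [_ _ s1] := cv1; apply: diff_derivable; apply: (smooth_on_diff (s1 c ac k)).
      by split=> //=; rewrite g1.
    have e2 : derivable (fun s => chart_map c (gamma2 s) ord0 k) h 1.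
      have [_ _ s2] := cv2; apply: diff_derivable; apply: (smooth_on_diff (s2 c ac k)).
      by split=> //=; rewrite g2.
    rewrite deriveD ?derive_cst ?addr0; last 2 first.
    + by apply: derivableD.
    + exact: derivable_cst.
    by rewrite deriveD.
  have BE : transport_mx Gam c gamma h = transport_mx Gam c gamma1 h + transport_mx Gam c gamma2 h.
    rewrite /transport_mx gh g1 // g2 // velE -opprD -nabla_mxD; congr (- nabla_mx _ _).
    by apply/rowP => j; rewrite !mxE rmorphD.
  move=> k.
  have := is_cderiveD (is_cderiveD (sol1 k) (sol2 k)) (is_cderive_cst (- comp10 c v ord0 k) h 1).
  rewrite y1 // y2 // Yh BE mulmxDr addr0 [X in _ -> is_cderive _ _ _ X]mxE.
  rewrite [X in _ -> is_cderive X _ _ _](_ : _ = fun s => comp10 c (Y1 s) ord0 k + comp10 c (Y2 s) ord0 k +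
    - comp10 c v ord0 k) //.
  apply/funext => s; rewrite /Y; case: (leP s h) => sh; first by rewrite (y2 s) // addrK.
  by rewrite (y1 s (ltW sh)) addrC addrA addNr add0r.
- by apply: filterS (filterI E1 E2) => s [/= e1 e2]; rewrite /gamma /Y; case: ifP.
Unshelve. all: by end_near.
Qed.

(** Transport as a relation between vectors, with the path quantified away, so that concatenation
    becomes transitivity. *)
Definition transports x v y w := exists I gamma Y, [/\ curve_on I gamma, `[0, 1] `<=` I,
  gamma 0 = x /\ gamma 1 = y, Y 0 = v /\ Y 1 = w & forall t, 0 <= t <= 1 -> parallel_at DT gamma Y t].

Lemma transports_T10 x v y w : transports x v y w -> T10 x v /\ T10 y w.
Proof.
move=> [I [gamma [Y [_ _ [<- <-] [<- <-] P]]]].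
by split; [case: (P 0); rewrite ?lexx ?ler01|case: (P 1); rewrite ?lexx ?ler01].
Qed.

(** The first path is run up to time [2^-1] and then stays at [y], where the second has been
    waiting; the reparametrisations make both smooth. *)
Lemma transports_trans x v y w z u : transports x v y w -> transports y w z u -> transports x v z u.
Proof.
move=> [I1 [gamma1 [Y1 [cv1 II1 [g10 g11] [Y10 Y11] P1]]]].
move=> [I2 [gamma2 [Y2 [cv2 II2 [g20 g21] [Y20 Y21] P2]]]].
(* [ramp] is flat at 0, so [r2] starts flat at [2^-1], and its mirror image [r1] ends flat there. *)
pose r2 (t : R) := ramp (- 2^-1 + t * 1); pose r1 (t : R) := 1 + (-1) * ramp (2^-1 + t * (-1)).
have sr2 : smooth_on setT r2.
  move=> k; apply: (@Ck_comp1 R R k setT setT) => //; [exact: openT|exact: smooth_affine|].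
  exact: (ramp_smooth openT).
have sr1 : smooth_on setT r1.
  move=> k; apply: CkD; [exact: openT|exact: Ck_cst|]; apply: CkM; [exact: openT|exact: Ck_cst|].
  apply: (@Ck_comp1 R R k setT setT) => //; [exact: openT|exact: smooth_affine|].
  exact: (ramp_smooth openT).
have r1h t : 2^-1 <= t -> r1 t = 1.
  by move=> th; rewrite /r1 ramp_le0 ?mulr0 ?addr0 //; lra.
have r2h t : t <= 2^-1 -> r2 t = 0.
  by move=> th; rewrite /r2 ramp_le0 //; lra.
have r1i t : 0 <= t -> 0 <= r1 t <= 1.
  by move=> t0; rewrite /r1; have := @ramp_itv R (2^-1 + t * (-1)) ltac:(lra); lra.
have r2i t : t <= 1 -> 0 <= r2 t <= 1.
  by move=> t0; rewrite /r2; have := @ramp_itv R (- 2^-1 + t * 1) ltac:(lra); lra.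
have r10 : r1 0 = 0 by rewrite /r1 mul0r addr0 ramp_half; lra.
have r21 : r2 1 = 1.
  by rewrite /r2 (_ : _ + _ = 2^-1) ?ramp_half //; lra.
have cv1' := curve_on_comp sr1 cv1; have cv2' := curve_on_comp sr2 cv2.
have h1 : (1 <= 2^-1 :> R) = false by apply/negbTE; rewrite -ltNge; lra.
have h0 : 0 <= 2^-1 :> R by lra.
have II t : 0 <= t <= 1 -> I1 (r1 t) /\ I2 (r2 t).
  by move=> t01; split; [apply: II1|apply: II2]; rewrite /= in_itv /=; [apply: r1i|apply: r2i]; lra.
exists (r1 @^-1` I1 `&` r2 @^-1` I2), (fun t => if t <= 2^-1 then gamma1 (r1 t) else gamma2 (r2 t)),
  (fun t => if t <= 2^-1 then Y1 (r1 t) else Y2 (r2 t)).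
split.
- apply: (curve_glue (x := y) cv1' cv2').
    by move=> t th; rewrite r1h.
  by move=> t th; rewrite r2h.
- by move=> t; rewrite /= in_itv /= => t01; exact: II.
- by rewrite h0 h1 r10 r21.
- by rewrite h0 h1 r10 r21.
- move=> t t01; have [t1 t2] := II t t01.
  apply: (parallel_at_glue (I1 := r1 @^-1` I1) (I2 := r2 @^-1` I2) (gamma1 := fun t => gamma1 (r1 t))
    (gamma2 := fun t => gamma2 (r2 t)) (Y1 := fun t => Y1 (r1 t)) (Y2 := fun t => Y2 (r2 t)) (x := y) (v := w)
    cv1' cv2') => //.
  + by move=> s sh; rewrite r1h.
  + by move=> s sh; rewrite r2h.
  + by move=> s sh; rewrite r1h.
  + by move=> s sh; rewrite r2h.
  + by move=> th; apply: (parallel_at_comp cv1 sr1 t1); apply: P1; apply: r1i; lra.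
  + by move=> th; apply: (parallel_at_comp cv2 sr2 t2); apply: P2; apply: r2i; lra.
Qed.

Lemma transports_line c (p q : V) v : atlas c ->
  (forall t, 0 <= t <= 1 -> chart_image c (p + t *: (q - p))) -> T10 (chart_inv c p) v ->
  exists w, transports (chart_inv c p) v (chart_inv c q) w.
Proof.
move=> ac im Tv; have cvg := curve_line p (q - p) ac.
have [||Y Y0 P] := parallel_at_exists DT_chart cvg (v := v).
- by move=> t; rewrite /= in_itv /=; exact: im.
- by rewrite scale0r addr0.
exists (Y 1), [set t | chart_image c (p + t *: (q - p))], (fun t => chart_inv c (p + t *: (q - p))), Y.
split=> //.
by rewrite scale0r addr0 scale1r addrC subrK.
Qed.

Lemma chart_ball c x : atlas c -> chart_dom c x -> exists2 e : R, 0 < e &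
  forall p, `|p - chart_map c x| < e -> chart_image c p.
Proof.
move=> ac cx; have : nbhs (chart_map c x) (chart_image c).
  by apply: open_nbhs_nbhs; split; [exact: chart_image_open|exists x].
move=> /nbhs_ballP[e /= e0 He]; exists e => // p pe; apply: He.
by rewrite -ball_normE /ball_ /= distrC.
Qed.

Lemma segment_ball (o p q : V) (e t : R) : `|p - o| < e -> `|q - o| < e -> 0 <= t <= 1 ->
  `|p + t *: (q - p) - o| < e.
Proof.
move=> pe qe /andP[t0 t1].
have -> : p + t *: (q - p) - o = (1 - t) *: (p - o) + t *: (q - o).
  by apply/rowP => k; rewrite !mxE; ring.
apply: le_lt_trans (ler_normD _ _) _; rewrite !normrZ (ger0_norm t0) ger0_norm ?subr_ge0 //.
have [t00|t00] := eqVneq t 0; first by rewrite t00 subr0 mul1r mul0r addr0.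
have tp : 0 < t by rewrite lt_neqAle eq_sym t00.
have : t * `|q - o| < t * e by rewrite ltr_pM2l.
have : (1 - t) * `|p - o| <= (1 - t) * e by rewrite ler_wpM2l ?subr_ge0 // ltW.
by move: (_ * `|_|) (_ * `|_|) => a b; lra.
Qed.

(** Points of a coordinate ball are joined by segments in the chart, so reachability passes between
    nearby points. *)
Lemma transports_exists x v y : connected [set: M] -> T10 x v -> exists w, transports x v y w.
Proof.
move=> cM Tv.
apply: (@connected_induction M setT (fun y => exists w, transports x v y w) x) => //.
- have [c ac cx] := atlas_cover x.
  have [||w] := @transports_line c (chart_map c x) (chart_map c x) v ac.
  + by move=> t _; rewrite subrr scaler0 addr0; exists x.
  + by rewrite chart_mapK.
  by rewrite chart_mapK //; exists w.
- move=> z _; have [c ac cz] := atlas_cover z.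
  have [e e0 He] := chart_ball ac cz.
  exists (chart_dom c `&` chart_map c @^-1` [set p | `|p - chart_map c z| < e]); split.
  + rewrite openE => a [ca /= ae]; apply: filterI.
      by apply: open_nbhs_nbhs; split=> //; exact: chart_open.
    apply: (chart_map_continuous ac ca); apply: (@open_nbhs_nbhs _ _ [set p | `|p - chart_map c z| < e]); split=> //.
    have -> : [set p | `|p - chart_map c z| < e] = ball (chart_map c z) e.
      by rewrite -ball_normE; apply/funext => p; rewrite /ball_ /= distrC.
    exact: ball_open.
  + by split=> //=; rewrite subrr normr0.
  + move=> a b _ _ [ca /= ae] [cb /= be] [w aw].
    have [||u au] := @transports_line c (chart_map c a) (chart_map c b) w ac.
    * by move=> t t01; apply: He; exact: segment_ball.
    * by rewrite chart_mapK //; case: (transports_T10 aw).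
    by exists u; apply: transports_trans aw _; rewrite !chart_mapK // in au.
Qed.

(** An element of [holonomy] is a map on all vectors, while the hypothesis transports a single one.
    Transporting every vector along the loop and choosing the results gives such a map, and
    uniqueness identifies its value at [v] with [w]. *)
Lemma transports_fixed x v w : hol_fixed DT x v -> transports x v x w -> w = v.
Proof.
move=> [Tv fv] [I [gamma [Y [cvg II [g0 g1] [Y0 Y1] P]]]].
have pt u : exists w, T10 x u -> parallel_transport DT gamma u w.
  have [Tu|nTu] := pselect (T10 x u); last by exists 0.
  have [|Z Z0 PZ] := parallel_at_exists DT_chart cvg II (v := u); first by rewrite g0.
  by exists (Z 1) => _; exists Z; split=> // t t01; case: (PZ t t01).
have /choice[h Hh] := pt.
have loop : smooth_loop x gamma.
  by split=> //; have [oI cg sg] := cvg; exists I.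
have hv := fv h (holonomy_loop loop Hh).
have [Z [Z0 Z1 TZ cZ]] := Hh v Tv.
rewrite -hv -Z1 -Y1; apply: (parallel_at_unique DT_chart cvg II P) => //; last by rewrite lexx ler01.
  by move=> t t01; split; [exact: TZ|exact: cZ].
by rewrite Y0 Z0.
Qed.

(** The first path followed by the reverse of the second is a loop, which fixes [v]. So transport of
    [w] back along the second path ends at [v]; read forwards it carries [v] to [w], and uniqueness
    along that path gives [w = w']. *)
Lemma transports_unique x v y w w' : hol_fixed DT x v -> transports x v y w -> transports x v y w' ->
  w = w'.
Proof.
move=> fv xw [I [gamma [Y [cvg II [g0 g1] [Y0 Y1] P]]]].
pose r (t : R) : R := 1 + t * (-1).
have sr : smooth_on setT r by exact: smooth_affine.
have rr t : r (r t) = t by rewrite /r; ring.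
have r0 : r 0 = 1 by rewrite /r; ring.
have r1 : r 1 = 0 by rewrite /r; ring.
have r01 t : 0 <= t <= 1 -> 0 <= r t <= 1 by rewrite /r; lra.
have cvr := curve_on_comp sr cvg.
have IIr : `[0, 1] `<=` r @^-1` I.
  by move=> t; rewrite /= in_itv /= => t01; apply: II; rewrite /= in_itv /=; exact: r01.
have [|Z Z0 PZ] := parallel_at_exists DT_chart cvr IIr (v := w).
  by rewrite r0 g1; case: (transports_T10 xw).
have yv : transports y w x (Z 1).
  exists (r @^-1` I), (fun t => gamma (r t)), Z; split=> //; by rewrite r0 r1.
have Z1 := transports_fixed fv (transports_trans xw yv).
have PZr t : 0 <= t <= 1 -> parallel_at DT gamma (fun s => Z (r s)) t.
  move=> t01; have := parallel_at_comp cvr sr _ (PZ (r t) (r01 t t01)).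
  rewrite /= (_ : (fun s => gamma (r (r s))) = gamma); last by apply/funext => s; rewrite rr.
  by apply; rewrite /= rr; apply: II; rewrite /= in_itv.
have := parallel_at_unique DT_chart cvg II P PZr.
rewrite Y0 r0 Z1 => /(_ erefl 1); rewrite r1 Z0 lexx ler01 Y1 => -> //.
Qed.

End Paths.

(** * Parallel sections *)

Section Lines.
Context {R : realType} {V : normedModType R}.

Lemma is_derive_line (F : V -> R) (a w : V) (t d : R) :
  is_derive t 1 (fun s => F (a + s *: w)) d <-> is_derive (a + t *: w) w F d.
Proof.
have E : (fun h : R => h^-1 *: (((fun s => F (a + s *: w)) \o shift t) (h *: 1) - F (a + t *: w))) =
  (fun h : R => h^-1 *: ((F \o shift (a + t *: w)) (h *: w) - F (a + t *: w))).
  apply/funext => h /=; congr (_ *: (F _ - _)).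
  by rewrite [h *: 1]mulr1 scalerDl addrCA.
by split=> -[d1 d2]; split; move: d1 d2; rewrite /derivable /derive E.
Qed.

Lemma is_cderive_line (F : V -> R[i]) (a w : V) (t : R) d :
  is_cderive (fun s : R => F (a + s *: w)) t 1 d <-> is_cderive F (a + t *: w) w d.
Proof.
split=> /is_cderiveP[d1 d2]; apply/is_cderiveP.
  by split; [exact: (is_derive_line (fun q => complex.Re (F q)) _ _ _ _).1 d1|
             exact: (is_derive_line (fun q => complex.Im (F q)) _ _ _ _).1 d2].
by split; [exact: (is_derive_line (fun q => complex.Re (F q)) _ _ _ _).2 d1|
           exact: (is_derive_line (fun q => complex.Im (F q)) _ _ _ _).2 d2].
Qed.

End Lines.

(** * Differentiability from continuous partial derivatives *)

Section PartialDerivatives.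
Context {R : realType} {m : nat}.
Local Notation V := 'rV[R]_m.
Implicit Types (f : V -> R) (p q w : V) (U : set V).

Lemma row_entry_norm (h : V) k : `|h ord0 k| <= `|h|.
Proof.
rewrite [X in _ <= X]/Num.norm /= mx_normrE.
exact: (le_bigmax _ (fun ij : 'I_1 * 'I_m => `|h ij.1 ij.2|) (ord0, k)).
Qed.

(** After subtracting the linear function with coefficients [L k p], the derivatives vanish at [p]
    and are small nearby; the mean value theorem on segments then bounds the increments of [g]. *)
Lemma continuous_partials f (L : 'I_m -> V -> R) U p : open U -> U p ->
  (forall q w, U q -> is_derive q w f (\sum_k w ord0 k * L k q)) ->
  (forall k, {for p, continuous (L k)}) -> differentiable f p.
Proof.
move=> oU Up df cL.
have dl k : differentiable (fun q : V => L k p * q ord0 k) p.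
  apply: differentiableM; first exact: differentiable_cst.
  exact: (smooth_on_diff (@smooth_coordinate R m setT k)).
pose g q := f q - \sum_k L k p * q ord0 k.
have dg q w : U q -> is_derive q w g (\sum_k w ord0 k * (L k q - L k p)).
  move=> Uq.
  have dk k : is_derive q w (fun q : V => L k p * q ord0 k) (L k p * w ord0 k).
    have dc : is_derive q w (fun q : V => q ord0 k) (w ord0 k).
      have := (is_derive_line (fun q : V => q ord0 k) q w 0 (w ord0 k)).1.
      rewrite scale0r addr0; apply.
      rewrite (_ : (fun s : R => _) = fun s => q ord0 k + s * w ord0 k); first exact: is_derive_affine.
      by apply/funext => s; rewrite !mxE.
    apply: is_derive_eq (is_deriveM (is_derive_cst (L k p) q w) dc) _.
    by rewrite scaler0 addr0.
  have ds : is_derive q w (fun q : V => \sum_k L k p * q ord0 k) (\sum_k L k p * w ord0 k).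
    rewrite (_ : (fun q => _) = \sum_k (fun q : V => L k p * q ord0 k)).
      exact: is_derive_sum.
    by apply/funext => z; rewrite fct_sumE.
  apply: is_derive_eq (is_deriveB (df q w Uq) ds) _.
  by rewrite -sumrB; apply: eq_bigr => k _; rewrite mulrBr [w _ _ * L k p]mulrC.
suff dgp : differentiable g p.
  rewrite (_ : f = fun q => g q + \sum_k L k p * q ord0 k).
    apply: differentiableD => //.
    rewrite (_ : (fun q => _) = \sum_k (fun q : V => L k p * q ord0 k)).
      by apply: differentiable_sum => k; exact: dl.
    by apply/funext => z; rewrite fct_sumE.
  by apply/funext => q; rewrite subrK.
pose Z := 'd (cst (0 : R) : V -> R) p.
have ZE h : Z h = 0 by rewrite /Z diff_cst.
have [||//] := @differentiable_intro R V g Z p.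
  by apply: diff_continuous; exact: differentiable_cst.
move=> e e0.
pose e' := e / (m%:R + 1).
have m0 : 0 < m%:R + 1 :> R by rewrite ltr_wpDl.
have e'0 : 0 < e' by rewrite divr_gt0.
have /nbhs_ballP[d /= d0 Hd] : \forall q \near p, U q /\ forall k, `|L k p - L k q| < e'.
  apply: filterI; first exact: open_nbhs_nbhs.
  have Lk k : \forall q \near p, `|L k p - L k q| < e'.
    by have /cvgrPdist_lt/(_ e' e'0) := cL k.
  exact: (@filter_forall _ _ _ _ _ Lk).
apply/nbhs_ballP; exists d => //= h; rewrite -ball_normE /ball_ /= sub0r normrN => hd.
rewrite ZE subr0.
have Ht t : 0 <= t <= 1 -> U (p + t *: h) /\ forall k, `|L k p - L k (p + t *: h)| < e'.
  move=> t01; apply: Hd; rewrite -ball_normE /ball_ /= opprD addrA subrr sub0r normrN normrZ.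
  apply: le_lt_trans hd; rewrite ger0_norm; last by lra.
  by rewrite ler_piMl //; lra.
have B t : 0 <= t <= 1 -> `|\sum_k h ord0 k * (L k (p + t *: h) - L k p)| <= e * `|h|.
  move=> t01; apply: le_trans (ler_norm_sum _ _ _) _.
  apply: (@le_trans _ _ (\sum_(k < m) `|h| * e')).
    apply: ler_sum => k _; rewrite normrM ler_pM // ?row_entry_norm // distrC.
    by apply: ltW; exact: (Ht t t01).2.
  rewrite sumr_const card_ord -mulr_natr -mulrA mulrC ler_wpM2r //.
  by rewrite /e' mulrAC -mulrA ler_piMr ?(ltW e0) // ler_pdivrMr // mul1r lerDl.
have := @mean_value_bound R (fun t => g (p + t *: h)) (fun t => \sum_k h ord0 k * (L k (p + t *: h) - L k p))
  0 1 (e * `|h|) 0 1.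
rewrite scale0r addr0 scale1r subr0 normr1 mulr1 [h + p]addrC; apply=> //; try by rewrite ?lexx ?ler01.
by move=> t t01; apply/is_derive_line; apply: dg; exact: (Ht t t01).1.
Qed.

End PartialDerivatives.

Section Integrability.
Context {R : realType} {m n : nat}.
Local Notation C := R[i].
Local Notation V := 'rV[R]_m.
Implicit Types (eta : V -> 'rV[C]_n) (A : V -> 'I_m -> 'M[C]_n).

(* Gronwall along lines makes [eta] continuous, so its partial derivatives [eta A_a] are
   continuous; then the equation bootstraps. *)
Lemma total_ode_smooth U eta A : open U ->
  (forall a j k, csmooth_on U (fun q => A q a j k)) ->
  (forall q w k, U q -> is_cderive (fun q => eta q ord0 k) q w
     ((eta q *m \sum_a (w ord0 a)%:C *: A q a) ord0 k)) ->
  forall k, csmooth_on U (fun q => eta q ord0 k).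
Proof.
move=> oU sA deta.
have cA a j k p : U p -> {for p, continuous (fun q => complex.Re (A q a j k))} /\
    {for p, continuous (fun q => complex.Im (A q a j k))}.
  by move=> Up; have [/(_ 0%N) h1 /(_ 0%N) h2] := sA a j k; split; [exact: h1|exact: h2].
have ceta p i : U p -> {for p, continuous (fun q => part i (eta q))}.
  move=> Up.
  pose f (x : 'I_m * 'I_n * 'I_n * bool) q := if x.2 then complex.Re (A q x.1.1.1 x.1.1.2 x.1.2)
    else complex.Im (A q x.1.1.1 x.1.1.2 x.1.2).
  have cf x : {for p, continuous (f x)}.
    by case: x => -[[a j] k] []; [exact: (cA a j k p Up).1|exact: (cA a j k p Up).2].
  have [K K0 BK] := near_bounded cf.
  have /nbhs_ballP[d /= d0 Hd] : \forall q \near p, U q /\ forall x, `|f x q| <= K.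
    by apply: filterI BK; exact: open_nbhs_nbhs.
  (* Along the direction [w] the matrix of the equation is [sum_a w_a A_a], with parts of entries at
     most [m K |w|]. *)
  pose Q := m%:R * K; have Q0 : 0 <= Q by rewrite mulr_ge0.
  pose L := Q * #|{: bool * 'I_n}|%:R; have L0 : 0 <= L by rewrite mulr_ge0.
  pose S := Q * (2 * norm1 (eta p)).
  have S0 : 0 <= S by rewrite mulr_ge0 // mulr_ge0 // /norm1 sumr_ge0.
  suff : part i (eta q) @[q --> p] --> part i (eta p) by [].
  apply/(@cvgrPdist_lt R R^o V (nbhs p) (nbhs_filter p) (fun q => part i (eta q))) => e e0.
  (* The first quotient makes the parameter interval [[0, 1]] short enough for Gronwall, the second
     makes the Lipschitz bound [S |w|] smaller than [e]. *)
  pose r := Num.min d (Num.min (2^-1 / (L + 1)) (e / (S + 1))).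
  have r0 : 0 < r by rewrite !lt_min d0 !divr_gt0 //; lra.
  apply/nbhs_ballP; exists r => //= q; rewrite -ball_normE /ball_ /= distrC => qp.
  have [qd qL qS] : [/\ `|q - p| < d, `|q - p| < 2^-1 / (L + 1) & `|q - p| < e / (S + 1)].
    by move: qp; rewrite !lt_min => /and3P[].
  set w := q - p in qp qd qL qS *.
  have Ht t : 0 <= t <= 1 -> U (p + t *: w) /\ forall x, `|f x (p + t *: w)| <= K.
    move=> t01; apply: Hd; rewrite -ball_normE /ball_ /= opprD addrA subrr sub0r normrN normrZ.
    apply: le_lt_trans qd; rewrite ger0_norm; last by lra.
    by rewrite ler_piMl //; lra.
  pose B t := \sum_a (w ord0 a)%:C *: A (p + t *: w) a.
  have sol t : 0 <= t <= 1 -> solves_at (fun t => eta (p + t *: w)) B t.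
    move=> t01 k; apply/(is_cderive_line (fun q => eta q ord0 k)).
    exact: deta (Ht t t01).1.
  have BB t j k : 0 <= t <= 1 ->
      `|complex.Re (B t j k)| <= Q * `|w| /\ `|complex.Im (B t j k)| <= Q * `|w|.
    move=> t01.
    have E : Q * `|w| = \sum_(a < m) `|w| * K.
      by rewrite sumr_const card_ord -mulr_natl /Q; ring.
    have BE : B t j k = \sum_a (w ord0 a)%:C * A (p + t *: w) a j k.
      by rewrite summxE; apply: eq_bigr => a _; rewrite mxE.
    rewrite BE cRe_sum cIm_sum E; split; apply: le_trans (ler_norm_sum _ _ _) _; apply: ler_sum => a _.
      rewrite cReM /= mul0r subr0 normrM ler_pM // ?row_entry_norm //.
      exact: (Ht t t01).2 (a, j, k, true).
    rewrite cImM /= mul0r addr0 normrM ler_pM // ?row_entry_norm //.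
    exact: (Ht t t01).2 (a, j, k, false).
  have i01 : 0 <= (0 : R) <= 1 by rewrite lexx ler01.
  have i11 : 0 <= (1 : R) <= 1 by rewrite lexx ler01.
  have QW0 : 0 <= Q * `|w| by rewrite mulr_ge0.
  have small : (1 - 0) * (Q * `|w|) * #|{: bool * 'I_n}|%:R <= 2^-1.
    rewrite subr0 mul1r mulrAC -/L; apply: (@le_trans _ _ ((L + 1) * `|w|)).
      by rewrite ler_wpM2r //; lra.
    by rewrite mulrC -ler_pdivlMr ?(ltW qL) //; lra.
  have [_ /(_ i 1 i11)] := gronwall_complex QW0 i01 small sol BB.
  rewrite /= scale1r scale0r addr0 subr0 normr1 mulr1 distrC /w [p + _]addrC subrK => H.
  apply: le_lt_trans H _; rewrite mulrAC -/S.
  apply: (@le_lt_trans _ _ ((S + 1) * `|w|)); first by rewrite ler_wpM2r //; lra.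
  by rewrite mulrC -ltr_pdivlMr //; lra.
pose L (i : bool * 'I_n) a q := part i (eta q *m A q a).
have dpart q w i : U q -> is_derive q w (fun q => part i (eta q)) (\sum_a w ord0 a * L i a q).
  move=> Uq; have /is_cderiveP := deta q w i.2 Uq.
  have -> : (eta q *m \sum_a (w ord0 a)%:C *: A q a) ord0 i.2 = \sum_a (w ord0 a)%:C * (eta q *m A q a) ord0 i.2.
    by rewrite mulmx_sumr summxE; apply: eq_bigr => a _; rewrite -scalemxAr mxE.
  rewrite cRe_sum cIm_sum; case: i => -[] k [h1 h2].
    by apply: is_derive_eq h1 _; apply: eq_bigr => a _; rewrite cReM /= mul0r subr0.
  by apply: is_derive_eq h2 _; apply: eq_bigr => a _; rewrite cImM /= mul0r addr0.
have LC l i a : (forall i, Ck l U (fun q => part i (eta q))) -> Ck l U (L i a).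
  move=> H; have CA j k : Ck l U (fun q => complex.Re (A q a j k)) /\ Ck l U (fun q => complex.Im (A q a j k)).
    by have [h1 h2] := sA a j k; split; [exact: h1|exact: h2].
  case: i => -[] k.
    rewrite (_ : L _ _ = fun q => \sum_j (part (true, j) (eta q) * complex.Re (A q a j k) +
        - (part (false, j) (eta q) * complex.Im (A q a j k)))); last first.
      by apply/funext => q; rewrite /L /part /= mxE cRe_sum; apply: eq_bigr => j _; rewrite cReM.
    apply: Ck_sum => // j; apply: CkD => //; last apply: Ck_opp => //.
      by apply: CkM => //; exact: (CA j k).1.
    by apply: CkM => //; exact: (CA j k).2.
  rewrite (_ : L _ _ = fun q => \sum_j (part (true, j) (eta q) * complex.Im (A q a j k) +
      part (false, j) (eta q) * complex.Re (A q a j k))); last first.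
    by apply/funext => q; rewrite /L /part /= mxE cIm_sum; apply: eq_bigr => j _; rewrite cImM.
  apply: Ck_sum => // j; apply: CkD => //.
    by apply: CkM => //; exact: (CA j k).2.
  by apply: CkM => //; exact: (CA j k).1.
have C0 i : Ck 0 U (fun q => part i (eta q)) by move=> p Up; exact: ceta.
have dd i p : U p -> differentiable (fun q => part i (eta q)) p.
  move=> Up; apply: (continuous_partials oU Up (fun q w Uq => dpart q w i Uq)) => a.
  exact: (LC 0%N i a C0).
have CC l i : Ck l U (fun q => part i (eta q)).
  elim: l i => [|l IH] i; first exact: C0.
  split=> [p|w]; first exact: dd.
  apply: (@Ck_ext _ _ _ _ (fun q => \sum_a w ord0 a * L i a q)) => //.
    by move=> q Uq; have [_ ->] := dpart q w i Uq.
  apply: Ck_sum => // a; apply: CkM => //; first exact: Ck_cst.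
  exact: LC.
by move=> k; split=> l; [exact: (CC l (true, k))|exact: (CC l (false, k))].
Qed.

End Integrability.

(** * Global parallel sections *)

Section ParallelFields.
Context {R : realType} {n : nat} {M : complexManifold R n}.
Local Notation C := R[i].
Local Notation N := (n + n)%N.
Local Notation V := 'rV[R]_N.
Implicit Types (c : chart R n M) (U W : set M) (f : M -> C) (x y z : M) (gamma : R -> M).
Implicit Types (Y : R -> tvec M) (s t : R) (I : set R) (v w : tvec M) (xi : vfield M).

Variable DT : vfield M -> vfield M -> vfield M.
Hypothesis DT_chart : forall c, atlas c -> exists Gam, torsion_chart DT c Gam.

(** Compatibility with transport along every path, without any regularity. A field built by
    transporting a fixed vector has this property; it is shown below to be equivalent to
    [parallel_field]. *)
Definition invariant_field xi := (forall x, T10 x (xi x)) /\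
  (forall y z w, transports DT y (xi y) z w -> w = xi z).

Definition parallel_field xi := section10 setT xi /\ parallel_section DT xi.

Lemma nabla_mx_delta (Gam : 'I_n -> 'M[C]_n) (u : 'rV[C]_N) :
  nabla_mx Gam u = \sum_a u ord0 a *: nabla_mx Gam (delta_mx ord0 a).
Proof.
rewrite {1}[u]row_sum_delta.
have nabla_mx0 : nabla_mx Gam 0 = 0.
  by have := nabla_mxZ Gam 0 0; rewrite !scale0r.
rewrite (@big_morph _ _ (nabla_mx Gam) 0 +%R 0 +%R (nabla_mxD Gam) nabla_mx0).
by apply: eq_bigr => a _; rewrite nabla_mxZ.
Qed.

Lemma parallel_field_chart xi c Gam : atlas c -> torsion_chart DT c Gam -> parallel_field xi ->
  exists p : M -> 'rV[C]_n, [/\ smooth_row (chart_dom c) p,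
    forall x, chart_dom c x -> xi x = vec10 c x (p x) &
    forall x u, chart_dom c x -> nabla c Gam p x u = 0].
Proof.
move=> ac [Gs HDT _] [sxi pxi].
have oc := chart_open ac.
have [p [sp pE]] := section10_chart ac (@subset_refl _ _) (section10_sub (@subsetT _ _) sxi).
exists p; split=> // x u cx.
have su k : smooth_fun (chart_dom c) (fun y : M => u ord0 k) by exact: smooth_fun_cst.
have := HDT (chart_dom c) (fun y => chart_vec c y u) xi (fun=> u) p x oc (@subset_refl _ _) cx su sp
  (fun _ _ => erefl) pE.
rewrite (pxi (chart_dom c)) //; last first.
  exact: (csection_intro (u := fun=> u) ac oc (@subset_refl _ _) su (fun _ _ => erefl)).
move=> /esym H; have := comp10K (nabla c Gam p x u) ac cx; rewrite H => <-.
by apply/rowP => k; rewrite !mxE.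
Qed.

Lemma parallel_field_intro xi : (forall c, atlas c -> exists Gam (p : M -> 'rV[C]_n),
    [/\ torsion_chart DT c Gam, smooth_row (chart_dom c) p,
    forall x, chart_dom c x -> xi x = vec10 c x (p x) &
    forall x u, chart_dom c x -> nabla c Gam p x u = 0]) -> parallel_field xi.
Proof.
move=> H; split.
- split=> [c ac|x _].
    have [Gam [p [_ sp pE _]]] := H c ac.
    have [/(_ c ac)[u [su uE]] _] := section10_intro ac (chart_open ac) (@subset_refl _ _) sp pE.
    exists u; split=> [k|x _ cx]; last exact: uE.
    by apply: smooth_fun_sub (su k) => z [].
  have [c ac cx] := atlas_cover x; have [Gam [p [_ _ pE _]]] := H c ac.
  by rewrite pE //; exact: T10_vec10.
move=> U X x oU Ux sX.
have [c ac cx] := atlas_cover x; have [Gam [p [[Gs HDT _] sp pE np]]] := H c ac.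
pose W := U `&` chart_dom c.
have oW : open W by apply: openI => //; exact: chart_open.
have Wc : W `<=` chart_dom c by move=> z [].
have WU : W `<=` U by move=> z [].
have [u [su uE]] := csection_chart ac Wc (csection_sub WU sX).
have := HDT W X xi u p x oW Wc (conj Ux cx) su (fun k => smooth_fun_sub Wc (sp k)) uE (fun y Wy => pE y (Wc y Wy)).
rewrite np // => ->.
by have := vec10Z c x 0 0; rewrite !scale0r.
Qed.

Lemma parallel_field_invariant xi : parallel_field xi -> invariant_field xi.
Proof.
move=> [[cxi Txi] pxi]; split=> [x|y z w]; first exact: Txi.
move=> [I [gamma [Y [cvg II [g0 g1] [Y0 Y1] P]]]].
have Q t : 0 <= t <= 1 -> parallel_at DT gamma (fun s => xi (gamma s)) t.
  move=> t01; split; first exact: Txi.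
  have It : I t by apply: II; rewrite /= in_itv.
  have [c ac ct] := atlas_cover (gamma t).
  have oc := chart_open ac.
  set v := vel c gamma t.
  have sX : rsection (chart_dom c) (fun x => chart_vec c x (rcx v)).
    by apply: (@rsection_intro _ _ _ c _ _ (fun=> v)) => // k; exact: smooth_fun_cst.
  (* The restriction of [xi] to the curve is expressed by the single field [xi] with coefficient
     1. *)
  exists (chart_dom c), (fun x => chart_vec c x (rcx v)), 1%N, (fun=> xi), (fun _ _ => 1).
  split=> //.
  - by split=> //; rewrite (velocity_chart ac ct (curve_on_diff cvg It)).
  - move=> _; split; first exact: section10_sub (@subsetT _ _) (conj cxi Txi).
    by case: (is_cderive_cst (1 : C) t 1).
  - by apply: filterE => s; rewrite big_ord1 scale1r.
  - rewrite big_ord1 (is_cderive_cst (1 : C) t 1).2 scale0r add0r scale1r.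
    by apply/esym; apply: (pxi (chart_dom c)) => //; case: sX.
have := parallel_at_unique DT_chart cvg II P Q; rewrite Y0 g0 => /(_ erefl 1).
by rewrite Y1 g1 lexx ler01; apply.
Qed.

(** Along a coordinate line, transport of a value of the field reproduces the field by invariance,
    so the field inherits the transport equation, which at [p] is a derivative in the direction
    [w]. *)
Lemma invariant_field_ode xi c Gam (p w : V) k : invariant_field xi -> atlas c -> torsion_chart DT c Gam ->
  chart_image c p ->
  is_cderive (fun q => comp10 c (xi (chart_inv c q)) ord0 k) p w
    (- (comp10 c (xi (chart_inv c p)) *m nabla_mx (Gam (chart_inv c p)) (rcx w)) ord0 k).
Proof.
move=> [Txi inv] ac TG im.
have [cp mp] := chart_invK ac im.
have [e e0 He] := chart_ball ac cp; rewrite mp in He.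
pose d : R := e / (2 * (`|w| + 1)).
have w0 : 0 < `|w| + 1 by rewrite ltr_wpDl.
have d0 : 0 < d by rewrite divr_gt0 // mulr_gt0.
have dw : d * `|w| < e.
  rewrite /d mulrAC ltr_pdivrMr ?mulr_gt0 // ltr_pM2l //.
  by have := normr_ge0 w; lra.
(* The segment from [p - d w] to [p + d w] has [p] at parameter [2^-1], in its interior, so the
   derivative obtained is two-sided. *)
pose a : V := p - d *: w; pose u : V := (2 * d) *: w.
have half : a + 2^-1 *: u = p.
  by rewrite /a /u scalerA mulrA mulVf ?mul1r ?subrK // pnatr_eq0.
have imt t : 0 <= t <= 1 -> chart_image c (a + t *: u).
  move=> t01; apply: He.
  have -> : a + t *: u - p = (2 * t - 1) * d *: w.
    by apply/rowP => j; rewrite !mxE; ring.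
  rewrite normrZ normrM (gtr0_norm d0); apply: le_lt_trans dw.
  have t1 : `|2 * t - 1| <= 1 by rewrite ler_norml; lra.
  by rewrite -mulrA ler_piMl // mulr_ge0 // ltW.
have cvg := curve_line a u ac.
set gamma := fun t : R => chart_inv c (a + t *: u) in cvg.
have II : `[0, 1] `<=` [set t | chart_image c (a + t *: u)].
  by move=> t; rewrite /= in_itv /=; exact: imt.
have [Y Y0 P] := parallel_at_exists DT_chart cvg II (Txi (gamma 0)).
(* Invariance speaks of paths over [[0, 1]]; the line up to time [t] is made into one by
   [s -> s t]. *)
have YE t : 0 <= t <= 1 -> Y t = xi (gamma t).
  move=> t01; apply: (inv (gamma 0)).
  have sr : smooth_on setT (fun s : R => 0 + s * t) by exact: smooth_affine.
  have r01 s : 0 <= s <= 1 -> 0 <= 0 + s * t <= 1.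
    by move=> s01; rewrite add0r mulr_ge0 ?mulr_ile1 //=; lra.
  exists ((fun s : R => 0 + s * t) @^-1` [set t | chart_image c (a + t *: u)]),
    (fun s => gamma (0 + s * t)), (fun s => Y (0 + s * t)); split.
  - exact: curve_on_comp.
  - by move=> s; rewrite /= in_itv /= => s01; apply: imt; exact: r01.
  - by rewrite mul0r mul1r !add0r.
  - by rewrite mul0r mul1r !add0r.
  - move=> s s01; apply: (parallel_at_comp DT_chart (r := fun s => 0 + s * t) cvg sr); last by apply: P; exact: r01.
    by apply: imt; exact: r01.
have h01 : 0 <= (2^-1 : R) <= 1 by lra.
have gh : gamma 2^-1 = chart_inv c p by rewrite /gamma half.
have ch : chart_dom c (gamma 2^-1) by rewrite gh.
have dg := curve_on_diff cvg (imt _ h01).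
have [sol _] := cov_deriv_solves ac ch TG dg (P _ h01).2.
have velE : vel c gamma 2^-1 = u.
  apply/rowP => j; rewrite mxE.
  transitivity ('D_1 (fun s : R => a ord0 j + s * u ord0 j) 2^-1).
    apply: near_eq_derive; apply/nbhs_ballP; exists 2^-1 => /=; first by lra.
    move=> s; rewrite /ball /= ltr_distl => sh.
    have si : chart_image c (a + s *: u) by apply: imt; lra.
    by have [_ ->] := chart_invK ac si; rewrite !mxE.
  by have [_ ->] := is_derive_affine (a ord0 j) (u ord0 j) 2^-1.
pose F q := comp10 c (xi (chart_inv c q)) ord0 k.
have D1 : is_cderive (fun s : R => F (a + s *: u)) 2^-1 1
    (- (2 * d)%:C * (comp10 c (xi (chart_inv c p)) *m nabla_mx (Gam (chart_inv c p)) (rcx w)) ord0 k).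
  have := sol k; rewrite YE // gh /transport_mx velE gh (_ : rcx u = (2 * d)%:C *: rcx w); last first.
    by apply/rowP => j; rewrite !mxE rmorphM.
  rewrite nabla_mxZ -scalerN -scalemxAr [X in is_cderive _ _ _ X]mxE mulmxN [X in is_cderive _ _ _ (_ * X)]mxE mulrN -mulNr.
  apply: is_cderive_near; apply/nbhs_ballP; exists 2^-1 => /=; first by lra.
  by move=> s; rewrite /ball /= ltr_distl => sh; rewrite YE //; lra.
(* The affine change [s -> 2^-1 + s / (2 d)] turns the derivative along [u] at parameter [2^-1] into
   the one along [w] at [p]. *)
have r0 := is_derive_affine (2^-1 : R) (2 * d)^-1 0.
have D2 := is_cderive_comp1 (f := fun s : R => F (a + s *: u)) r0.
rewrite mul0r addr0 in D2; have {}D2 := D2 _ D1.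
have dd : 2 * d != 0 by rewrite mulf_neq0 ?pnatr_eq0 // gt_eqF.
have E : ((2 * d)^-1)%:C * (- (2 * d)%:C * (comp10 c (xi (chart_inv c p)) *m
    nabla_mx (Gam (chart_inv c p)) (rcx w)) ord0 k) =
    - (comp10 c (xi (chart_inv c p)) *m nabla_mx (Gam (chart_inv c p)) (rcx w)) ord0 k.
  by rewrite mulrA mulrN -rmorphM mulVf // rmorph1 mulN1r.
rewrite E in D2.
have D3 : is_cderive (fun s : R => F (p + s *: w)) 0 1
    (- (comp10 c (xi (chart_inv c p)) *m nabla_mx (Gam (chart_inv c p)) (rcx w)) ord0 k).
  rewrite (_ : (fun s : R => F (p + s *: w)) = fun s : R => F (a + (2^-1 + s * (2 * d)^-1) *: u)) //.
  apply/funext => s; congr F; rewrite scalerDl addrA half /u scalerA.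
  by rewrite -mulrA mulVf ?mulr1.
by have := (is_cderive_line F p w 0 _).1 D3; rewrite scale0r addr0.
Qed.

Lemma invariant_field_parallel xi : invariant_field xi -> parallel_field xi.
Proof.
move=> inv; apply: parallel_field_intro => c ac.
have [Gam TG] := DT_chart ac; have [Gs HDT _] := TG.
pose p x := comp10 c (xi x).
have oc := chart_open ac.
have sp k : smooth_fun (chart_dom c) (fun x => p x ord0 k).
  apply: (smooth_fun_chart ac oc (@subset_refl _ _)).
  apply: (total_ode_smooth (A := fun q a => - nabla_mx (Gam (chart_inv c q)) (delta_mx ord0 a))
    (eta := fun q => p (chart_inv c q)) (chart_image_open ac)).
  - move=> a j l.
    have sG m : csmooth_on (chart_image c) (fun q => (Gam (chart_inv c q)) m j l).
      by have := Gs m j l c ac; rewrite setIid.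
    rewrite (_ : (fun q => _) = fun q => - \sum_m (((delta_mx ord0 a : 'rV[C]_N) ord0 (lshift n m) +
       'i%C * (delta_mx ord0 a : 'rV[C]_N) ord0 (rshift n m)) * Gam (chart_inv c q) m j l)); last first.
      by apply/funext => q; rewrite mxE summxE; congr (- _); apply: eq_bigr => m _; rewrite mxE.
    have oi := chart_image_open ac.
    apply: csmoothN => //; apply: csmooth_sum => // m _; apply: csmoothM => //; exact: csmooth_cst.
  - move=> q w l im; have := invariant_field_ode w l inv ac TG im.
    rewrite [X in is_cderive _ _ _ X](_ : _ = (p (chart_inv c q) *m
      \sum_a (w ord0 a)%:C *: - nabla_mx (Gam (chart_inv c q)) (delta_mx ord0 a)) ord0 l) //.
    rewrite nabla_mx_delta -[LHS]mulN1r.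
    rewrite [in RHS](eq_bigr (fun a => - ((w ord0 a)%:C *: nabla_mx (Gam (chart_inv c q)) (delta_mx ord0 a)))); last first.
      by move=> a _; rewrite scalerN.
    rewrite sumrN mulmxN [RHS]mxE mulN1r; congr (- (_ *m _) _ _).
    by apply: eq_bigr => a _; rewrite mxE.
exists Gam, p; split=> //.
- by move=> x cx; rewrite /p vec10_comp //; case: inv.
- move=> x u cx; apply/rowP => k.
  have im : chart_image c (chart_map c x) by exists x.
  have H a : cpart c a (fun y => p y ord0 k) x = - (p x *m nabla_mx (Gam x) (delta_mx ord0 a)) ord0 k.
    have [_] := invariant_field_ode (delta_mx ord0 a) k inv ac TG im.
    rewrite chart_mapK // => H; rewrite [LHS]H.
    by congr (- (_ *m nabla_mx _ _) _ _); apply/rowP => j; rewrite !mxE rmorph_nat.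
  rewrite /nabla [LHS]mxE [X in X + _]mxE /cdir.
  rewrite (eq_bigr (fun a => - (u ord0 a * (p x *m nabla_mx (Gam x) (delta_mx ord0 a)) ord0 k))); last first.
    by move=> a _; rewrite H mulrN.
  rewrite sumrN nabla_mx_delta mulmx_sumr summxE mxE.
  apply/eqP; rewrite addrC subr_eq0; apply/eqP; apply: eq_bigr => a _.
  by rewrite -scalemxAr mxE.
Qed.

(** Choice picks a transport of [v] to each point; as [v] is fixed by the holonomy, the result does
    not depend on the path, which gives invariance. *)
Lemma hol_fixed_extend x v : connected [set: M] -> hol_fixed DT x v ->
  exists2 xi, parallel_field xi & xi x = v.
Proof.
move=> cM fv; have [Tv _] := fv.
have /choice[xi Hxi] : forall y, exists w, transports DT x v y w.
  by move=> y; exact: transports_exists.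
exists xi; last exact: (transports_fixed DT_chart fv (Hxi x)).
apply: invariant_field_parallel; split=> [y|y z w yz].
  by case: (transports_T10 (Hxi y)).
apply: (transports_unique DT_chart fv _ (Hxi z)).
exact: (transports_trans DT_chart (Hxi y) yz).
Qed.

(** Induction on the generation of the group: a loop is a path to which invariance applies, and an
    inverse [k] of [h] satisfies [k (h v) = v] with [h v = v]. *)
Lemma parallel_field_fixed xi x : parallel_field xi -> hol_fixed DT x (xi x).
Proof.
move=> pf; have [Txi inv] := parallel_field_invariant pf; split=> // h.
elim=> {h} [gamma h [[I [oI II cg sg]] g0 g1] Hh|//|h k _ hE _ kE|h k _ hE kh] /=.
- have [Y [Y0 Y1 TY cY]] := Hh _ (Txi x).
  apply: (inv x x); exists I, gamma, Y; split=> // t t01.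
  by split; [exact: TY|exact: cY].
- by rewrite kE hE.
- by have [_ _] := kh _ (Txi x); rewrite hE.
Qed.

Lemma parallel_field_unique xi eta x : connected [set: M] -> parallel_field xi -> parallel_field eta ->
  xi x = eta x -> xi = eta.
Proof.
move=> cM /parallel_field_invariant[Txi ixi] /parallel_field_invariant[_ ieta] E.
apply/funext => y; have [w xw] := transports_exists DT_chart y cM (Txi x).
by rewrite -(ixi x y w xw) -(ieta x y w) // -E.
Qed.

Lemma parallel_field_lin (r : nat) (a : 'I_r -> C) (xi : 'I_r -> vfield M) :
  (forall i, parallel_field (xi i)) -> parallel_field (fun x => \sum_i a i *: xi i x).
Proof.
move=> pxi; apply: parallel_field_intro => c ac.
have [Gam TG] := DT_chart ac.
have /choice[p Hp] : forall i, exists p : M -> 'rV[C]_n, [/\ smooth_row (chart_dom c) p,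
    forall x, chart_dom c x -> xi i x = vec10 c x (p x) &
    forall x u, chart_dom c x -> nabla c Gam p x u = 0].
  by move=> i; exact: parallel_field_chart.
have oc := chart_open ac.
have sE k : (fun x => (\sum_i a i *: p i x) ord0 k) = fun x => \sum_i a i * p i x ord0 k.
  by apply/funext => x; rewrite summxE; apply: eq_bigr => i _; rewrite mxE.
have sp i k : smooth_fun (chart_dom c) (fun x => p i x ord0 k) by case: (Hp i).
have sap i k : smooth_fun (chart_dom c) (fun x => a i * p i x ord0 k).
  by apply: smooth_funM => //; exact: smooth_fun_cst.
exists Gam, (fun x => \sum_i a i *: p i x); split=> //.
- by move=> k; rewrite sE; apply: smooth_fun_sum.
- move=> x cx; rewrite vec10_sum; apply: eq_bigr => i _; rewrite vec10Z.
  by have [_ ->] := Hp i.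
- move=> x u cx.
  have nE i : nabla c Gam (p i) x u = 0 by have [_ _ ->] := Hp i.
  transitivity (\sum_i a i *: nabla c Gam (p i) x u); last by rewrite big1 // => i _; rewrite nE scaler0.
  have near_s f : smooth_fun (chart_dom c) f -> smooth_near x f by exact: smooth_near_fun.
  apply/rowP => k; rewrite [LHS]mxE [X in X + _]mxE sE cdir_sum //; last by move=> i _; exact: near_s.
  rewrite mulmx_suml !summxE -big_split /=; apply: eq_bigr => i _.
  rewrite cdirM //; [|exact: near_s (smooth_fun_cst _ _)|exact: near_s].
  by rewrite cdir_cst mul0r add0r -scalemxAl [RHS]mxE [X in _ = _ * X]mxE [X in _ = _ * (X + _)]mxE [X in _ + X = _]mxE mulrDr.
Qed.

Lemma parallel_field_bracket xi eta : parallel_field xi -> parallel_field eta ->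
  parallel_field (bracket xi eta).
Proof.
move=> pxi peta; apply: parallel_field_intro => c ac.
have [Gam TG] := DT_chart ac; have [Gs _ cf] := TG.
have [p [sp pE np]] := parallel_field_chart ac TG pxi.
have [q [sq qE nq]] := parallel_field_chart ac TG peta.
have oc := chart_open ac.
exists Gam, (bracket10 c p q); split=> //.
- exact: bracket10_smooth.
- by move=> x cx; apply: (bracket10_chart (U := chart_dom c)).
- move=> x u cx; apply: (bracket10_parallel (U := chart_dom c)) => //; exact: cf.
Qed.

End ParallelFields.

(** * Bases of subspaces given by a predicate *)

Section LinearAlgebra.
Context {K : fieldType} {n : nat}.

(** Take a matrix of maximal rank among those with row space inside [S]: adjoining a row from [S]
    cannot raise the rank. *)
Lemma subspace_row_base (S : 'rV[K]_n -> Prop) : S 0 ->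
  (forall a p q, S p -> S q -> S (a *: p + q)) ->
  exists r (B : 'M[K]_(r, n)), row_free B /\ forall p, S p <-> (p <= B)%MS.
Proof.
move=> S0 SL.
pose rk r := `[< exists m (B : 'M[K]_(m, n)), \rank B = r /\ forall p : 'rV_n, (p <= B)%MS -> S p >].
have rk0 : exists r, rk r.
  exists 0%N; apply/asboolP; exists n, (0 : 'M[K]_n); split; first exact: mxrank0.
  by move=> p; rewrite submx0 => /eqP ->.
have rkn r : rk r -> (r <= n)%N by move=> /asboolP[m [B [<- _]]]; exact: rank_leq_col.
case: (ex_maxnP rk0 rkn) => r /asboolP[m [B [rB SB]]] maxr.
exists (\rank B), (row_base B); split; first exact: row_base_free.
move=> p; rewrite eq_row_base; split=> [Sp|]; last exact: SB.
have sB : (B <= B + p)%MS by exact: addsmxSl.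
have rk' : rk (\rank (B + p)%MS).
  apply/asboolP; exists n, (B + p)%MS; split=> // q /sub_addsmxP[[u a] /= ->].
  rewrite [a]mx11_scalar mul_scalar_mx addrC; apply: SL => //.
  by apply: SB; exact: submxMl.
have le1 := maxr _ rk'; have le2 := mxrankS sB; rewrite -rB in le1.
have eqr : \rank B == \rank (B + p)%MS by rewrite eqn_leq le1 le2.
have := mxrank_leqif_sup sB; move=> [_]; rewrite eqr => /esym sB'.
exact: submx_trans (addsmxSr B p) sB'.
Qed.

End LinearAlgebra.

(** * Integrability of the distribution and its structure constants *)

Section Main.
Context {R : realType} {n : nat} {M : complexManifold R n}.
Local Notation C := R[i].
Local Notation N := (n + n)%N.
Implicit Types (c : chart R n M) (U W : set M) (f : M -> C) (x y z : M) (v w : tvec M) (xi : vfield M).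

Lemma smooth_fun_prod U (I : Type) (r : seq I) (F : I -> M -> C) : open U ->
  (forall i, smooth_fun U (F i)) -> smooth_fun U (fun x => \prod_(i <- r) F i x).
Proof.
move=> oU sF; elim: r => [|i r IH].
  by apply: smooth_fun_eq (smooth_fun_cst U 1) => x; rewrite big_nil.
by apply: smooth_fun_eq (smooth_funM oU (sF i) IH) => x; rewrite big_cons.
Qed.

Lemma smooth_fun_det U m (A : M -> 'M[C]_m) : open U ->
  (forall i j, smooth_fun U (fun x => A x i j)) -> smooth_fun U (fun x => \det (A x)).
Proof.
move=> oU sA; rewrite /determinant; apply: smooth_fun_sum => // s _.
apply: smooth_funM => //; first exact: smooth_fun_cst.
by apply: smooth_fun_prod.
Qed.

(** The adjugate, unlike the inverse, is polynomial in the entries, hence smooth also where the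
    determinant vanishes. *)
Lemma smooth_fun_adj U m (A : M -> 'M[C]_m) i j : open U ->
  (forall i j, smooth_fun U (fun x => A x i j)) -> smooth_fun U (fun x => (\adj (A x)) i j).
Proof.
move=> oU sA; apply: (@smooth_fun_eq _ _ _ _ (fun x => cofactor (A x) j i)).
  by move=> x; rewrite mxE.
apply: smooth_funM => //; first exact: smooth_fun_cst.
apply: smooth_fun_det => // k l.
by apply: smooth_fun_eq (sA (lift j k) (lift i l)) => x; rewrite !mxE.
Qed.

Lemma smooth_fun_mulmx U m p q (A : M -> 'M[C]_(m, p)) (B : M -> 'M[C]_(p, q)) : open U ->
  (forall i j, smooth_fun U (fun x => A x i j)) -> (forall i j, smooth_fun U (fun x => B x i j)) ->
  forall i j, smooth_fun U (fun x => (A x *m B x) i j).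
Proof.
move=> oU sA sB i j; apply: (@smooth_fun_eq _ _ _ _ (fun x => \sum_k A x i k * B x k j)).
  by move=> x; rewrite mxE.
by apply: smooth_fun_sum => // k _; apply: smooth_funM.
Qed.

Variable DT : vfield M -> vfield M -> vfield M.
Hypothesis DT_chart : forall c, atlas c -> exists Gam, torsion_chart DT c Gam.
Hypothesis connM : connected [set: M].

Local Notation F := (hol_fixed DT).

(** Linearity of the holonomy maps is not built into [holonomy]; that of the fibre is taken from
    parallel extensions, whose combinations are parallel. *)
Lemma hol_fixed_lin x a v w : F x v -> F x w -> F x (a *: v + w).
Proof.
move=> /(hol_fixed_extend DT_chart connM)[xi pxi <-] /(hol_fixed_extend DT_chart connM)[eta peta <-].
pose b (i : 'I_2) : C := if i == ord0 then a else 1.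
pose z (i : 'I_2) := if i == ord0 then xi else eta.
have pz i : parallel_field DT (z i) by rewrite /z; case: ifP.
have := parallel_field_fixed DT_chart x (parallel_field_lin DT_chart b pz).
by rewrite big_ord_recl big_ord1 /b /z /= scale1r.
Qed.

Lemma hol_fixed_vec10 c x a (p q : 'rV[C]_n) : F x (vec10 c x p) -> F x (vec10 c x q) ->
  F x (vec10 c x (a *: p + q)).
Proof. by move=> Fp Fq; rewrite vec10D vec10Z; exact: hol_fixed_lin. Qed.

Lemma hol_fixed_section10 U X : section_in F U X -> section10 U X.
Proof. by move=> [cX FX]; split=> // x Ux; case: (FX x Ux). Qed.

(* If [P y] has independent rows at [x], with right inverse [Q] there, the columns of
   [det (P Q) Z - Q adj (P Q) P Z] are killed by [P] identically and extend those of [Z] from [x]. *)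
Lemma nabla_hol_fixed c Gam U (q : M -> 'rV[C]_n) x u : atlas c -> torsion_chart DT c Gam ->
  open U -> U `<=` chart_dom c -> U x ->
  smooth_row U q -> (forall y, U y -> F y (vec10 c y (q y))) ->
  F x (vec10 c x (nabla c Gam q x u)).
Proof.
move=> ac TG oU Uc Ux sq Fq; have cx := Uc x Ux.
have vec00 : vec10 c x 0 = 0 by have := vec10Z c x 0 0; rewrite !scale0r.
have F0 : F x (vec10 c x 0).
  by have := hol_fixed_lin (-1) (Fq x Ux) (Fq x Ux); rewrite scaleN1r addNr vec00.
(* The rows of [B] are a basis of the fibre at [x], in components; their parallel extensions become
   the rows of [P]. *)
have [|r [B [fB SB]]] := subspace_row_base (S := fun p => F x (vec10 c x p)) F0.
  by move=> a p p'; exact: hol_fixed_vec10.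
have [Q BQ] := row_freeP fB.
have /choice[xi Hxi] : forall i : 'I_r, exists xi, parallel_field DT xi /\ xi x = vec10 c x (row i B).
  move=> i; have [|xi pxi xiE] := hol_fixed_extend DT_chart connM (x := x) (v := vec10 c x (row i B)).
    by apply/SB; exact: row_sub.
  by exists xi.
have /choice[p Hp] : forall i, exists p : M -> 'rV[C]_n,
    [/\ smooth_row (chart_dom c) p,
    forall x, chart_dom c x -> xi i x = vec10 c x (p x) &
    forall x u, chart_dom c x -> nabla c Gam p x u = 0].
  by move=> i; exact: (parallel_field_chart ac TG (Hxi i).1).
pose P y : 'M[C]_(r, n) := \matrix_(i, k) p i y ord0 k.
have PxE : P x = B.
  apply/row_matrixP => i; apply/rowP => k; rewrite !mxE.
  have [_ pE _] := Hp i; have := (Hxi i).2; rewrite pE // => /(congr1 (comp10 c)).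
  by rewrite !comp10K // => ->; rewrite mxE.
have sP i k : smooth_fun U (fun y => P y i k).
  have [/(_ k) H _ _] := Hp i; apply: smooth_fun_eq (smooth_fun_sub Uc H) => y; by rewrite mxE.
(* A parallel extension of [w] is a combination of the [xi i] at [x], hence everywhere with the same
   coefficients; so the rows of [P y] span the fibre at [y]. *)
have spanP y (w : 'rV[C]_n) : U y -> F y (vec10 c y w) -> exists a : 'rV[C]_r, w = a *m P y.
  move=> Uy /(hol_fixed_extend DT_chart connM)[eta peta etaE].
  have [p' [_ p'E _]] := parallel_field_chart ac TG peta.
  have /SB/submxP[a aE] : F x (vec10 c x (p' x)).
    by rewrite -p'E //; exact: parallel_field_fixed.
  exists a.
  have E : eta = fun z => \sum_i a ord0 i *: xi i z.
    apply: (parallel_field_unique DT_chart (x := x) connM peta).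
      by apply: parallel_field_lin => // i; case: (Hxi i).
    rewrite p'E // aE mulmx_sum_row vec10_sum; apply: eq_bigr => i _.
    by rewrite vec10Z (Hxi i).2.
  rewrite -(comp10K w ac (Uc y Uy)) -etaE E.
  rewrite (eq_bigr (fun i => vec10 c y (a ord0 i *: row i (P y)))) => [|i _].
    by rewrite -vec10_sum comp10K ?mulmx_sum_row //; exact: Uc.
  rewrite vec10Z; have [_ -> //] := Hp i; last exact: Uc.
  by move=> _; congr (_ *: vec10 _ _ _); apply/rowP => k; rewrite !mxE.
pose Z := cokermx B.
pose L y : 'M[C]_n := \det (P y *m Q) *: Z - Q *m \adj (P y *m Q) *m (P y *m Z).
have PL y : P y *m L y = 0.
  have E : P y *m (Q *m \adj (P y *m Q) *m (P y *m Z)) = P y *m Q *m \adj (P y *m Q) *m (P y *m Z).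
    by rewrite !mulmxA.
  by rewrite /L mulmxBr E mul_mx_adj mul_scalar_mx -scalemxAr subrr.
have LxE : L x = Z.
  by rewrite /L PxE BQ det1 scale1r mulmx_coker mulmx0 subr0.
have sQ : forall i j, smooth_fun U (fun y => (P y *m Q) i j).
  by apply: smooth_fun_mulmx => // i j; exact: smooth_fun_cst.
have sL k j : smooth_fun U (fun y => L y k j).
  have sadj i l : smooth_fun U (fun y => \adj (P y *m Q) i l) by exact: smooth_fun_adj.
  have sPZ i l : smooth_fun U (fun y => (P y *m Z) i l).
    by apply: smooth_fun_mulmx => // i' l'; exact: smooth_fun_cst.
  have sQa i l : smooth_fun U (fun y => (Q *m \adj (P y *m Q)) i l).
    by apply: smooth_fun_mulmx => // i' l'; exact: smooth_fun_cst.
  have s1 : smooth_fun U (fun y => \det (P y *m Q) * Z k j).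
    by apply: smooth_funM => //; [exact: smooth_fun_det|exact: smooth_fun_cst].
  have s2 : smooth_fun U (fun y => (Q *m \adj (P y *m Q) *m (P y *m Z)) k j).
    exact: smooth_fun_mulmx.
  apply: smooth_fun_eq (smooth_funD oU s1 (smooth_funN oU s2)) => y.
  by rewrite [LHS]mxE [X in X + _ = _]mxE [X in _ + X = _]mxE.
(* A parallel section through [q x]: the connection terms at [x] being equal, [nabla] of [q] there
   is the difference of the derivatives of [q] and [q']. *)
have [eta peta etaE] := hol_fixed_extend DT_chart connM (Fq x Ux).
have [q' [sq' q'E nq']] := parallel_field_chart ac TG peta.
have qx : q' x = q x.
  have := etaE; rewrite q'E // => /(congr1 (comp10 c)).
  by rewrite !comp10K.
have near_s f : smooth_fun U f -> smooth_near x f by exact: smooth_near_fun.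
(* Differentiating [s L = 0] at [x] expresses [ds Z] through [s x] alone, so it is the same for [q]
   and [q']. *)
have kill (s : M -> 'rV[C]_n) j : smooth_row U s ->
    (forall y, U y -> F y (vec10 c y (s y))) ->
    \sum_k cdir c u (fun y => s y ord0 k) x * Z k j = - \sum_k s x ord0 k * cdir c u (fun y => L y k j) x.
  move=> ss Fs; apply/eqP; rewrite -addr_eq0 -big_split /=; apply/eqP.
  transitivity (cdir c u (fun y => \sum_k s y ord0 k * L y k j) x).
    rewrite cdir_sum //; last by move=> k _; apply: near_s; apply: smooth_funM.
    by apply: eq_bigr => k _; rewrite cdirM ?LxE //; exact: near_s.
  transitivity (cdir c u (fun=> 0) x); last exact: cdir_cst.
  apply: cdir_near => //; apply: (filterS _ (open_nbhs_nbhs (conj oU Ux))) => y Uy.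
  have [a aE] := spanP y (s y) Uy (Fs y Uy).
  transitivity ((s y *m L y) ord0 j); first by rewrite mxE.
  by rewrite aE -mulmxA PL mulmx0 mxE.
apply/SB; rewrite submxE; apply/eqP/rowP => j; rewrite [RHS]mxE.
have nE k : nabla c Gam q x u ord0 k = cdir c u (fun y => q y ord0 k) x - cdir c u (fun y => q' y ord0 k) x.
  have /rowP/(_ k) := nq' x u cx; rewrite /nabla [LHS]mxE [X in X + _]mxE [RHS]mxE qx => /eqP.
  by rewrite addrC addr_eq0 => /eqP H; rewrite [LHS]mxE [X in X + _]mxE H.
transitivity (\sum_k cdir c u (fun y => q y ord0 k) x * Z k j - \sum_k cdir c u (fun y => q' y ord0 k) x * Z k j).
  by rewrite [LHS]mxE -sumrB; apply: eq_bigr => k _; rewrite nE mulrBl.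
rewrite !kill ?qx ?subrr //.
  by move=> k; exact: smooth_fun_sub (sq' k).
by move=> y Uy; rewrite -q'E; [exact: parallel_field_fixed|exact: Uc].
Qed.

Lemma hol_fixed_frobenius : frobenius_integrable F.
Proof.
move=> U X Y oU sX sY; split.
  by apply: bracket_csection => //; [case: sX|case: sY].
move=> x Ux; have [c ac cx] := atlas_cover x.
have [Gam TG] := DT_chart ac.
pose W := U `&` chart_dom c.
have oW : open W by apply: openI => //; exact: chart_open.
have Wc : W `<=` chart_dom c by move=> z [].
have WU : W `<=` U by move=> z [].
have Wx : W x by [].
have [p [sp pE]] := section10_chart ac Wc (section10_sub WU (hol_fixed_section10 sX)).
have [q [sq qE]] := section10_chart ac Wc (section10_sub WU (hol_fixed_section10 sY)).
have Fp y : W y -> F y (vec10 c y (p y)) by move=> Wy; rewrite -pE //; apply: sX.2; exact: WU.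
have Fq y : W y -> F y (vec10 c y (q y)) by move=> Wy; rewrite -qE //; apply: sY.2; exact: WU.
rewrite (bracket10_chart ac oW Wc Wx sp sq pE qE) (bracket10E c Gam).
have [xi pxi xiE] := hol_fixed_extend DT_chart connM (Fp x Wx).
have [eta peta etaE] := hol_fixed_extend DT_chart connM (Fq x Wx).
have [p' [sp' p'E np']] := parallel_field_chart ac TG pxi.
have [q' [sq' q'E nq']] := parallel_field_chart ac TG peta.
have px : p' x = p x.
  by have := xiE; rewrite p'E // => /(congr1 (comp10 c)); rewrite !comp10K.
have qx : q' x = q x.
  by have := etaE; rewrite q'E // => /(congr1 (comp10 c)); rewrite !comp10K.
have F3 : F x (vec10 c x (p x *m nabla_mx (Gam x) (iota10 (q x)) - q x *m nabla_mx (Gam x) (iota10 (p x)))).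
  have := parallel_field_fixed DT_chart x (parallel_field_bracket DT_chart pxi peta).
  rewrite (bracket10_chart ac (chart_open ac) (@subset_refl _ _) cx sp' sq' p'E q'E) (bracket10E c Gam).
  by rewrite (np' x _ cx) (nq' x _ cx) subrr add0r px qx.
have F1 := nabla_hol_fixed (iota10 (p x)) ac TG oW Wc Wx sq Fq.
have F2 := nabla_hol_fixed (iota10 (q x)) ac TG oW Wc Wx sp Fp.
have F4 := hol_fixed_vec10 1 F1 (hol_fixed_vec10 (-1) F2 F3).
by rewrite scale1r scaleN1r addrA in F4.
Qed.

Lemma structure_constants r (xi : 'I_r -> vfield M) : is_frame F xi ->
  (forall i, parallel_section DT (xi i)) ->
  exists c : 'I_r -> 'I_r -> 'I_r -> C,
    forall i j x, bracket (xi i) (xi j) x = \sum_k c i j k *: xi k x.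
Proof.
move=> [sxi fr] pxi.
(* If [M] is empty there is no base point, and any constants will do. *)
have [[x0 _]|nM] := pselect (exists x0 : M, True); last first.
  by exists (fun _ _ _ => 0) => i j x; case: nM; exists x.
have pf i : parallel_field DT (xi i) by split=> //; exact: hol_fixed_section10.
have pb i j := parallel_field_bracket DT_chart (pf i) (pf j).
have /choice[c Hc] : forall ij : 'I_r * 'I_r, exists a : 'I_r -> C,
    bracket (xi ij.1) (xi ij.2) x0 = \sum_k a k *: xi k x0.
  by move=> [i j]; apply: (fr x0).2; exact: parallel_field_fixed (pb i j).
exists (fun i j => c (i, j)) => i j x.
have E := parallel_field_unique DT_chart (x := x0) connM (pb i j)
  (parallel_field_lin DT_chart (c (i, j)) pf) (Hc (i, j)).
by rewrite E.
Qed.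

End Main.

Theorem proposition3p6 (R : realType) (n : nat) (M : complexManifold R n)
    (g : M -> tvec M -> tvec M -> R) (D : vfield M -> vfield M -> vfield M) :
  connected [set: M] ->
  hermitian_metric g ->
  chern_connection g D ->
  let DT := complexify (torsion_twisted D) in
  let F := hol_fixed DT in
  frobenius_integrable F /\
  (forall (r : nat) (xi : 'I_r -> vfield M),
    is_frame F xi ->
    (forall i, parallel_section DT (xi i)) ->
    exists c : 'I_r -> 'I_r -> 'I_r -> R[i],
      forall i j x, bracket (xi i) (xi j) x = \sum_k c i j k *: xi k x).
Proof.
move=> connM metricg chernD DT F.
have DT_chart (c : chart R n M) : atlas c -> exists Gam, torsion_chart DT c Gam.
  by move=> ac; exact: chern_torsion_chart metricg chernD.
split; first exact: hol_fixed_frobenius.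
by move=> r xi; exact: structure_constants.
Qed.
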